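(* Let $\alpha\in(0,1)$ be fixed. The problem of deciding, given an $\alpha$-ICD instance and a nonnegative integer $c$, whether the instance has an exact solution using at most $c$ cuts (equivalently, determining the minimum number of cuts needed for an exact solution of a given instance) is $\mathsf{NP}$-hard.
   Context: $\alpha$-ICD: an instance with $n$ agents consists of $n$ probability measures $\mu_1,\dots,\mu_n$ on $[0,1]$ given explicitly as piecewise-constant densities (step functions). A solution with $c$ cuts is given by cut points $0<t_1<\dots<t_c<1$ partitioning $[0,1]$ into $c+1$ subintervals, each labelled ''$+$'' or ''$-$''; $A_+$ is the union of the ''$+$'' subintervals; it is exact if $\mu_i(A_+)=\alpha$ for all $i\in[n]$. *)

(* Defs.v *)
From HB Require Import structures.
From mathcomp Require Import all_boot all_order all_algebra.
From mathcomp Require Import all_classical all_reals all_analysis.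

Set Implicit Arguments.
Unset Strict Implicit.
Unset Printing Implicit Defensive.

Import Order.TTheory GRing.Theory Num.Theory.

Local Open Scope classical_set_scope.
Local Open Scope ring_scope.

(** * Turing machines and NP-hardness *)

Definition word := seq bool.

Inductive move := MoveL | MoveN | MoveR.

(** Deterministic multi-tape machines with [tm_tapes.+1] two-way infinite
    tapes.  The tape alphabet is [{blank, 0, 1}] plus the finite set [tm_aux]:
    see [tm_sym]. *)
Record TM := {
  tm_state : finType;
  tm_aux : finType;
  tm_tapes : nat;
  tm_start : tm_state;
  tm_halt : pred tm_state;
  tm_trans : tm_state -> {ffun 'I_tm_tapes.+1 -> option (bool + tm_aux)} ->
    tm_state * {ffun 'I_tm_tapes.+1 -> option (bool + tm_aux) * move}
}.

(** [None] is the blank, [Some (inl b)] the input/output bit [b]. *)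
Definition tm_sym (M : TM) := option (bool + tm_aux M).

(** A tape is a pair [(l, r)]: [r] is read from the scanned cell rightwards,
    [l] from the cell left of it leftwards; both are continued by blanks. *)
Definition tape (M : TM) := (seq (tm_sym M) * seq (tm_sym M))%type.

Definition scanned M (t : tape M) : tm_sym M := head None t.2.

Definition write_move M (t : tape M) (am : tm_sym M * move) : tape M :=
  match am.2 with
  | MoveL => (behead t.1, head None t.1 :: am.1 :: behead t.2)
  | MoveN => (t.1, am.1 :: behead t.2)
  | MoveR => (am.1 :: t.1, behead t.2)
  end.

Definition config (M : TM) :=
  (tm_state M * {ffun 'I_(tm_tapes M).+1 -> tape M})%type.

Definition tm_step M (c : config M) : config M :=
  if tm_halt c.1 then c else
  let qa := tm_trans c.1 [ffun i => scanned (c.2 i)] in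
  (qa.1, [ffun i => write_move (c.2 i) (qa.2 i)]).

(** The [i]-th argument is written on the [i]-th tape. *)
Definition tm_init M (args : seq word) : config M :=
  (tm_start M, [ffun i : 'I_(tm_tapes M).+1 =>
    ([::], [seq Some (inl b) | b <- nth [::] args i])]).

Fixpoint leading_bits (A : Type) (s : seq (option (bool + A))) : word :=
  if s is Some (inl b) :: s' then b :: leading_bits s' else [::].

(** The output is the maximal block of bits starting at the head of tape 0. *)
Definition tm_outputs (M : TM) (args : seq word) (time : nat) (out : word) :=
  let c := iter time (@tm_step M) (tm_init M args) in
  tm_halt c.1 /\ leading_bits (c.2 ord0).2 = out.

Definition polytime_function (f : word -> word) : Prop :=
  exists (M : TM) (p : {poly nat}),
    forall x, tm_outputs M [:: x] p.[size x] (f x).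

Definition polytime_relation (V : word -> word -> bool) : Prop :=
  exists (M : TM) (p : {poly nat}),
    forall x y, tm_outputs M [:: x; y] p.[(size x + size y)%N] [:: V x y].

Definition NP (L : set word) : Prop :=
  exists V : word -> word -> bool, polytime_relation V /\
  exists p : {poly nat},
    forall x, L x <-> exists y, (size y <= p.[size x])%N /\ V x y.

Definition polytime_reducible (L1 L2 : set word) : Prop :=
  exists f, polytime_function f /\ forall x, L1 x <-> L2 (f x).

Definition NP_hard (L : set word) : Prop :=
  forall L', NP L' -> polytime_reducible L' L.

(** * Instances *)

(** [(p, q)] stands for p / q, not necessarily in lowest terms. *)
Definition fraction := (nat * nat)%type.

(** The list [(x_1, v_1), ..., (x_m, v_m)] describes the density with value
    [v_j] between [x_(j-1)] and [x_j], where [x_0 = 0]. *)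
Definition step_function := seq (fraction * fraction).

Definition instance := seq step_function.

Definition fraction_val (R : realType) (u : fraction) : R := u.1%:R / u.2%:R.

Fixpoint density (R : realType) (s : step_function) (x : R) : R :=
  if s is (b, v) :: s' then
    if x <= fraction_val R b then fraction_val R v else density s' x
  else 0.

Definition agent_measure (R : realType) (s : step_function) (A : set R) :
    \bar R :=
  (\int[lebesgue_measure]_(x in A `&` `[0%R, 1%R]) (density s x)%:E)%E.

Definition valid_agent (R : realType) (s : step_function) : Prop :=
  [/\ all (fun bv => (0 < bv.1.2)%N && (0 < bv.2.2)%N) s,
      path <%R 0 [seq fraction_val R bv.1 | bv <- s],
      last 0 [seq fraction_val R bv.1 | bv <- s] = 1 &
      agent_measure s [set: R] = 1%E].

Definition valid_instance (R : realType) (I : instance) : Prop :=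
  forall s, s \in I -> valid_agent R s.

(** * Solutions *)

Definition cuts (R : realType) (t : seq R) : Prop := path <%R 0 (rcons t 1).

(** [lab] lists the labels of the [size t + 1] subintervals from left to
    right, [true] being "+". *)
Definition plus_part (R : realType) (t : seq R) (lab : seq bool) : set R :=
  \bigcup_(i in [set i | nth false lab i])
    `[nth 0 (0 :: rcons t 1) i, nth 0 (rcons t 1) i]%classic.

Definition exact_solution (R : realType) (alpha : R) (I : instance)
    (t : seq R) (lab : seq bool) : Prop :=
  [/\ cuts t, size lab = (size t).+1 &
      forall s, s \in I -> agent_measure s (plus_part t lab) = alpha%:E].

(** * Binary encoding of the input *)

(** Binary digits, least significant first. *)
Definition bits (n : nat) : word :=
  mkseq (fun i => odd (n %/ 2 ^ i)) (trunc_log 2 n).+1.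

(** Every item is preceded by [true]; [false] marks the end of the list. *)
Definition enc_seq (A : Type) (enc : A -> word) (s : seq A) : word :=
  flatten [seq true :: enc a | a <- s] ++ [:: false].

Definition enc_nat (n : nat) : word := enc_seq (fun b => [:: b]) (bits n).

Definition enc_fraction (u : fraction) : word := enc_nat u.1 ++ enc_nat u.2.

Definition enc_piece (bv : fraction * fraction) : word :=
  enc_fraction bv.1 ++ enc_fraction bv.2.

Definition encode (I : instance) (c : nat) : word :=
  enc_seq (enc_seq enc_piece) I ++ enc_nat c.

(** Only well-formed encodings of valid instances belong to the language. *)
Definition ICD (R : realType) (alpha : R) : set word :=
  [set w | exists (I : instance) (c : nat),
    [/\ w = encode I c, valid_instance R I &
        exists t lab, (size t <= c)%N /\ exact_solution alpha I t lab]].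

(** [encode] is unambiguous. *)

Local Open Scope nat_scope.

Definition prefix_code (A : Type) (enc : A -> word) : Prop :=
  forall a b u v, enc a ++ u = enc b ++ v -> a = b /\ u = v.

Lemma prefix_code_seq (A : Type) (enc : A -> word) :
  prefix_code enc -> prefix_code (enc_seq enc).
Proof.
move=> encP.
have encE a s u :
    enc_seq enc (a :: s) ++ u = true :: enc a ++ (enc_seq enc s ++ u).
  by rewrite /enc_seq /= !catA.
elim=> [|a s IHs] [|b s'] u v; rewrite ?encE //=; first by case.
by case=> /encP[-> eq_uv]; have [-> ->] := IHs _ _ _ eq_uv.
Qed.

Lemma bits_inj : injective bits.
Proof.
have digitP m i : odd (m %/ 2 ^ i) = nth false (bits m) i.
  have [lt_im|le_mi] := ltnP i (trunc_log 2 m).+1; first by rewrite nth_mkseq.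
  rewrite nth_default ?size_mkseq// divn_small//.
  exact: leq_trans (trunc_log_ltn m (isT : 1 < 2)) (leq_pexp2l (isT : 0 < 2) le_mi).
move=> m n eq_mn.
have {}eq_mn i : odd (m %/ 2 ^ i) = odd (n %/ 2 ^ i) by rewrite !digitP eq_mn.
elim/ltn_ind: m n eq_mn => m IHm n eq_mn.
have /= := eq_mn 0; rewrite expn0 !divn1 => odd_mn.
have half_mn i : odd (m./2 %/ 2 ^ i) = odd (n./2 %/ 2 ^ i).
  by rewrite -!divn2 -!divnMA -!expnS.
case: m => [|m] in IHm eq_mn odd_mn half_mn *.
  case: n => // n in eq_mn odd_mn half_mn *.
  have := eq_mn (trunc_log 2 n.+1); rewrite div0n digitP.
  rewrite -digitP (_ : n.+1 %/ _ = 1)//.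
  have /andP[le_n lt_n] := trunc_log_bounds (isT : 1 < 2) (ltn0Sn n).
  apply/eqP; rewrite eqn_leq -ltnS ltn_divLR ?expn_gt0//.
  by rewrite -expnS lt_n divn_gt0 ?expn_gt0.
rewrite -(odd_double_half m.+1) -(odd_double_half n) odd_mn.
by rewrite (IHm m.+1./2 _ n./2)// -divn2 ltn_Pdiv.
Qed.

Lemma prefix_code_nat : prefix_code enc_nat.
Proof.
have bitP : prefix_code (fun b : bool => [:: b]) by move=> a b u v [-> ->].
by move=> m n u v /(prefix_code_seq bitP)[/bits_inj].
Qed.

Lemma prefix_code_pair (A B : Type) (enc : A -> word) (enc' : B -> word) :
  prefix_code enc -> prefix_code enc' ->
  prefix_code (fun ab => enc ab.1 ++ enc' ab.2).
Proof.
move=> encP encP' [a b] [a' b'] u v /=; rewrite -!catA => eq_uv.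
have [-> eq_uv'] := encP _ _ _ _ eq_uv.
by have [-> ->] := encP' _ _ _ _ eq_uv'.
Qed.

Lemma prefix_code_piece : prefix_code enc_piece.
Proof.
have fracP := prefix_code_pair prefix_code_nat prefix_code_nat.
exact: (prefix_code_pair fracP fracP).
Qed.

Lemma encode_inj (I I' : instance) (c c' : nat) :
  encode I c = encode I' c' -> I = I' /\ c = c'.
Proof.
move=> eq_w; have [] // := prefix_code_pair
  (prefix_code_seq (prefix_code_seq prefix_code_piece)) prefix_code_nat
  (a := (I, c)) (b := (I', c')) (u := [::]) (v := [::]).
  by rewrite !cats0.
by case.
Qed.

(* Main.v *)
(* Acceptance of a nondeterministic computation is first expressed by
   constraints "exactly one of the equations [u n = t] listed here holds", for
   variables [u 0], ..., [u (N - 1)] with values below a constant [k]: every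
   cell of a space-time tableau is a variable, and [f (u n) = g (u m)] says
   that for each [c] exactly one of [f (u n) = c] and [g (u m) <> c] holds.

   Choose [k] and [w] with [alpha (k + w) = w + beta], [0 < beta < 1], and
   place integer masses of total [k + w] on disjoint slots of dyadic length, in
   particular on two consecutive slots for each pair [(n, t)].  A measure with
   integer masses has an integral positive part unless one of its slots is cut.
   There are 2N + 1 measures with disjoint supports: one on a single slot, and
   two for each variable [n], one on the first slots of the pairs [(n, t)] and
   one on the second slots.  With 2N + 1 cuts each of them therefore contains
   exactly one cut.  Further measures make the first and the second slot of
   each pair be cut in the same proportion, so that the cuts of the variable
   [n] lie in the two slots of one pair [(n, u n)] and cancel each other's
   effect on the labels to their right.  A measure with mass 1 on the first
   slots of the pairs in a list, and its remaining mass on slots without cuts,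
   is then balanced if and only if exactly one of these pairs is selected.

   The reduction is programmed with registers holding words and loops bounded
   by their length.  Such a program is compiled to a Turing machine and its
   running time is bounded by a polynomial in the size of the registers. *)

Require Import Defs.
From mathcomp Require Import all_boot all_order all_algebra.
From mathcomp Require Import all_classical all_reals all_analysis.
From mathcomp Require Import measurable_realfun zify ring lra.

Set Implicit Arguments.
Unset Strict Implicit.
Unset Printing Implicit Defensive.

Import Order.TTheory GRing.Theory Num.Theory.

Local Open Scope nat_scope.

(** * Structured programs for Turing machines *)

(** The threshold [alpha] is an arbitrary real number, possibly irrational, while an instance is a
    word. Hence [alpha] never enters the computation: the program depends on it only through the
    fixed integers [k] and [w], and soundness uses little more than the fact that [w + beta] is not
    an integer. A solution may label its subintervals in an unexpected way, so soundness cannot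
    assume that the part containing the cells starts with -. The agents of the constraints are
    therefore padded to the same total mass on a slot whose label agrees with that of the uncut cell
    slots; the unknown labels then cancel and only the number of selected pairs remains. Constraints
    of the form exactly one are used because each of them is a single linear equation in the shares
    of the slots. The budget of cuts has no slack: as soon as every forcing agent contains a cut, no
    cut is left for another place, which is what turns a real-valued solution into a discrete
    choice. *)

Notation stream A := (nat -> A).

Definition scons A (a : A) (s : stream A) : stream A :=
  fun i => if i is i'.+1 then s i' else a.
Definition stail A (s : stream A) : stream A := fun i => s i.+1.

(* Tapes with both halves continued by blanks: this identifies the list
   representations that differ by explicit blanks only. *)
Definition stape (A : Type) := (stream (option A) * stream (option A))%type.

Definition tape_stream M (t : tape M) : stape (bool + tm_aux M) :=
  (nth None t.1, nth None t.2).

Definition smove A (t : stape A) (am : option A * move) : stape A :=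
  match am.2 with
  | MoveL => (stail t.1, scons (t.1 0) (scons am.1 (stail t.2)))
  | MoveN => (t.1, scons am.1 (stail t.2))
  | MoveR => (scons am.1 t.1, stail t.2)
  end.

Lemma tape_stream_move M (t : tape M) am :
  tape_stream (write_move t am) = smove (tape_stream t) am.
Proof.
case: t am => [l r] [a []]; rewrite /tape_stream /write_move /smove /=;
  congr pair; apply: funext => i; rewrite /scons /stail ?nth_behead //;
  case: i => [|i] //=; rewrite ?nth_behead ?nth0 //;
  by case: i => [|i] //=; rewrite nth_behead.
Qed.

Lemma scanned_stream M (t : tape M) : scanned t = (tape_stream t).2 0.
Proof. by rewrite /scanned /tape_stream /= nth0. Qed.

Lemma smove_stay A (t : stape A) : smove t (t.2 0, MoveN) = t.
Proof.
by case: t => l r; congr pair; apply: funext => -[|i].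
Qed.

Section Programs.
Variable K : nat.

Notation sym := (option (bool + void)).
Notation reading := {ffun 'I_K.+1 -> sym}.
Notation action := {ffun 'I_K.+1 -> sym * move}.
Notation tapes := ('I_K.+1 -> stape (bool + void)).

(** Structured control flow replaces transition tables, so that runs can be composed from the runs
    of subprograms. Bits and blanks suffice, hence the empty auxiliary alphabet. *)
Inductive prog :=
| Act of (reading -> action)
| Seq of prog & prog
| Cond of pred reading & prog & prog
| While of pred reading & prog.

Fixpoint pstate (p : prog) : finType :=
  match p with
  | Act _ => unit
  | Seq p q => (pstate p + pstate q)%type
  | Cond _ p q => option (pstate p + pstate q)
  | While _ p => option (pstate p)
  end.

Fixpoint pstart (p : prog) : pstate p :=
  match p with
  | Act _ => tt
  | Seq p q => inl (pstart p)
  | Cond _ p q => None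
  | While _ p => None
  end.

Definition stay (v : reading) : action := [ffun i => (v i, MoveN)].

(* In the states of [Cond] and [While], [None] is the evaluation of the test;
   the value [None] of [pnext] is the end of the program. *)
Fixpoint pnext (p : prog) : pstate p -> reading -> option (pstate p) * action :=
  match p return pstate p -> reading -> option (pstate p) * action with
  | Act a => fun _ v => (None, a v)
  | Seq p q => fun s v =>
    match s with
    | inl s => let oa := pnext s v in
        (Some (if oa.1 is Some s' then inl s' else inr (pstart q)), oa.2)
    | inr s => let oa := pnext s v in (omap inr oa.1, oa.2)
    end
  | Cond b p q => fun s v =>
    match s with
    | None => (Some (Some (if b v then inl (pstart p) else inr (pstart q))),
               stay v)
    | Some (inl s) => let oa := pnext s v in
        (omap (fun s' => Some (inl s')) oa.1, oa.2)
    | Some (inr s) => let oa := pnext s v in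
        (omap (fun s' => Some (inr s')) oa.1, oa.2)
    end
  | While b p => fun s v =>
    match s with
    | None => (if b v then Some (Some (pstart p)) else None, stay v)
    | Some s => let oa := pnext s v in (Some oa.1, oa.2)
    end
  end.

Definition reads (C : tapes) : reading := [ffun i => (C i).2 0].
Definition acts (C : tapes) (a : action) : tapes := fun i => smove (C i) (a i).

Definition pstep p (c : option (pstate p) * tapes) : option (pstate p) * tapes :=
  if c.1 is Some s then
    let oa := pnext s (reads c.2) in (oa.1, acts c.2 oa.2)
  else c.

Lemma pstepE p s C : @pstep p (Some s, C) =
  ((pnext s (reads C)).1, acts C (pnext s (reads C)).2).
Proof. by []. Qed.

(** A finished program stays in its final configuration, so [n] is only an upper bound on the number
    of steps. *)
Definition runs p C n C' :=
  iter n (@pstep p) (Some (pstart p), C) = (None, C').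

Lemma iter_pstep_None p n C : iter n (@pstep p) (None, C) = (None, C).
Proof. by elim: n => //= n ->. Qed.

Lemma iter_pstep_leq p n m c C' : n <= m ->
  iter n (@pstep p) c = (None, C') -> iter m (@pstep p) c = (None, C').
Proof.
by move=> le_nm; rewrite -(subnK le_nm) iterD => ->; apply: iter_pstep_None.
Qed.

Lemma runs_leq p C n m C' : n <= m -> runs p C n C' -> runs p C m C'.
Proof. exact: iter_pstep_leq. Qed.

Lemma acts_stay C : acts C (stay (reads C)) = C.
Proof. by apply: funext => i; rewrite /acts !ffunE smove_stay. Qed.

Lemma runs_Act a C : runs (Act a) C 1 (acts C (a (reads C))).
Proof. by []. Qed.

(** Through [phi], [q] imitates [p] until [p] ends, and then passes to [exit]. Since [q] may go on
    afterwards, [m] has to be the exact moment at which [p] ends, whereas [n] is only a bound. *)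
Lemma runs_sub p q (phi : pstate p -> pstate q) (exit : option (pstate q)) :
  (forall s v, pnext (phi s) v =
     (if (pnext s v).1 is Some s' then Some (phi s') else exit, (pnext s v).2)) ->
  forall n s C C', iter n (@pstep p) (Some s, C) = (None, C') ->
  exists2 m, m <= n & iter m (@pstep q) (Some (phi s), C) = (exit, C').
Proof.
move=> phiE; elim=> [//|n IHn] s C C'; rewrite iterSr pstepE.
set oa := pnext s _ => run_n.
have stepE : pstep (Some (phi s), C) =
    (if oa.1 is Some s' then Some (phi s') else exit, acts C oa.2).
  by rewrite pstepE phiE.
case def_o: oa.1 => [s'|] in run_n stepE.
  by have [m le_mn run_m] := IHn _ _ _ run_n; exists m.+1; rewrite ?ltnS// iterSr stepE.
move: run_n; rewrite iter_pstep_None => -[<-].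
by exists 1; rewrite //= stepE.
Qed.

Lemma runs_Seq p q C n C' m C'' :
  runs p C n C' -> runs q C' m C'' -> runs (Seq p q) C (n + m) C''.
Proof.
move=> run_p run_q.
have [//|n' le_n run_n] :=
  @runs_sub p (Seq p q) inl (Some (inr (pstart q))) _ _ _ _ _ run_p.
  by move=> s v /=; case: (pnext s v) => [[s'|] a].
have [|m' le_m run_m] := @runs_sub q (Seq p q) inr None _ _ _ _ _ run_q.
  by move=> s v /=; case: (pnext s v) => [[s'|] a].
apply: (@runs_leq _ _ (m' + n')); first by rewrite addnC leq_add.
by rewrite /runs iterD /= run_n run_m.
Qed.

Lemma runs_Cond b p q C n C' :
  runs (if b (reads C) then p else q) C n C' -> runs (Cond b p q) C n.+1 C'.
Proof.
move=> run_pq; rewrite /runs iterSr pstepE /= acts_stay.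
case: (b (reads C)) in run_pq *.
  have [|n' le_n run_n] :=
    @runs_sub p (Cond b p q) (fun s => Some (inl s)) None _ _ _ _ _ run_pq.
    by move=> s v /=; case: (pnext s v) => [[s'|] a].
  exact: (@iter_pstep_leq (Cond b p q) _ _ _ _ le_n).
have [|n' le_n run_n] :=
  @runs_sub q (Cond b p q) (fun s => Some (inr s)) None _ _ _ _ _ run_pq.
  by move=> s v /=; case: (pnext s v) => [[s'|] a].
exact: (@iter_pstep_leq (Cond b p q) _ _ _ _ le_n).
Qed.

Lemma runs_While_end b p C : ~~ b (reads C) -> runs (While b p) C 1 C.
Proof.
by move=> /negbTE bF; rewrite /runs /= pstepE /= bF acts_stay.
Qed.

Lemma runs_While_step (b : pred reading) p C n C' m C'' : b (reads C) ->
  runs p C n C' -> runs (While b p) C' m C'' -> runs (While b p) C (n + m).+1 C''.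
Proof.
move=> bT run_p run_w; rewrite /runs iterSr pstepE /= bT acts_stay.
have [|n' le_n run_n] :=
  @runs_sub p (While b p) Some (Some None) _ _ _ _ _ run_p.
  by move=> s v /=; case: (pnext s v) => [[s'|] a].
have le_nm : m + n' <= n + m by rewrite addnC leq_add2r.
apply: (@iter_pstep_leq (While b p) _ _ _ _ le_nm).
by rewrite iterD run_n.
Qed.

Definition prog_TM (p : prog) : TM := {|
  tm_state := option (pstate p);
  tm_aux := void;
  tm_tapes := K;
  tm_start := Some (pstart p);
  tm_halt := fun s => s == None;
  tm_trans := fun s v =>
    if s is Some s' then pnext s' v else (None, stay v) |}.

Definition config_streams p (c : config (prog_TM p)) : option (pstate p) * tapes :=
  (c.1, fun i => tape_stream (c.2 i)).

Lemma config_streams_step p (c : config (prog_TM p)) :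
  config_streams (tm_step c) = pstep (config_streams c).
Proof.
case: c => [[s|] ts] //=; rewrite /config_streams /tm_step /pstep /=.
have -> : [ffun i => scanned (ts i)] = reads (fun i => tape_stream (ts i)).
  by apply/ffunP => i; rewrite !ffunE scanned_stream.
congr pair; apply: funext => i; rewrite ffunE /acts.
exact: (@tape_stream_move (prog_TM p)).
Qed.

Lemma leading_bits_stream (A : Type) (s : seq (option (bool + A))) (w : word) :
  nth None s =1 nth None [seq Some (inl b) | b <- w] -> leading_bits s = w.
Proof.
elim: w s => [|b w IHw] [|a s] //= eq_sw.
- by have := eq_sw 0 => /= ->.
- by have := eq_sw 0.
have /= -> := eq_sw 0; congr cons; apply: IHw => i.
exact: (eq_sw i.+1).
Qed.

Definition bits_stream (w : word) : stream sym :=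
  nth None [seq Some (inl b) | b <- w].

Lemma prog_TM_outputs p args n C' w :
  runs p (fun i : 'I_K.+1 => (bits_stream [::], bits_stream (nth [::] args i))) n C' ->
  (C' ord0).2 = bits_stream w ->
  tm_outputs (prog_TM p) args n w.
Proof.
move=> run_p C'w.
have itE c : config_streams (iter n (@tm_step (prog_TM p)) c) =
             iter n (@pstep p) (config_streams c).
  by elim: n {run_p} => //= m IHm; rewrite config_streams_step IHm.
have initE : config_streams (tm_init (prog_TM p) args) =
    (Some (pstart p), fun i : 'I_K.+1 =>
       (bits_stream [::], bits_stream (nth [::] args i))).
  by rewrite /config_streams /=; congr pair; apply: funext => i; rewrite ffunE.
have := itE (tm_init (prog_TM p) args); rewrite initE run_p => -[c1 c2].
split; first by rewrite /= c1.
apply: leading_bits_stream => i.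
by have /(congr1 (fun C => (C ord0).2 i)) /= := c2; rewrite C'w.
Qed.

End Programs.

(** * Register programs *)

(** A loop reads the word of its register bit by bit, with one body for each value of the bit, so
    the number of turns is fixed on entry. The condition [wf] keeps the bodies away from that
    register, whose head can then record the progress of the loop. *)
Inductive cmd :=
| Skip
| Comp of cmd & cmd
| Push of nat & bool
| Clear of nat
| Incr of nat
| Loop of nat & cmd & cmd.

Definition upd A (s : nat -> A) (r : nat) (a : A) : nat -> A :=
  fun i => if i == r then a else s i.

Lemma upd_eq A (s : nat -> A) r a : upd s r a r = a.
Proof. by rewrite /upd eqxx. Qed.

Lemma upd_neq A (s : nat -> A) r a i : i != r -> upd s r a i = s i.
Proof. by rewrite /upd => /negbTE ->. Qed.

Lemma upd_upd A (s : nat -> A) r a b : upd (upd s r a) r b = upd s r b.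
Proof. by apply: funext => i; rewrite /upd; case: (i == r). Qed.

Lemma upd_id A (s : nat -> A) r : upd s r (s r) = s.
Proof. by apply: funext => i; rewrite /upd; case: eqP => // ->. Qed.

Lemma updC A (s : nat -> A) r1 r2 a b : r1 != r2 ->
  upd (upd s r1 a) r2 b = upd (upd s r2 b) r1 a.
Proof.
move=> /negbTE r12; apply: funext => i; rewrite /upd.
by case: (i =P r1) => [->|_]; [rewrite r12 | case: (i == r2)].
Qed.

(* Binary successor, least significant digit first. *)
Fixpoint incw (w : word) : word :=
  if w is b :: w' then if b then false :: incw w' else true :: w' else [:: true].

Fixpoint run (c : cmd) (s : nat -> word) : nat -> word :=
  match c with
  | Skip => s
  | Comp c d => run d (run c s)
  | Push r b => upd s r (b :: s r)
  | Clear r => upd s r [::]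
  | Incr r => upd s r (incw (s r))
  | Loop r c d => foldl (fun s (b : bool) => if b then run c s else run d s) s (s r)
  end.

Fixpoint regs (c : cmd) : seq nat :=
  match c with
  | Skip => [::]
  | Comp c d => regs c ++ regs d
  | Push r _ | Clear r | Incr r => [:: r]
  | Loop r c d => r :: regs c ++ regs d
  end.

Fixpoint wf (c : cmd) : bool :=
  match c with
  | Comp c d => wf c && wf d
  | Loop r c d => [&& r \notin regs c, r \notin regs d, wf c & wf d]
  | _ => true
  end.

Fixpoint loop_cost S (f : S -> bool -> nat) (g : S -> bool -> S) s (w : word) :=
  if w is b :: w' then f s b + 3 + loop_cost f g (g s b) w' else 0.

(** This bounds the steps of the compiled program. Each turn of a loop adds 3 to the cost of its
    body: the test of the loop, the test of the bit and the move to the next bit. The summand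
    outside [loop_cost] pays for the last test and the rewinding. *)
Fixpoint cost (c : cmd) (s : nat -> word) : nat :=
  match c with
  | Skip => 1
  | Comp c d => cost c s + cost d (run c s)
  | Push _ _ => 2
  | Clear r => (size (s r)).*2.+1
  | Incr r => 4 * size (s r) + 5
  | Loop r c d =>
    loop_cost (fun s (b : bool) => if b then cost c s else cost d s)
      (fun s (b : bool) => if b then run c s else run d s) s (s r)
    + ((size (s r)).*2 + 4)
  end.

Lemma run_notin c s r : r \notin regs c -> run c s r = s r.
Proof.
elim: c s => //= [c IHc d IHd|q b|q|q|q c IHc d IHd] s.
- by rewrite mem_cat negb_or => /andP[/IHc{}IHc /IHd ->].
- by rewrite inE /upd => /negbTE ->.
- by rewrite inE /upd => /negbTE ->.
- by rewrite inE /upd => /negbTE ->.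
rewrite inE mem_cat !negb_or => /and3P[_ /IHc{}IHc /IHd{}IHd].
move: (s q) => w; elim: w s => //= b w IHw s; rewrite IHw; case: b => /=; [exact: IHc | exact: IHd].
Qed.

Lemma scons_bits b w : scons (Some (inl b)) (bits_stream w) = bits_stream (b :: w).
Proof. by apply: funext => -[|i]. Qed.

Lemma scons_blank : scons None (bits_stream [::]) = bits_stream [::].
Proof. by apply: funext => -[|i]; rewrite /bits_stream /= ?nth_nil. Qed.

Lemma stail_bits b w : stail (bits_stream (b :: w)) = bits_stream w.
Proof. by []. Qed.

Lemma stail_blank : stail (bits_stream [::]) = bits_stream [::].
Proof. by apply: funext => i; rewrite /stail /bits_stream /= !nth_nil. Qed.

Lemma stail_scons A (a : A) s : stail (scons a s) = s.
Proof. by []. Qed.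

Definition streamE :=
  (scons_bits, scons_blank, stail_bits, stail_blank, stail_scons).

Definition zip_tape (w1 w2 : word) : stape (bool + void) :=
  (bits_stream (rev w1), bits_stream w2).

(** * Compilation of register programs to tapes *)

Section Compile.
Variable K : nat.

Notation sym := (option (bool + void)).
Notation reading := {ffun 'I_K.+1 -> sym}.
Notation stapes := (nat -> stape (bool + void)).

Definition on_reg (r : nat) (f : sym -> sym * move) : prog K :=
  Act (fun v => [ffun i => if val i == r then f (v i) else (v i, MoveN)]).

Definition test_reg (r : nat) (P : pred sym) : pred reading :=
  fun v => P (v (inord r)).

Definition is_bit (x : sym) := if x is Some (inl _) then true else false.
Definition is_one (x : sym) := if x is Some (inl b) then b else false.

Definition go_left r := on_reg r (fun x => (x, MoveL)).
Definition go_right r := on_reg r (fun x => (x, MoveR)).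
Definition put r b := on_reg r (fun _ => (Some (inl b), MoveN)).

(** The first move precedes the loop because the head may stand on the blank behind the word, where
    the test would fail at once. *)
Definition rewind r : prog K :=
  Seq (go_left r) (Seq (While (test_reg r is_bit) (go_left r)) (go_right r)).

Fixpoint compile (c : cmd) : prog K :=
  match c with
  | Skip => Act (@stay K)
  | Comp c d => Seq (compile c) (compile d)
  | Push r b => Seq (go_left r) (put r b)
  | Clear r => While (test_reg r is_bit) (on_reg r (fun _ => (None, MoveR)))
  | Incr r =>
    Seq (While (test_reg r is_one)
           (on_reg r (fun _ => (Some (inl false), MoveR))))
      (Seq (put r true) (rewind r))
  | Loop r c d =>
    Seq (While (test_reg r is_bit)
           (Seq (Cond (test_reg r is_one) (compile c) (compile d)) (go_right r)))
      (rewind r)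
  end.

Definition rruns p (T : stapes) n (T' : stapes) :=
  runs p (fun i : 'I_K.+1 => T i) n (fun i : 'I_K.+1 => T' i).

Lemma rruns_on_reg r f T :
  rruns (on_reg r f) T 1 (upd T r (smove (T r) (f ((T r).2 0)))).
Proof.
rewrite /rruns /on_reg; set g := (X in Act X).
have -> : (fun i : 'I_K.+1 => upd T r (smove (T r) (f ((T r).2 0))) i) =
    acts (fun i : 'I_K.+1 => T i) (g (reads (fun i : 'I_K.+1 => T i))).
  apply: funext => i; rewrite /acts /g !ffunE /upd.
  by case: eqP => [->|_] //; rewrite smove_stay.
exact: runs_Act.
Qed.

Lemma test_regE r P (T : stapes) : r <= K ->
  test_reg r P (reads (fun i : 'I_K.+1 => T i)) = P ((T r).2 0).
Proof. by move=> le_rK; rewrite /test_reg ffunE inordK. Qed.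

Lemma rruns_rewind_loop r u b w T : r <= K ->
  rruns (While (test_reg r is_bit) (go_left r))
    (upd T r (bits_stream u, bits_stream (b :: w))) ((size u).*2 + 3)
    (upd T r (bits_stream [::], scons None (bits_stream (catrev u (b :: w))))).
Proof.
move=> le_rK; elim: u b w => [|a u IHu] b w.
  apply: (@runs_While_step _ _ _ _ 1 _ 1); first by rewrite test_regE// upd_eq.
    exact: rruns_on_reg.
  rewrite upd_upd upd_eq /smove /= !streamE.
  by apply: runs_While_end; rewrite test_regE// upd_eq.
have -> : (size (a :: u)).*2 + 3 = (1 + ((size u).*2 + 3)).+1 by rewrite /=; lia.
apply: runs_While_step; first by rewrite test_regE// upd_eq.
  exact: rruns_on_reg.
by rewrite upd_upd upd_eq /smove /= !streamE; apply: IHu.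
Qed.

Lemma rruns_rewind r w1 w2 T : r <= K -> T r = zip_tape w1 w2 ->
  rruns (rewind r) T ((size w1).*2 + 3) (upd T r (zip_tape [::] (w1 ++ w2))).
Proof.
move=> le_rK Tr.
case/lastP: w1 Tr => [|w1 b] Tr; last first.
  have -> : (size (rcons w1 b)).*2 + 3 = 1 + (((size (rev w1)).*2 + 3) + 1).
    by rewrite size_rcons size_rev; lia.
  apply: runs_Seq; first exact: rruns_on_reg.
  rewrite Tr /zip_tape rev_rcons /smove /=.
  have -> : scons (bits_stream (b :: rev w1) 0)
      (scons (bits_stream w2 0) (stail (bits_stream w2))) = bits_stream (b :: w2).
    by case: w2 {Tr} => [|a w2] /=; rewrite !streamE.
  rewrite !streamE; apply: runs_Seq; first exact: rruns_rewind_loop.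
  have := @rruns_on_reg r (fun x => (x, MoveR))
    (upd T r (bits_stream [::], scons None (bits_stream (catrev (rev w1) (b :: w2))))).
  rewrite upd_upd upd_eq /smove /= !streamE.
  by rewrite -[catrev _ _]/(catrev (rev w1) (b :: w2)) catrevE revK -cat_rcons.
apply: (@runs_Seq _ _ _ _ 1 _ 2); first exact: rruns_on_reg.
apply: (@runs_Seq _ _ _ _ 1 _ 1).
  by apply: runs_While_end; rewrite test_regE// upd_eq Tr.
have := @rruns_on_reg r (fun x => (x, MoveR)) (upd T r (smove (T r) ((T r).2 0, MoveL))).
rewrite upd_upd upd_eq Tr /smove /= !streamE.
suff -> : scons (bits_stream w2 0) (stail (bits_stream w2)) = bits_stream w2 by [].
by case: w2 {Tr} => [|a w2] /=; rewrite !streamE.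
Qed.

(** The carry turns the leading ones into zeros and stops at the first zero or at the blank behind
    the word; writing a one there gives [true :: behead w3] in both cases. *)
Lemma rruns_Incr_loop r w1 w T : r <= K -> exists n w2 w3,
  [/\ n <= (size w).*2.+1, size w2 <= size w,
      w2 ++ true :: behead w3 = incw w &
  rruns (While (test_reg r is_one) (on_reg r (fun _ => (Some (inl false), MoveR))))
    (upd T r (zip_tape w1 w)) n (upd T r (zip_tape (w1 ++ w2) w3))].
Proof.
move=> le_rK; elim: w w1 => [|[] w IHw] w1.
- exists 1, [::], [::]; split=> //; rewrite cats0.
  by apply: runs_While_end; rewrite test_regE// upd_eq.
- have [n [w2 [w3 [le_n le_w2 def_w run_n]]]] := IHw (rcons w1 false).
  exists (1 + n).+1, (false :: w2), w3.
  split; [by rewrite /= doubleS; lia | by [] | by rewrite /= -def_w |].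
  apply: runs_While_step; first by rewrite test_regE// upd_eq.
    exact: rruns_on_reg.
  rewrite upd_upd upd_eq /smove /= !streamE -rev_rcons -cat_rcons.
  exact: run_n.
- exists 1, [::], (false :: w); split=> //; rewrite cats0.
  by apply: runs_While_end; rewrite test_regE// upd_eq.
Qed.

(** [D i] is the position of the head in the word of register [i]; it is nonzero only for the
    registers of the enclosing loops. *)
Definition tapes_of (D : nat -> nat) (s : nat -> word) : stapes :=
  fun i => zip_tape (take (D i) (s i)) (drop (D i) (s i)).

Lemma tapes_of_upd D s r w : D r = 0 ->
  tapes_of D (upd s r w) = upd (tapes_of D s) r (zip_tape [::] w).
Proof.
move=> Dr; apply: funext => i; rewrite /tapes_of /upd.
by case: eqP => // ->; rewrite Dr take0 drop0.
Qed.

(** The statement is general in [D] for the sake of the induction: the body of a loop runs while the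
    head of the loop register is somewhere inside its word, and by [wf] the body never uses this
    tape. *)
Lemma rruns_compile c D s :
  wf c -> all (leq^~ K) (regs c) -> (forall r, r \in regs c -> D r = 0) ->
  rruns (compile c) (tapes_of D s) (cost c s) (tapes_of D (run c s)).
Proof.
elim: c D s => [|c IHc d IHd|r b|r|r|r c IHc d IHd] D s /=.
- move=> _ _ _; rewrite /rruns -[X in runs _ _ _ X]acts_stay; exact: runs_Act.
- case/andP=> wfc wfd; rewrite all_cat => /andP[leK_c leK_d] D0.
  apply: runs_Seq.
    by apply: IHc => // r rc; apply: D0; rewrite mem_cat rc.
  by apply: IHd => // r rd; apply: D0; rewrite mem_cat rd orbT.
- rewrite andbT => _ le_rK /(_ r (mem_head _ _)) Dr; rewrite tapes_of_upd//.
  apply: (@runs_Seq _ _ _ _ 1 _ 1); first exact: rruns_on_reg.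
  have := @rruns_on_reg r (fun _ => (Some (inl b), MoveN))
    (upd (tapes_of D s) r (smove (tapes_of D s r) ((tapes_of D s r).2 0, MoveL))).
  rewrite upd_upd upd_eq /tapes_of Dr take0 drop0 /smove /= !streamE.
  suff -> : scons (bits_stream (s r) 0) (stail (bits_stream (s r))) = bits_stream (s r).
    by rewrite streamE.
  by case: (s r) => [|a w2] /=; rewrite !streamE.
- rewrite andbT => _ le_rK /(_ r (mem_head _ _)) Dr; rewrite tapes_of_upd//.
  rewrite -{1}[tapes_of D s](upd_id _ r) [tapes_of D s r]/tapes_of Dr take0 drop0.
  elim: (s r) => [|b w IHw] /=.
    by apply: runs_While_end; rewrite test_regE// upd_eq.
  apply: (@runs_While_step _ _ _ _ 1 _ (size w).*2.+1).
  - by rewrite test_regE// upd_eq.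
  - exact: rruns_on_reg.
  by rewrite upd_upd upd_eq /smove /= !streamE.
- rewrite andbT => _ le_rK /(_ r (mem_head _ _)) Dr; rewrite tapes_of_upd//.
  have [n [w2 [w3 [le_n le_w2 <- run_n]]]] := @rruns_Incr_loop r [::] (s r) (tapes_of D s) le_rK.
  apply: (@runs_leq _ _ _ (n + (1 + ((size w2).*2 + 3)))); first by lia.
  rewrite -{1}[tapes_of D s](upd_id _ r) [tapes_of D s r]/tapes_of Dr take0 drop0.
  apply: runs_Seq; first exact: run_n.
  apply: runs_Seq; first exact: rruns_on_reg.
  rewrite upd_upd upd_eq /smove /=.
  have -> : scons (Some (inl true)) (stail (bits_stream w3)) =
            bits_stream (true :: behead w3).
    by case: w3 {run_n} => [|a w3] /=; rewrite !streamE.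
  have := @rruns_rewind r w2 (true :: behead w3)
    (upd (tapes_of D s) r (zip_tape w2 (true :: behead w3))) le_rK (upd_eq _ _ _).
  by rewrite upd_upd.
case/and4P=> rc rd wfc wfd.
rewrite all_cat => /and3P[le_rK leK_c leK_d] D0.
have Dr : D r = 0 by apply: D0; rewrite mem_head.
set s' := foldl _ _ _.
have s'E t w : foldl (fun s (b : bool) => if b then run c s else run d s) t w r = t r.
  by elim: w t => //= b w IHw t; rewrite IHw; case: b; rewrite run_notin.
have -> : tapes_of D s' = upd (tapes_of (upd D r (size (s r))) s') r (zip_tape [::] (s r ++ [::])).
  apply: funext => i; rewrite /tapes_of /upd.
  by case: eqP => // ->; rewrite Dr take0 drop0 cats0 /s' s'E.
have -> : (size (s r)).*2 + 4 = 1 + ((size (s r)).*2 + 3) by lia.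
rewrite addnA.
apply: (@runs_Seq _ _ _ _ _
  (fun i : 'I_K.+1 => tapes_of (upd D r (size (s r))) s' i)); last first.
  apply: rruns_rewind => //.
  by rewrite /tapes_of upd_eq /s' s'E take_size drop_size.
rewrite /s'; set bcost := fun t b => if b then cost c t else _.
set body := fun t b => if b then run c t else _.
have loopP w1 w2 t : t r = w1 ++ w2 ->
    rruns (While (test_reg r is_bit)
             (Seq (Cond (test_reg r is_one) (compile c) (compile d)) (go_right r)))
      (tapes_of (upd D r (size w1)) t) (loop_cost bcost body t w2 + 1)
      (tapes_of (upd D r (size (t r))) (foldl body t w2)).
  elim: w2 w1 t => [|b w2 IHw] w1 t def_w.
    rewrite def_w cats0; apply: runs_While_end.
    by rewrite test_regE// /tapes_of upd_eq def_w cats0 drop_size.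
  set n := if b then cost c t else cost d t.
  have -> : loop_cost bcost body t (b :: w2) + 1 =
             (n.+1 + 1 + (loop_cost bcost body (body t b) w2 + 1)).+1.
    by rewrite /= -/(bcost t b) /bcost -/n; lia.
  have bodyr : body t b r = t r by rewrite /body; case: (b); rewrite run_notin.
  apply: (@runs_While_step _ _ _ _ _
    (fun i : 'I_K.+1 => tapes_of (upd D r (size (rcons w1 b))) (body t b) i)).
  - by rewrite test_regE// /tapes_of upd_eq def_w drop_size_cat.
  - apply: (@runs_Seq _ _ _ _ _
      (fun i : 'I_K.+1 => tapes_of (upd D r (size w1)) (body t b) i)).
      apply: runs_Cond.
      rewrite test_regE// {1}/tapes_of upd_eq def_w drop_size_cat//=.
      have D0' q : (q \in regs c) || (q \in regs d) -> upd D r (size w1) q = 0.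
        move=> q_cd; rewrite upd_neq ?D0 ?inE ?mem_cat ?q_cd ?orbT//.
        by apply: contraTneq q_cd => ->; rewrite negb_or rc.
      rewrite /n /body; case: (b).
        by apply: IHc => // q qc; rewrite D0' ?qc.
      by apply: IHd => // q qd; rewrite D0' ?qd ?orbT.
    have -> : (fun i : 'I_K.+1 =>
        tapes_of (upd D r (size (rcons w1 b))) (body t b) i) =
      (fun i : 'I_K.+1 => upd (tapes_of (upd D r (size w1)) (body t b)) r
      (smove (tapes_of (upd D r (size w1)) (body t b) r)
         ((tapes_of (upd D r (size w1)) (body t b) r).2 0, MoveR)) i).
      apply: funext => i; rewrite /tapes_of /upd; case: eqP => // ->.
      have takeE u v : take (size u) (u ++ v) = u by rewrite take_size_cat.
      have dropE u v : drop (size u) (u ++ v) = v by rewrite drop_size_cat.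
      rewrite eqxx bodyr def_w takeE dropE -cat_rcons takeE dropE /smove /zip_tape /=.
      by rewrite !streamE rev_rcons.
    exact: rruns_on_reg.
  rewrite -bodyr -[foldl _ _ _]/(foldl body (body t b) w2).
  by apply: IHw; rewrite bodyr def_w cat_rcons.
have := loopP [::] (s r) s erefl.
by rewrite -[size [::]]Dr upd_id.
Qed.


End Compile.

(** * Polynomial bounds for the running time *)

(** Without [Clear] no register shrinks, so the sizes at the end of a run bound the sizes at all
    earlier times. *)
Fixpoint clear_free (c : cmd) : bool :=
  match c with
  | Comp c d | Loop _ c d => clear_free c && clear_free d
  | Clear _ => false
  | _ => true
  end.

(* The registers whose sizes determine the running time. *)
Fixpoint counters (c : cmd) : seq nat :=
  match c with
  | Comp c d => counters c ++ counters d
  | Incr r => [:: r]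
  | Loop r c d => r :: counters c ++ counters d
  | _ => [::]
  end.

Lemma size_incw w : size w <= size (incw w).
Proof. by elim: w => //= -[]. Qed.

Lemma size_run c s r : clear_free c -> size (s r) <= size (run c s r).
Proof.
elim: c s => //= [c IHc d IHd|q b|q|q c IHc d IHd] s.
- by case/andP=> /IHc{}IHc /IHd{}IHd; apply: leq_trans (IHd _).
- by move=> _; rewrite /upd; case: eqP => // ->.
- by move=> _; rewrite /upd; case: eqP => // ->; apply: size_incw.
case/andP=> /IHc{}IHc /IHd{}IHd; move: (s q) => w.
elim: w s => //= b w IHw s; apply: leq_trans (IHw _).
by case: b.
Qed.

Lemma leq_bound a a' d d' V : a <= a' -> d <= d' -> a * V.+1 ^ d <= a' * V.+1 ^ d'.
Proof. by move=> le_a le_d; rewrite leq_mul// leq_pexp2l. Qed.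

(** As sizes never decrease, the bound [V] on the final counters also bounds the number of turns of
    every loop, and each loop costs one more factor [V + 1]. Registers that are only pushed to, such
    as the output, need no bound. *)
Lemma cost_bound c : clear_free c -> exists a d, forall s V,
  (forall r, r \in counters c -> size (run c s r) <= V) ->
  cost c s <= a * V.+1 ^ d.
Proof.
elim: c => [|c IHc d IHd|r b|r|r|r c IHc d IHd] //=.
- by move=> _; exists 1, 0 => s V _; rewrite expn0.
- case/andP=> ccf dcf; have [a1 [d1 b1]] := IHc ccf; have [a2 [d2 b2]] := IHd dcf.
  exists (a1 + a2), (d1 + d2) => s V leV; rewrite mulnDl leq_add//.
    apply: (leq_trans (b1 s V _)); last by rewrite leq_bound ?leq_addr.
    move=> r rc; apply: leq_trans (leV r _); last by rewrite mem_cat rc.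
    exact: size_run.
  apply: (leq_trans (b2 _ V _)); last by rewrite leq_bound ?leq_addl.
  by move=> r rd; apply: leV; rewrite mem_cat rd orbT.
- by move=> _; exists 2, 0 => s V _; rewrite expn0.
- move=> _; exists 9, 1 => s V /(_ r (mem_head _ _)); rewrite upd_eq => leV.
  have := leq_trans (size_incw _) leV; rewrite expn1; lia.
case/andP=> ccf dcf; have [a1 [d1 b1]] := IHc ccf; have [a2 [d2 b2]] := IHd dcf.
exists (a1 + a2 + 9), (d1 + d2).+1 => s V leV.
set body := fun t (b : bool) => if b then run c t else run d t.
set bcost := fun t (b : bool) => if b then cost c t else cost d t.
have body_size t b q : size (t q) <= size (body t b q).
  by rewrite /body; case: b; apply: size_run.
have fold_size t w q : size (t q) <= size (foldl body t w q).
  by elim: w t => //= b w IHw t; apply: leq_trans (IHw _).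
have le_w : size (s r) <= V by apply: leq_trans (fold_size _ _ _) (leV r (mem_head _ _)).
set P := V.+1 ^ (d1 + d2); have P0 : 0 < P by rewrite expn_gt0.
suff le_loop : loop_cost bcost body s (s r) <= size (s r) * ((a1 + a2) * P + 3).
  rewrite expnS -/P; apply: leq_trans (leq_add le_loop (leqnn _)) _.
  have : size (s r) * ((a1 + a2) * P + 3) <= V * ((a1 + a2) * P + 3).
    by rewrite leq_mul2r le_w orbT.
  nia.
have {leV} : forall q, q \in counters c ++ counters d ->
    size (foldl body s (s r) q) <= V.
  by move=> q q_cd; apply: leV; rewrite inE q_cd orbT.
move: (s r) => w; elim: w s {le_w} => //= b w IHw s leV.
rewrite mulSn; apply: leq_add; last exact: IHw.
rewrite leq_add2r /bcost mulnDl.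
have leV' q : q \in counters c ++ counters d -> size (body s b q) <= V.
  by move=> /leV; apply: leq_trans.
case: b leV' {leV} => leV.
  apply: leq_trans (leq_addr _ _); apply: (leq_trans (b1 s V _)).
    by move=> q qc; apply: leV; rewrite mem_cat qc.
  by rewrite leq_bound ?leq_addr.
apply: leq_trans (leq_addl _ _); apply: (leq_trans (b2 s V _)).
  by move=> q qd; apply: leV; rewrite mem_cat qd orbT.
by rewrite leq_bound ?leq_addl.
Qed.

Definition init_regs (x : word) : nat -> word := nth [::] [:: x].

Theorem run_polytime (c : cmd) (p : {poly nat}) : wf c ->
  (forall x, cost c (init_regs x) <= (p.[size x])%R) ->
  polytime_function (fun x => run c (init_regs x) 0).
Proof.
move=> wfc le_cost; pose K := \max_(r <- regs c) r.
exists (prog_TM (compile K c)), p => x.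
have leK : all (leq^~ K) (regs c).
  by apply/allP => r rc; rewrite /K (big_rem r)//= leq_maxl.
have := @rruns_compile K c (fun _ => 0) (init_regs x) wfc leK (fun _ _ => erefl).
rewrite /rruns => /(runs_leq (le_cost x)) run_c.
apply: prog_TM_outputs; last first.
- have -> : run c (init_regs x) 0 = drop 0 (run c (init_regs x) (@ord0 K)) by rewrite drop0.
  instantiate (1 := fun i : 'I_K.+1 => tapes_of (fun _ => 0) (run c (init_regs x)) i).
  by [].
- rewrite (_ : (fun i => _) = fun i : 'I_K.+1 => tapes_of (fun _ => 0) (init_regs x) i)//.
  by apply: funext => i; rewrite /tapes_of take0 drop0.
Qed.

(** * Printing agents *)

Lemma bitsE n : bits n = odd n :: (if n < 2 then [::] else bits n./2).
Proof.
rewrite /bits /mkseq -[iota 0 _]/(0 :: iota 1 _) /= expn0 divn1; congr cons.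
case: ifP => [|/negbT]; first by case: n => [|[]].
rewrite -leqNgt => n_gt1; rewrite trunc_log2S//.
rewrite (iotaDl 1 0) -map_comp; apply: eq_map => i /=.
by rewrite add1n expnS divnMA divn2.
Qed.

(** Zero is excluded because [bits 0] already consists of one digit. *)
Lemma bits_double n : 0 < n -> bits n.*2 = false :: bits n.
Proof.
move=> n_gt0; rewrite bitsE odd_double doubleK; case: ifP => //.
by case: n n_gt0.
Qed.

Lemma bits_doubleS n : 0 < n -> bits n.*2.+1 = true :: bits n.
Proof.
move=> n_gt0; rewrite bitsE /= odd_double uphalf_double.
by case: n n_gt0.
Qed.

Lemma bits_mul_exp m e : 0 < m -> bits (m * 2 ^ e) = nseq e false ++ bits m.
Proof.
move=> m_gt0; elim: e => [|e IHe]; first by rewrite muln1.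
rewrite expnS mulnCA mul2n bits_double ?IHe//.
by rewrite muln_gt0 m_gt0 expn_gt0.
Qed.

Lemma bits_pred_exp e : bits (2 ^ e.+1 - 1) = nseq e.+1 true.
Proof.
elim: e => [|e IHe]; first by rewrite (bitsE 1).
have e_gt1 : 1 < 2 ^ e.+1 by rewrite -{1}(expn0 2) ltn_exp2l.
rewrite expnS mul2n (_ : _ - 1 = (2 ^ e.+1 - 1).*2.+1); last by lia.
by rewrite bits_doubleS ?IHe// subn_gt0.
Qed.

Lemma bitsS n : 0 < n -> bits n.+1 = incw (bits n).
Proof.
elim/ltn_ind: n => n IHn n_gt0.
rewrite -(odd_double_half n).
have [n2|n2] := posnP n./2.
  rewrite n2; case: (odd n) (odd_double_half n) => /=; last by rewrite n2; lia.
  by rewrite (bitsE 2) (bitsE 1).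
case odd_n: (odd n); rewrite ?add0n ?add1n; last first.
  by rewrite bits_doubleS// bits_double.
rewrite -doubleS bits_double// bits_doubleS//= IHn//.
by rewrite -divn2 ltn_Pdiv.
Qed.

(** Counting starts from an empty register, which is not of the form [bits n]; it becomes correct
    with the first increment. *)
Lemma bits_iter n : iter n.+1 incw [::] = bits n.+1.
Proof. by elim: n => [|n IHn]; [rewrite (bitsE 1) | rewrite bitsS// -IHn]. Qed.

(** For positive [e] the numerator is a run of ones and the denominator a run of zeros followed by a
    one. Loops of length [e] therefore print such endpoints without any arithmetic, although the
    distances between them are exponentially small. *)
Definition dyadic (e : nat) : fraction := (2 ^ e - 1, 2 ^ e).

(* Slot [j] is the interval from [dyadic (2j+1)] to [dyadic (2j+2)]. *)
Definition slot_pieces (D : nat) (jm : nat * nat) : step_function :=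
  [:: (dyadic jm.1.*2.+1, (0, 1));
      (dyadic jm.1.*2.+2, (jm.2 * 2 ^ jm.1.*2.+2, D))].

(* The agent with mass [m / D] on slot [j] for every [(j, m)] in [A]. *)
Definition slot_agent (D : nat) (A : seq (nat * nat)) : step_function :=
  flatten [seq slot_pieces D jm | jm <- A] ++ [:: ((1, 1), (0, 1))].

(* The word [w] repeated [c + sum of the sizes of the registers rs] times. *)
Definition token := ((seq nat * nat) * word)%type.

Definition linear_val (s : nat -> word) (e : seq nat * nat) : nat :=
  e.2 + sumn [seq size (s r) | r <- e.1].

Definition token_word s (t : token) : word :=
  flatten (nseq (linear_val s t.1) t.2).

Definition lit (w : word) : token := (([::], 1), w).

Lemma token_lit s w : token_word s (lit w) = w.
Proof. by rewrite /token_word /= cats0. Qed.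

Fixpoint push_word (w : word) : cmd :=
  if w is b :: w' then Comp (push_word w') (Push 0 b) else Skip.

Definition emit_token (t : token) : cmd :=
  Comp (foldr (fun r => Comp (Loop r (push_word t.2) (push_word t.2))) Skip t.1.1)
       (iter t.1.2 (Comp (push_word t.2)) Skip).

(** Words grow at their front, so the last token is emitted first. *)
Definition emit_tokens (ts : seq token) : cmd :=
  foldr (fun t c => Comp c (emit_token t)) Skip ts.

Lemma run_push_word w s : run (push_word w) s = upd s 0 (w ++ s 0).
Proof.
elim: w => [|b w IHw] /=; first by rewrite upd_id.
by rewrite IHw upd_upd upd_eq.
Qed.

Lemma flatten_nseqC (T : Type) c (w : seq T) :
  flatten (nseq c w) ++ w = w ++ flatten (nseq c w).
Proof. by elim: c => [|c IHc] /=; rewrite ?cats0// -catA IHc. Qed.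

Lemma run_emit_token t s : 0 \notin t.1.1 ->
  run (emit_token t) s = upd s 0 (token_word s t ++ s 0).
Proof.
case: t => -[rs c] w /= rs0; rewrite /token_word /linear_val /=.
have -> u : run (iter c (Comp (push_word w)) Skip) u =
            upd u 0 (flatten (nseq c w) ++ u 0).
  elim: c u => [|c IHc] u /=; first by rewrite upd_id.
  rewrite run_push_word IHc upd_upd upd_eq catA; congr (upd _ _ (_ ++ _)).
  exact: flatten_nseqC.
elim: rs s rs0 => [|r rs IHrs] s; first by rewrite addn0.
rewrite inE negb_or => /andP[r0 rs0] /=.
have loopE v u : foldl (fun s (b : bool) => if b then run (push_word w) s
      else run (push_word w) s) u v = upd u 0 (flatten (nseq (size v) w) ++ u 0).
  elim: v u => [|b v IHv] u /=; first by rewrite upd_id.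
  rewrite if_same run_push_word IHv upd_upd upd_eq catA; congr (upd _ _ (_ ++ _)).
  exact: flatten_nseqC.
rewrite loopE IHrs// upd_upd upd_eq catA; congr (upd _ _ (_ ++ _)).
have -> : [seq size (upd s 0 (flatten (nseq (size (s r)) w) ++ s 0) q) | q <- rs] =
          [seq size (s q) | q <- rs].
  by apply/eq_in_map => q q_rs; rewrite upd_neq//; apply: contraNneq rs0 => <-.
rewrite -flatten_cat; congr flatten.
by rewrite -nseqD; congr nseq; lia.
Qed.

Lemma run_emit_tokens ts s : all (fun t => 0 \notin t.1.1) ts ->
  run (emit_tokens ts) s = upd s 0 (flatten [seq token_word s t | t <- ts] ++ s 0).
Proof.
elim: ts s => [|t ts IHts] s; first by rewrite /= upd_id.
case/andP=> t0 ts0; rewrite -[LHS]/(run (emit_token t) (run (emit_tokens ts) s)).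
rewrite IHts// run_emit_token//= .
rewrite upd_upd upd_eq catA; congr (upd _ _ ((_ ++ _) ++ _)).
rewrite /token_word /linear_val; congr (flatten (nseq (_ + sumn _) _)).
by apply/eq_in_map => q q_t; rewrite upd_neq//; apply: contraNneq t0 => <-.
Qed.

Lemma enc_nat_cat v n m : bits n = v ++ bits m ->
  enc_nat n = flatten [seq [:: true; b] | b <- v] ++ enc_nat m.
Proof. by move=> def_n; rewrite /enc_nat /enc_seq def_n map_cat flatten_cat catA. Qed.

Lemma flatten_nseq_map (b : bool) e :
  flatten [seq [:: true; b] | b <- nseq e b] = flatten (nseq e [:: true; b]).
Proof. by rewrite map_nseq. Qed.

(* A slot is given by a linear expression of the registers. *)
Definition slot_tokens (D : nat) (x : (seq nat * nat) * nat) : seq token :=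
  let ones := [:: true; true; true; true] in
  let zeros := [:: true; false; true; false] in
  [:: lit [:: true];
      (x.1, ones); lit [:: true; true; false];
      (x.1, zeros); lit ([:: true; false] ++ enc_nat 1);
      lit (enc_fraction (0, 1)); lit [:: true];
      (x.1, ones); lit (ones ++ [:: false]);
      (x.1, zeros); lit (zeros ++ enc_nat 1);
      (x.1, zeros); lit (zeros ++ enc_nat x.2); lit (enc_nat D)].

Definition slots_val s (T : seq ((seq nat * nat) * nat)) : seq (nat * nat) :=
  [seq (linear_val s x.1, x.2) | x <- T].

Lemma flatten_nseq_double (T : Type) e (u v : seq T) :
  flatten (nseq e.*2 (u ++ v)) = flatten (nseq e (u ++ v ++ u ++ v)).
Proof. by elim: e => //= e <-; rewrite !catA. Qed.

Lemma enc_dyadicS e : enc_fraction (dyadic e.+1) =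
  flatten (nseq e.+1 [:: true; true]) ++ [:: false] ++
  flatten (nseq e.+1 [:: true; false]) ++ enc_nat 1.
Proof.
have -> : enc_fraction (dyadic e.+1) = enc_nat (2 ^ e.+1 - 1) ++ enc_nat (2 ^ e.+1) by [].
have -> : enc_nat (2 ^ e.+1 - 1) = flatten (nseq e.+1 [:: true; true]) ++ [:: false].
  by rewrite /enc_nat /enc_seq bits_pred_exp map_nseq.
rewrite -catA (@enc_nat_cat (nseq e.+1 false) (2 ^ e.+1) 1) ?flatten_nseq_map//.
by rewrite -bits_mul_exp// mul1n.
Qed.

(** The endpoints of slot [j] need runs of [2j + 1] and [2j + 2] digits while a token is repeated
    [j] times: the repeated blocks contain two digits, and literals supply the missing one or
    two. *)
Lemma token_word_slot D s x : 0 < x.2 ->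
  flatten [seq token_word s t | t <- slot_tokens D x] =
  flatten [seq true :: enc_piece bv | bv <- slot_pieces D (linear_val s x.1, x.2)].
Proof.
move=> m_gt0; rewrite /slot_tokens /slot_pieces.
rewrite !(map_cons (token_word s)) !token_lit /token_word ![(_, _).1]/= ![(_, _).2]/=.
set j := linear_val s x.1.
rewrite !map_cons /enc_piece ![(_, _).1]/= ![(_, _).2]/= !enc_dyadicS.
have -> : enc_fraction (x.2 * 2 ^ j.*2.+2, D) = enc_nat (x.2 * 2 ^ j.*2.+2) ++ enc_nat D by [].
rewrite (@enc_nat_cat (nseq j.*2.+2 false) (x.2 * 2 ^ j.*2.+2) x.2); last exact: bits_mul_exp.
rewrite flatten_nseq_map.
have dblE b : flatten (nseq j [:: true; b; true; b]) = flatten (nseq j.*2 [:: true; b]).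
  by rewrite (@flatten_nseq_double _ j [:: true] [:: b]).
have nS b e : flatten (nseq e.+1 [:: true; b]) = flatten (nseq e [:: true; b]) ++ [:: true; b].
  by rewrite flatten_nseqC.
rewrite !dblE !nS.
move: (flatten (nseq j.*2 _)) (flatten (nseq j.*2 _)) (enc_nat 1) (enc_nat x.2).
move: (enc_nat D) (enc_fraction _) => eD e01 w1 w0 e1 ex.
by rewrite [map _ [::]]/= [map _ [::]]/= /flatten /foldr !cats0; do 4!rewrite -?catA /=.
Qed.

Definition agent_tokens D (T : seq ((seq nat * nat) * nat)) : seq token :=
  lit [:: true] :: flatten [seq slot_tokens D x | x <- T] ++
  [:: lit (true :: enc_piece ((1, 1), (0, 1)) ++ [:: false])].

Definition emit_agent D T : cmd := emit_tokens (agent_tokens D T).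

Definition enc_agent (s : step_function) : word := true :: enc_seq enc_piece s.

(* Register 0 holds the output: templates may not refer to it. *)
Definition template_ok (T : seq ((seq nat * nat) * nat)) : bool :=
  all (fun x => (0 \notin x.1.1) && (0 < x.2)) T.

Lemma run_emit_agent D T s : template_ok T ->
  run (emit_agent D T) s =
    upd s 0 (enc_agent (slot_agent D (slots_val s T)) ++ s 0).
Proof.
move=> T_ok; rewrite /emit_agent run_emit_tokens; last first.
  rewrite /agent_tokens /= all_cat /= andbT; elim: T T_ok => //= x T IHT.
  by case/andP=> /andP[x0 _] /IHT ->; rewrite x0.
congr (upd _ _ (_ ++ _)).
have flattenE (a : word) l : flatten (a :: l) = a ++ flatten l by [].
rewrite /agent_tokens !map_cons map_cat !map_cons flattenE flatten_cat flattenE.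
rewrite !token_lit [flatten (map _ [::])]/= cats0 /enc_agent /enc_seq /slot_agent cat1s; congr cons.
rewrite map_cat flatten_cat -catA; congr (_ ++ _).
elim: T T_ok => // x T IHT /andP[/andP[_ m_gt0] /IHT{}IHT].
have flatT A (a : seq A) l : flatten (a :: l) = a ++ flatten l by [].
rewrite -[slots_val s _]/((linear_val s x.1, x.2) :: slots_val s T).
rewrite (map_cons (slot_tokens D)) (map_cons (slot_pieces D)).
rewrite (flatT _ (slot_tokens D x)) (flatT _ (slot_pieces D _)).
by rewrite !map_cat !flatten_cat IHT token_word_slot.
Qed.

(** * The consensus-division gadget *)

Section Gadget.
Variables (k w N : nat).

(* Slots, from left to right: [plus_slot], then one slot per forcing agent,
   then [flip_slot], [minus_slot] and two slots per value of each cell. *)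
Definition plus_slot : nat := 0.
Definition force_slot (n : nat) (b : bool) : nat := n.*2 + b + 1.
Definition flip_slot : nat := N.*2 + 1.
Definition minus_slot : nat := N.*2 + 2.
Definition cell_slot (n t : nat) (b : bool) : nat := N.*2 + 3 + (n * k + t).*2 + b.

Definition gadget_mass : nat := k + w.

Definition flip_agent := [:: (flip_slot, gadget_mass)].

(** The slot of its own lies to the left of the flip slot, where the intended solution has the label
    +, and thus supplies the mass [w] without making the supports of the forcing agents overlap. *)
Definition force_agent (n : nat) (b : bool) :=
  (force_slot n b, w) :: [seq (cell_slot n t b, 1) | t <- iota 0 k].

(* This agent imposes that exactly one of the slots listed in [L] is cut. *)
Definition exact_agent (L : seq (nat * nat * bool)) :=
  (plus_slot, w) ::
  (if size L == k then [::] else [:: (minus_slot, k - size L)]) ++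
  [seq (cell_slot l.1.1 l.1.2 l.2, 1) | l <- L].

Definition cell_lits (n : nat) := [seq (n, t, false) | t <- iota 0 k].

(** The only difference from [cell_lits n] is that [t] uses its second slot, so comparing the two
    agents shows that both slots of [(n, t)] have the same share. *)
Definition link_lits (n t : nat) := [seq (n, u, u == t) | u <- iota 0 k].

Definition first_lits (c : seq (nat * nat)) := [seq (l, false) | l <- c].

Definition gadget_agent (CS : seq (nat * nat) -> Prop) (A : seq (nat * nat)) : Prop :=
  [\/ A = flip_agent,
      exists n b, n < N /\ A = force_agent n b,
      exists2 n, n < N & A = exact_agent (cell_lits n) \/
                         exists2 t, t < k & A = exact_agent (link_lits n t) |
      exists2 c, CS c & A = exact_agent (first_lits c)].

Definition gadget_csp (CS : seq (nat * nat) -> Prop) (u : nat -> nat) : Prop :=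
  (forall n, n < N -> u n < k) /\
  (forall c, CS c -> count (fun l => u l.1 == l.2) c = 1).

(** The literals have to be listed in the order of their slots because the breakpoints of a step
    function increase; the bound on the length leaves room for the padding. *)
Definition csp_wf (CS : seq (nat * nat) -> Prop) : Prop :=
  forall c, CS c -> [/\ size c <= k, all (fun l => (l.1 < N) && (l.2 < k)) c &
    sorted ltn [seq l.1 * k + l.2 | l <- c]].

End Gadget.

(** * The reduction as a register program *)

Section Prints.
Variable D : nat.

Definition enc_agents (L : seq (seq (nat * nat))) : word :=
  flatten [seq enc_agent (slot_agent D A) | A <- L].

(* [c] leads from [s] to [s'], up to the output register, and prints in some
   order the agents satisfying [P]. *)
Definition prints (c : cmd) (s s' : nat -> word) (P : seq (nat * nat) -> Prop) :=
  exists2 L, (forall A, A \in L <-> P A) &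
    forall o, run c (upd s 0 o) = upd s' 0 (enc_agents L ++ o).

Lemma prints_iff c s s' (P Q : seq (nat * nat) -> Prop) :
  (forall A, P A <-> Q A) -> prints c s s' P -> prints c s s' Q.
Proof. by move=> PQ [L LP run_c]; exists L => // A; rewrite LP. Qed.

Lemma prints_Push r b s : r != 0 ->
  prints (Push r b) s (upd s r (b :: s r)) (fun _ => False).
Proof.
move=> r0; exists [::] => // o /=.
by rewrite upd_neq// updC// eq_sym.
Qed.

Lemma prints_Comp c d s s1 s2 P Q : prints c s s1 P -> prints d s1 s2 Q ->
  prints (Comp c d) s s2 (fun A => P A \/ Q A).
Proof.
move=> [L LP run_c] [L' LQ run_d]; exists (L' ++ L).
  move=> A; rewrite mem_cat -LP -LQ.
  by split=> [/orP[]|[]] ->; rewrite ?orbT; auto.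
by move=> o; rewrite /= run_c run_d catA /enc_agents map_cat flatten_cat.
Qed.

Lemma prints_Loop r c d s (st : nat -> nat -> word) (P : nat -> seq (nat * nat) -> Prop) :
  r != 0 -> st 0 = s ->
  (forall i, i < size (s r) ->
     prints (if nth false (s r) i then c else d) (st i) (st i.+1) (P i)) ->
  prints (Loop r c d) s (st (size (s r))) (fun A => exists2 i, i < size (s r) & P i A).
Proof.
move=> r0 <- body; suff [L LP run_L] : exists2 L,
  (forall A, A \in L <-> exists2 i, i < size (st 0 r) & P i A) & forall o,
    foldl (fun s (b : bool) => if b then run c s else run d s) (upd (st 0) 0 o) (st 0 r) =
    upd (st (size (st 0 r))) 0 (enc_agents L ++ o).
  by exists L => // o; rewrite /= upd_neq.
move: (st 0 r) body => v; elim: v st P => [|b v IHv] st P body.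
  by exists [::] => // A; split=> // -[].
have [L' L'P run_v] : exists2 L',
    (forall A, A \in L' <-> exists2 i, i < size v & P i.+1 A) & forall o,
    foldl (fun s (b : bool) => if b then run c s else run d s) (upd (st 1) 0 o) v =
    upd (st (size v).+1) 0 (enc_agents L' ++ o).
  by apply: (IHv (fun i => st i.+1) (fun i => P i.+1)) => i; apply: (body i.+1).
have [L LP run_b] := body 0 isT; exists (L' ++ L).
  move=> A; rewrite mem_cat; split=> [/orP[/L'P[i le_i PA]|/LP PA]|[[|i] le_i PA]].
  - by exists i.+1.
  - by exists 0.
  - by apply/orP; right; apply/LP.
  by apply/orP; left; apply/L'P; exists i.
move=> o /=; have -> : (if b then run c (upd (st 0) 0 o) else run d (upd (st 0) 0 o)) =
    upd (st 1) 0 (enc_agents L ++ o) by rewrite -run_b; case: (b).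
by rewrite run_v catA /enc_agents map_cat flatten_cat.
Qed.

Lemma slots_val_upd s o T : template_ok T -> slots_val (upd s 0 o) T = slots_val s T.
Proof.
move=> /allP T_ok; apply/eq_in_map => x /T_ok/andP[x0 _].
rewrite /linear_val; congr (_ + sumn _, _); apply/eq_in_map => r rx.
by rewrite upd_neq//; apply: contraNneq x0 => <-.
Qed.

Lemma prints_agent T s : template_ok T ->
  prints (emit_agent D T) s s (fun A => A = slots_val s T).
Proof.
move=> T_ok; exists [:: slots_val s T] => [A|o]; first by rewrite inE; split=> /eqP.
rewrite run_emit_agent// upd_upd upd_eq slots_val_upd//.
by rewrite /enc_agents /= cats0.
Qed.

Definition emit_agents (Ts : seq (seq ((seq nat * nat) * nat))) : cmd :=
  foldr (fun T c => Comp (emit_agent D T) c) Skip Ts.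

Lemma prints_agents Ts s : all template_ok Ts ->
  prints (emit_agents Ts) s s (fun A => A \in [seq slots_val s T | T <- Ts]).
Proof.
elim: Ts => [_|T Ts IHTs /= /andP[T_ok Ts_ok]]; first by exists [::].
apply: prints_iff (prints_Comp (prints_agent s T_ok) (IHTs Ts_ok)) => A.
by rewrite inE; split=> [[->|->]|/predU1P[]]; rewrite ?eqxx ?orbT; auto.
Qed.

End Prints.

(* Nested loops over copies of the same number, held by the registers [base],
   [base + 1] ..., make a body run a polynomial number of times. *)
Fixpoint repeat_poly (p : seq nat) (base : nat) (body : cmd) : cmd :=
  if p is a :: p' then
    Comp (iter a (Comp body) Skip)
      (Loop base (repeat_poly p' base.+1 body) (repeat_poly p' base.+1 body))
  else Skip.

Lemma run_iter_Comp a c s : run (iter a (Comp c) Skip) s = iter a (run c) s.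
Proof. by elim: a s => //= a IHa s; rewrite IHa -iterSr. Qed.

(** The nesting of the loops follows Horner's rule. Every coefficient needs a register of its own,
    since the body of a loop may not loop over the same register again. *)
Lemma repeat_polyE p base body n s :
  (forall r, r \in regs body -> r < base) ->
  (forall i, i < size p -> size (s (base + i)) = n) ->
  run (repeat_poly p base body) s = iter (horner_rec p n) (run body) s.
Proof.
elim: p base s => //= a p IHp base s lt_base sn.
rewrite run_iter_Comp [RHS](_ : _ = iter (horner_rec p n * n + a) (run body) s)//.
rewrite iterD; set s1 := iter a _ s.
have keep m t r : base <= r -> iter m (run body) t r = t r.
  move=> le_r; elim: m => //= m IHm; rewrite run_notin//.
  by apply: contraTN le_r => /lt_base; rewrite -ltnNge.
have s1n i : i < (size p).+1 -> size (s1 (base + i)) = n.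
  by move=> lt_i; rewrite /s1 keep ?leq_addr// sn.
have s1b : size (s1 base) = n by have := s1n 0 isT; rewrite addn0.
have {}s1n i : i < size p -> size (s1 (base.+1 + i)) = n.
  by move=> lt_i; rewrite addSnnS s1n.
rewrite -[X in _ * X]s1b; move: (s1 base) {s1b} => v.
elim: v (s1) s1n => [|b v IHv] t tn /=; first by rewrite muln0.
rewrite if_same IHp//; last first.
  by move=> r /lt_base; apply: leqW.
rewrite IHv => [|i lt_i]; last first.
  by rewrite keep ?tn// addSnnS leq_addr.
by rewrite -iterD mulnS addnC.
Qed.

Definition block (cs : seq cmd) : cmd := foldr Comp Skip cs.

(* Programs using the registers of [R], and register 0 for the output. *)
Definition within (R : seq nat) (c : cmd) : bool :=
  [&& wf c, clear_free c, all (fun q => q \in 0 :: R) (regs c) & 0 \notin counters c].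

Lemma within_sub (R R' : seq nat) c : {subset R <= R'} -> within R c -> within R' c.
Proof.
move=> RR' /and4P[wfc cfc /allP cR c0]; rewrite /within wfc cfc c0 andbT /=.
by apply/allP => r /cR; rewrite !inE => /predU1P[->//|/RR' ->]; rewrite orbT.
Qed.

Lemma within_Comp R c d : within R c -> within R d -> within R (Comp c d).
Proof.
case/and4P=> [w1 f1 r1 c1] /and4P[w2 f2 r2 c2]; rewrite /within /= w1 w2 f1 f2 /=.
by rewrite all_cat r1 r2 mem_cat negb_or c1.
Qed.

Lemma within_Push R r b : r \in 0 :: R -> within R (Push r b).
Proof. by rewrite /within /= => ->. Qed.

Lemma within_Loop R r c d : r != 0 -> r \notin R -> within R c -> within R d ->
  within (r :: R) (Loop r c d).
Proof.
move=> r0 rR /and4P[w1 f1 r1 c1] /and4P[w2 f2 r2 c2].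
have notin e : all (fun q => q \in 0 :: R) (regs e) -> r \notin regs e.
  by move=> /allP eR; apply/negP => /eR; rewrite inE (negbTE r0) (negbTE rR).
rewrite /within /= w1 w2 f1 f2 !notin//= all_cat !inE mem_cat !negb_or c1 c2.
rewrite (eq_sym 0) r0 eqxx orbT !andbT /=.
by apply/andP; split; [move: r1 | move: r2]; apply: sub_all => q;
  rewrite !inE => /orP[->|->]; rewrite ?orbT.
Qed.

Lemma within_block R cs : all (within R) cs -> within R (block cs).
Proof. by elim: cs => //= c cs IHcs /andP[cR /IHcs]; apply: within_Comp. Qed.

Lemma within_iter R a c : within R c -> within R (iter a (Comp c) Skip).
Proof. by move=> cR; elim: a => //= a; apply: within_Comp. Qed.

Lemma within_push_word R w : within R (push_word w).
Proof. by elim: w => //= b w IHw; apply: within_Comp => //; apply: within_Push. Qed.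

Lemma within_emit_token R t : 0 \notin t.1.1 -> {subset t.1.1 <= R} ->
  within R (emit_token t).
Proof.
case: t => -[rs c] w /= rs0 rsR; apply: within_Comp; last first.
  exact/within_iter/within_push_word.
elim: rs rs0 rsR => //= r rs IHrs; rewrite inE negb_or eq_sym => /andP[r0 rs0] rsR.
apply: within_Comp; last by apply: IHrs => // q q_rs; rewrite rsR// inE q_rs orbT.
apply: (@within_sub [:: r]); first by move=> q; rewrite inE => /eqP ->; rewrite rsR ?mem_head.
by apply: within_Loop => //; apply: within_push_word.
Qed.

Definition template_regs (T : seq ((seq nat * nat) * nat)) : seq nat :=
  flatten [seq x.1.1 | x <- T].

Lemma within_emit_agent R D T : template_ok T -> {subset template_regs T <= R} ->
  within R (emit_agent D T).
Proof.
move=> T_ok TR; rewrite /emit_agent.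
have: all (fun t : token => (0 \notin t.1.1) && all (fun q => q \in R) t.1.1) (agent_tokens D T).
  rewrite /agent_tokens /= all_cat /= andbT.
  elim: T T_ok TR => //= x T IHT /andP[/andP[x0 _] T_ok] TR.
  have -> : all (fun q => q \in R) x.1.1.
    by apply/allP => r rx; apply: TR; rewrite /template_regs /= mem_cat rx.
  rewrite x0 /=; apply: IHT => // r rT.
  by apply: TR; move: rT; rewrite /template_regs /= mem_cat => ->; rewrite orbT.
elim: (agent_tokens D T) => //= t ts IHts /andP[/andP[t0 /allP tR] /IHts{}IHts].
by apply: within_Comp => //; apply: within_emit_token.
Qed.

Lemma within_emit_agents R D Ts :
  all (fun T => template_ok T && all (fun q => q \in R) (template_regs T)) Ts ->
  within R (emit_agents D Ts).
Proof.
elim: Ts => //= T Ts IHTs /andP[/andP[T_ok /allP TR] /IHTs].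
by apply: within_Comp; apply: within_emit_agent.
Qed.

Lemma within_repeat_poly R p base body : within R body ->
  0 < base -> (forall r, r \in R -> r < base) ->
  within (iota base (size p) ++ R) (repeat_poly p base body).
Proof.
elim: p base => //= a p IHp base bodyR base0 R_lt.
apply: within_Comp.
  apply: within_iter; apply: within_sub bodyR => r rR.
  by rewrite inE mem_cat rR !orbT.
have {}IHp : within (iota base.+1 (size p) ++ R) (repeat_poly p base.+1 body).
  by apply: IHp => // r /R_lt; apply: leqW.
apply: within_Loop => //; first by rewrite -lt0n.
rewrite mem_cat mem_iota ltnn /=; apply/negP => /R_lt; by rewrite ltnn.
Qed.

(** * Printing the agents of a local constraint system *)

(** Every field lists constraints relative to the current cell of a walk. They depend on the machine
    alone, so they are built into the program; the input only decides where they are placed. *)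
Record csp_rules := CspRules {
  row_left : seq (seq (nat * nat));
  row_head : seq (seq (nat * nat));
  row_right : seq (seq (nat * nat));
  vertical : seq (seq (nat * nat));
  accept : seq (seq (nat * nat));
  blank_left : seq (seq (nat * nat));
  input_one : seq (seq (nat * nat));
  input_zero : seq (seq (nat * nat));
  input_blank : seq (seq (nat * nat));
  guess : seq (seq (nat * nat));
  guess_blank : seq (seq (nat * nat));
  first_row : seq (seq (nat * nat)) }.

Section Emission.
Variables (k w : nat).

Let D := gadget_mass k w.

(* Register 5 holds the number of cells and register 6 the distance between
   vertical neighbours.  A literal [(o, t, b)] of a template refers to the
   cell at distance 0, 1 or the content of register 6 for [o = 0, 1, 2]. *)
Definition offset (W o : nat) := if o == 1 then 1 else if o == 2 then W else 0.

(** Since [k] is a constant, the number of a cell slot is linear in the registers: the index of the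
    cell is counted [2k] times. *)
Definition cell_expr (I : nat) (l : nat * nat * bool) : seq nat * nat :=
  ([:: 5; 5] ++ nseq k.*2 I ++ (if l.1.1 == 2 then nseq k.*2 6 else [::]),
   3 + l.1.2.*2 + l.2 + (if l.1.1 == 1 then k.*2 else 0)).

Definition exact_template (I : nat) (L : seq (nat * nat * bool)) :=
  (([::], 0), w) ::
  (if size L == k then [::] else [:: (([:: 5; 5], 2), k - size L)]) ++
  [seq (cell_expr I l, 1) | l <- L].

Definition force_template (I : nat) (b : bool) :=
  (([:: I; I], b + 1), w) :: [seq (cell_expr I (0, t, b), 1) | t <- iota 0 k].

Definition flip_template := [:: (([:: 5; 5], 1), D)].

Definition csp_templates I (Cs : seq (seq (nat * nat))) :=
  [seq exact_template I [seq (l, false) | l <- C] | C <- Cs].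

Definition cell_templates I :=
  [:: force_template I false, force_template I true,
      exact_template I (cell_lits k 0) &
      [seq exact_template I (link_lits k 0 t) | t <- iota 0 k]].

Definition shift_csp (W i : nat) (C : seq (nat * nat)) :=
  [seq (i + offset W l.1, l.2) | l <- C].

Lemma linear_cell_expr s N W I i l : size (s 5) = N -> size (s 6) = W ->
  size (s I) = i ->
  linear_val s (cell_expr I l) = cell_slot k N (i + offset W l.1.1) l.1.2 l.2.
Proof.
case: l => [[f t] b] /= sN sW si; rewrite /linear_val /cell_expr /cell_slot /=.
rewrite map_cat sumn_cat map_nseq sumn_nseq sN si /offset.
case: (f =P 1) => [->|f1] /=; first by lia.
by case: ifP => f2; rewrite ?map_nseq ?sumn_nseq ?sW /=; lia.
Qed.

Lemma slots_val_exact s N W I i L : size (s 5) = N -> size (s 6) = W ->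
  size (s I) = i ->
  slots_val s (exact_template I L) =
    exact_agent k w N [seq (i + offset W l.1.1, l.1.2, l.2) | l <- L].
Proof.
move=> sN sW si; rewrite /slots_val /exact_template /exact_agent /= map_cat size_map.
congr (_ :: _ ++ _).
  by case: ifP => //= _; rewrite /linear_val /= sN /minus_slot; congr [:: (_, _)]; lia.
by rewrite -!map_comp; apply: eq_map => l /=; rewrite (linear_cell_expr _ sN sW si).
Qed.

Lemma slots_val_force s N W I i b : size (s 5) = N -> size (s 6) = W ->
  size (s I) = i -> slots_val s (force_template I b) = force_agent k w N i b.
Proof.
move=> sN sW si; rewrite /slots_val /force_template /force_agent /=.
congr (_ :: _).
  by rewrite /linear_val /= si /force_slot; congr pair; lia.
rewrite -!map_comp; apply: eq_map => t /=.
by rewrite (linear_cell_expr _ sN sW si) /= /offset /= addn0.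
Qed.

Lemma slots_val_flip s N : size (s 5) = N ->
  slots_val s flip_template = flip_agent k w N.
Proof.
move=> sN; rewrite /slots_val /flip_agent /linear_val /= sN /flip_slot.
by congr [:: (_, _)]; lia.
Qed.

Hypothesis w_gt0 : 0 < w.

Lemma template_ok_exact I L : I != 0 -> size L <= k -> template_ok (exact_template I L).
Proof.
move=> I0 leL; rewrite /template_ok /exact_template /= w_gt0 /= all_cat.
apply/andP; split.
  by case: eqP => //= /eqP neL; rewrite andbT subn_gt0 ltn_neqAle neL.
rewrite all_map; apply/allP => l _ /=; rewrite andbT !inE /= mem_cat negb_or mem_nseq.
rewrite eq_sym (negbTE I0) andbF /=.
by case: ifP => //; rewrite mem_nseq andbF.
Qed.

Lemma template_ok_force I b : I != 0 -> template_ok (force_template I b).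
Proof.
move=> I0; rewrite /template_ok /force_template /= !inE w_gt0 eq_sym (negbTE I0) /=.
rewrite all_map; apply/allP => t _ /=; rewrite andbT !inE /= cats0 mem_nseq.
by rewrite eq_sym (negbTE I0) andbF.
Qed.

Lemma regs_cell_expr I l : {subset (cell_expr I l).1 <= [:: 5; 6; I]}.
Proof.
move=> r; rewrite /cell_expr /= !inE mem_cat mem_nseq.
case/predU1P => [->//|/predU1P[->//|/orP[/andP[_ ->]|]]]; first by rewrite !orbT.
by case: ifP => // _; rewrite mem_nseq => /andP[_ ->]; rewrite orbT.
Qed.

Lemma regs_cells I (L : seq (nat * nat * bool)) :
  {subset template_regs [seq (cell_expr I l, 1) | l <- L] <= [:: 5; 6; I]}.
Proof.
move=> r /flattenP[rs /mapP[x /mapP[l _ ->] ->]] /=; exact: regs_cell_expr.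
Qed.

Lemma regs_exact I L : {subset template_regs (exact_template I L) <= [:: 5; 6; I]}.
Proof.
move=> r; rewrite /template_regs /exact_template /= map_cat flatten_cat mem_cat.
by case/orP=> [|/regs_cells//]; case: ifP => //= _; rewrite !inE orbb => ->.
Qed.

Lemma regs_force I b : {subset template_regs (force_template I b) <= [:: 5; 6; I]}.
Proof.
move=> r; rewrite /template_regs /force_template /= !inE.
case/predU1P => [->|/predU1P[->|]]; rewrite ?eqxx ?orbT//.
have := @regs_cells I [seq (0, t, b) | t <- iota 0 k] r.
by rewrite -map_comp !inE; apply.
Qed.

Lemma csp_templates_ok I Cs : I != 0 -> all (fun C : seq (nat * nat) => size C <= k) Cs ->
  all template_ok (csp_templates I Cs).
Proof.
move=> I0 /allP leC; rewrite all_map; apply/allP => C /leC leCk /=.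
by apply: template_ok_exact; rewrite ?size_map.
Qed.

Lemma cell_templates_ok I : I != 0 -> all template_ok (cell_templates I).
Proof.
move=> I0; have ok_ex L : size L = k -> template_ok (exact_template I L).
  by move=> sL; rewrite template_ok_exact ?sL.
apply/allP => T; rewrite !inE => /or4P[/eqP->|/eqP->|/eqP->|/mapP[t _ ->]].
- exact: template_ok_force.
- exact: template_ok_force.
- by apply: ok_ex; rewrite size_map size_iota.
by apply: ok_ex; rewrite size_map size_iota.
Qed.

Lemma regs_csp_templates I Cs : all (fun T => all (fun q => q \in [:: 5; 6; I]) (template_regs T))
  (csp_templates I Cs).
Proof.
by rewrite all_map; apply/allP => C _ /=; apply/allP => r; apply: regs_exact.
Qed.

Lemma regs_cell_templates I : all (fun T => all (fun q => q \in [:: 5; 6; I]) (template_regs T))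
  (cell_templates I).
Proof.
have exR L : all (fun q => q \in [:: 5; 6; I]) (template_regs (exact_template I L)).
  by apply/allP => r; apply: regs_exact.
have foR b : all (fun q => q \in [:: 5; 6; I]) (template_regs (force_template I b)).
  by apply/allP => r; apply: regs_force.
rewrite /cell_templates; apply/allP => T; rewrite !inE.
case/or4P=> [/eqP->|/eqP->|/eqP->|/mapP[t _ ->]].
- exact: foR.
- exact: foR.
- exact: exR.
exact: exR.
Qed.

Definition walk_step I Ts := Comp (emit_agents D Ts) (Push I true).

Lemma within_walk_step I Ts :
  all template_ok Ts -> all (fun T => all (fun q => q \in [:: 5; 6; I]) (template_regs T)) Ts ->
  within [:: 5; 6; I] (walk_step I Ts).
Proof.
move=> /allP Ts_ok /allP TsR; apply: within_Comp.
  by apply: within_emit_agents; apply/allP => T TT; rewrite Ts_ok ?TsR.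
by apply: within_Push; rewrite !inE eqxx !orbT.
Qed.

Lemma prints_walk r I Ts1 Ts0 s i : r != 0 -> I != 0 -> I != r ->
  all template_ok Ts1 -> all template_ok Ts0 -> s I = nseq i true ->
  prints D (Loop r (walk_step I Ts1) (walk_step I Ts0)) s
    (upd s I (nseq (i + size (s r)) true))
    (fun A => exists2 j, j < size (s r) &
      A \in [seq slots_val (upd s I (nseq (i + j) true)) T
            | T <- if nth false (s r) j then Ts1 else Ts0]).
Proof.
move=> r0 I0 Ir ok1 ok0 sI.
apply: (@prints_Loop _ _ _ _ _ (fun j => upd s I (nseq (i + j) true))) => //.
  by rewrite addn0 -sI upd_id.
move=> j lt_j; set Ts := if _ then Ts1 else Ts0.
rewrite -(fun_if (walk_step I)) -/Ts.
have Ts_ok : all template_ok Ts by rewrite /Ts; case: ifP.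
have -> : upd s I (nseq (i + j.+1) true) =
    upd (upd s I (nseq (i + j) true)) I (true :: upd s I (nseq (i + j) true) I).
  by rewrite upd_upd upd_eq addnS.
apply: prints_iff (prints_Comp (prints_agents D (upd s I (nseq (i + j) true)) Ts_ok)
  (prints_Push D true _ I0)); first by move=> A; split=> [[]|] //; left.
Qed.


Definition csp_ok (Cs : seq (seq (nat * nat))) := all (fun C : seq (nat * nat) => size C <= k) Cs.

Definition csp_walk r I C1 C0 :=
  Loop r (walk_step I (csp_templates I C1)) (walk_step I (csp_templates I C0)).

Definition csp_emit I C := emit_agents D (csp_templates I C).

Definition shifted (W i : nat) (Cs : seq (seq (nat * nat))) (c : seq (nat * nat)) :=
  exists2 C, C \in Cs & c = shift_csp W i C.

Definition exacts N (CS : seq (nat * nat) -> Prop) (A : seq (nat * nat)) :=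
  exists2 c, CS c & A = exact_agent k w N (first_lits c).

Lemma slots_val_csp s N W I i Cs0 A : size (s 5) = N -> size (s 6) = W ->
  size (s I) = i ->
  A \in [seq slots_val s T | T <- csp_templates I Cs0] <-> exacts N (shifted W i Cs0) A.
Proof.
move=> sN sW si.
have valE C : slots_val s (exact_template I [seq (l, false) | l <- C]) =
    exact_agent k w N (first_lits (shift_csp W i C)).
  by rewrite (slots_val_exact _ sN sW si) /first_lits /shift_csp -!map_comp.
split=> [/mapP[_ /mapP[C CC ->] ->]|[c [C CC ->] ->]].
  by rewrite valE; exists (shift_csp W i C) => //; exists C.
by rewrite -valE; apply/map_f/map_f.
Qed.

Lemma exacts_exists N T (P : T -> Prop) (CS : T -> seq (nat * nat) -> Prop) A :
  (exists2 j, P j & exacts N (CS j) A) <-> exacts N (fun c => exists2 j, P j & CS j c) A.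
Proof.
split=> [[j Pj [c cC ->]]|[c [j Pj cC] ->]].
  by exists c => //; exists j.
by exists j => //; exists c.
Qed.

Lemma prints_csp_walk r I C1 C0 s N W i : r != 0 -> r \notin [:: 5; 6] ->
  I \notin [:: 0; 5; 6; r] -> csp_ok C1 -> csp_ok C0 ->
  size (s 5) = N -> size (s 6) = W -> s I = nseq i true ->
  prints D (csp_walk r I C1 C0) s (upd s I (nseq (i + size (s r)) true))
    (exacts N (fun c => exists2 j, j < size (s r) &
       shifted W (i + j) (if nth false (s r) j then C1 else C0) c)).
Proof.
move=> r0 r56; rewrite !inE !negb_or => /and4P[I0 I5 I6 Ir] ok1 ok0 sN sW sI.
apply: prints_iff (@prints_walk r I _ _ s i r0 I0 Ir _ _ sI).
- move=> A; rewrite -exacts_exists; split=> -[j lt_j PA]; exists j => //.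
    by move: PA; rewrite -(fun_if (csp_templates I)) (@slots_val_csp _ N W _ (i + j))//
         ?upd_eq ?size_nseq ?upd_neq// eq_sym.
  by rewrite -(fun_if (csp_templates I)) (@slots_val_csp _ N W _ (i + j))//
       ?upd_eq ?size_nseq ?upd_neq// eq_sym.
- exact: csp_templates_ok.
- exact: csp_templates_ok.
Qed.

Lemma prints_csp_emit I C s N W i : I != 0 -> csp_ok C ->
  size (s 5) = N -> size (s 6) = W -> s I = nseq i true ->
  prints D (csp_emit I C) s s (exacts N (shifted W i C)).
Proof.
move=> I0 okC sN sW sI; apply: prints_iff (prints_agents _ _ _) => [A|].
  by rewrite (@slots_val_csp _ N W _ i)// sI size_nseq.
exact: csp_templates_ok.
Qed.

Variable Q : csp_rules.

Definition rules_ok := [/\ csp_ok (row_left Q), csp_ok (row_head Q), csp_ok (row_right Q),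
  csp_ok (vertical Q) & csp_ok (accept Q)] /\ [/\ csp_ok (blank_left Q),
  csp_ok (input_one Q), csp_ok (input_zero Q) & csp_ok (input_blank Q)] /\
  [/\ csp_ok (guess Q), csp_ok (guess_blank Q) & csp_ok (first_row Q)].

Hypothesis Q_ok : rules_ok.

(* Register 2 holds the input [x] and, with the notation of [tableau_csp] below,
   registers 5 to 12, 19 and 20 hold words of length [N], [W], [h], [T + 1],
   [T * W], [B], [B + T + 2], [n + T + 2], [N] and [W], where [N] is the number
   of cells.  The content of registers 13 to 18 gives the current cell of the
   walks; walks without constraints only move it. *)
Definition row_cmd :=
  block [:: csp_walk 7 14 (row_left Q) (row_left Q); csp_emit 14 (row_head Q);
    csp_walk 7 14 (row_right Q) (row_right Q); Push 14 true].

Definition emission :=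
  block [:: emit_agent D flip_template;
    Loop 19 (walk_step 13 (cell_templates 13)) (walk_step 13 (cell_templates 13));
    Loop 8 row_cmd row_cmd;
    csp_walk 9 15 (vertical Q) (vertical Q); csp_walk 7 15 [::] [::]; csp_emit 15 (accept Q);
    csp_walk 7 16 (blank_left Q) (blank_left Q); csp_walk 2 16 (input_one Q) (input_zero Q);
    csp_walk 11 16 (input_blank Q) (input_blank Q);
    csp_walk 7 17 [::] [::]; csp_walk 10 17 (guess Q) (guess Q);
    csp_walk 12 17 (guess_blank Q) (guess_blank Q);
    csp_walk 20 18 (first_row Q) (first_row Q)].


(* The rows of the tableau have [h] columns on each side of the head column. *)
Definition tableau_csp (T B : nat) (x : word) (c : seq (nat * nat)) : Prop :=
  let n := size x in
  let h := n + B + T + 1 in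
  let W := (h + h).+1 in
  (exists2 i, i <= T &
    [\/ exists2 j, j < h & shifted W (i * W + j) (row_left Q) c,
        shifted W (i * W + h) (row_head Q) c |
        exists2 j, j < h & shifted W (i * W + h + j) (row_right Q) c]) \/
  (exists2 i, i < T * W & shifted W i (vertical Q) c) \/
  shifted W (T * W + h) (accept Q) c \/
  (exists2 j, j < h & shifted W j (blank_left Q) c) \/
  (exists2 j, j < n &
     shifted W (h + j) (if nth false x j then input_one Q else input_zero Q) c) \/
  (exists2 j, j < B + T + 2 & shifted W (h + n + j) (input_blank Q) c) \/
  (exists2 j, j < B & shifted W (h + j) (guess Q) c) \/
  (exists2 j, j < n + T + 2 & shifted W (h + B + j) (guess_blank Q) c) \/
  (exists2 j, j < W & shifted W j (first_row Q) c).

Lemma prints_row s N W h i : size (s 5) = N -> size (s 6) = W -> size (s 7) = h ->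
  s 14 = nseq i true ->
  prints D row_cmd s (upd s 14 (nseq (i + (h + h).+1) true)) (exacts N (fun c =>
    [\/ exists2 j, j < h & shifted W (i + j) (row_left Q) c,
        shifted W (i + h) (row_head Q) c |
        exists2 j, j < h & shifted W (i + h + j) (row_right Q) c])).
Proof.
move=> sN sW sh si; have [[Qa Qb Qc _ _] _] := Q_ok.
rewrite /row_cmd /block /=.
pose s1 := upd s 14 (nseq (i + h) true).
pose s2 := upd s 14 (nseq (i + h + h) true).
have pr1 := @prints_csp_walk 7 14 _ _ s N W i isT isT isT Qa Qa sN sW si.
have pr2 := @prints_csp_emit 14 _ s1 N W (i + h) isT Qb sN sW (upd_eq _ _ _).
have pr3 := @prints_csp_walk 7 14 _ _ s1 N W (i + h) isT isT isT Qc Qc sN sW (upd_eq _ _ _).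
have pr4 := @prints_Push D 14 true s2 isT.
have s17 : size (s1 7) = h by [].
rewrite s17 /s1 upd_upd -/s1 -/s2 in pr3; rewrite sh -/s1 in pr1.
have pr5 := prints_Comp pr1 (prints_Comp pr2 (prints_Comp pr3 (prints_Comp pr4
  (@prints_agents D [::] _ isT)))).
rewrite /s2 upd_upd upd_eq in pr5.
have e : (i + (h + h).+1) = (i + h + h).+1 by lia.
rewrite e; apply: prints_iff pr5 => A.
rewrite -[X in X <-> _]/(_ \/ _ \/ _ \/ False \/ _).
have -> : (A \in [seq slots_val (upd s 14 (true :: nseq (i + h + h) true)) T | T <- [::]] <-> False) by [].
split=> [[[c [j lt_j cC] ->]|[[c cC ->]|[[c [j lt_j cC] ->]|[]//]]]|[c cC ->]].
- by exists c => //; apply: Or31; exists j => //; move: cC; rewrite if_same.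
- by exists c => //; apply: Or32.
- by exists c => //; apply: Or33; exists j => //; move: cC; rewrite if_same.
case: cC => [[j lt_j cC]|cC|[j lt_j cC]].
- by left; exists c => //; exists j; rewrite // if_same.
- by right; left; exists c.
- by right; right; left; exists c => //; exists j; rewrite // if_same.
Qed.

End Emission.

Section Emission.
Variables (k w : nat) (Q : csp_rules).
Hypotheses (w_gt0 : 0 < w) (Q_ok : rules_ok k Q).

Let D := gadget_mass k w.

Lemma exacts_link N s i A : size (s 5) = N -> size (s 13) = i ->
  A \in [seq slots_val s T | T <- cell_templates k w 13] <->
  [\/ A = force_agent k w N i false, A = force_agent k w N i true,
      A = exact_agent k w N (cell_lits k i) |
      exists2 t, t < k & A = exact_agent k w N (link_lits k i t)].
Proof.
move=> sN si; have cellE L : slots_val s (exact_template k w 13 [seq (0, l.1, l.2) | l <- L]) =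
    exact_agent k w N [seq (i, l.1, l.2) | l <- L].
  by rewrite (slots_val_exact _ _ _ sN erefl si) -map_comp; congr exact_agent;
     apply: eq_map => l /=; rewrite /offset /= addn0.
have litsE j : cell_lits k j = [seq (j, l.1, l.2) | l <- [seq (t, false) | t <- iota 0 k]].
  by rewrite /cell_lits -map_comp.
have linkE j t : link_lits k j t = [seq (j, l.1, l.2) | l <- [seq (u, u == t) | u <- iota 0 k]].
  by rewrite /link_lits -map_comp.
rewrite /cell_templates !(map_cons (slots_val s)) !(slots_val_force _ _ _ sN erefl si).
rewrite litsE cellE -litsE !inE; split.
  case/or4P=> [/eqP->|/eqP->|/eqP->|/mapP[_ /mapP[t t_k ->] ->]].
  - exact: Or41.
  - exact: Or42.
  - exact: Or43.
  by apply: Or44; rewrite linkE cellE -linkE; exists t => //; move: t_k; rewrite mem_iota.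
case=> [->|->|->|[t t_k ->]]; rewrite ?eqxx ?orbT//.
apply/or4P/Or44/mapP; exists (exact_template k w 13 (link_lits k 0 t)).
  by apply/map_f; rewrite mem_iota.
by rewrite [in RHS]linkE cellE -linkE.
Qed.

(** The final registers are given explicitly because their sizes enter the bound on the running
    time. *)
Lemma prints_emission s T B x :
  let n := size x in
  let h := n + B + T + 1 in
  let W := (h + h).+1 in
  let N := T.+1 * W in
  s 2 = x -> size (s 5) = N -> size (s 6) = W -> size (s 7) = h ->
  size (s 8) = T.+1 -> size (s 9) = T * W -> size (s 10) = B ->
  size (s 11) = B + T + 2 -> size (s 12) = n + T + 2 -> size (s 19) = N ->
  size (s 20) = W -> (forall r, 13 <= r <= 18 -> s r = [::]) ->
  prints D (emission k w Q) s
    (upd (upd (upd (upd (upd (upd s 13 (nseq N true)) 14 (nseq N true))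
       15 (nseq (T * W + h) true)) 16 (nseq (h + n + (B + T + 2)) true))
       17 (nseq (h + B + (n + T + 2)) true)) 18 (nseq W true))
    (gadget_agent k w N (tableau_csp Q T B x)).
Proof.
move=> n h W N s2 s5 s6 s7 s8 s9 s10 s11 s12 s19 s20 s_empty.
have [[Qa Qb Qc Qv Qf] [[Ql Q1 Q0 Qx] [Qg Qy Qs]]] := Q_ok.
rewrite /emission /block [foldr _ _ _]/= -/D.
have pr0 : prints D (emit_agent D (flip_template k w)) s s (fun A => A = flip_agent k w N).
  apply: prints_iff (prints_agent _ _ _) => [A|]; first by rewrite (slots_val_flip _ _ s5).
  by rewrite /template_ok /= andbT addn_gt0 w_gt0 orbT.
pose s13 := upd s 13 (nseq N true).
have pr1 : prints D (Loop 19 (walk_step k w 13 (cell_templates k w 13))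
    (walk_step k w 13 (cell_templates k w 13))) s s13
    (fun A => exists2 i, i < N & [\/ A = force_agent k w N i false, A = force_agent k w N i true,
      A = exact_agent k w N (cell_lits k i) |
      exists2 t, t < k & A = exact_agent k w N (link_lits k i t)]).
  have ct_ok := @cell_templates_ok k w w_gt0 13 isT.
  have s13E : s 13 = nseq 0 true by rewrite s_empty.
  have := @prints_walk k w 19 13 _ _ s 0 isT isT isT ct_ok ct_ok s13E.
  rewrite s19 add0n -/s13; apply: prints_iff => A.
  split=> -[i lt_i cA]; exists i => //; move: cA; rewrite if_same;
    by rewrite (@exacts_link N _ i) ?upd_eq ?size_nseq.
pose s14 := upd s13 14 (nseq N true).
have pr2 : prints D (Loop 8 (row_cmd k w Q) (row_cmd k w Q)) s13 s14
  (exacts k w N (fun c => exists2 i, i <= T & [\/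
    exists2 j, j < h & shifted W (i * W + j) (row_left Q) c,
    shifted W (i * W + h) (row_head Q) c |
    exists2 j, j < h & shifted W (i * W + h + j) (row_right Q) c])).
  have e : s13 = upd s13 14 (nseq (0 * W) true).
    rewrite mul0n; have -> : nseq 0 true = s13 14 by rewrite -[s13 14]/(s 14) s_empty.
    by rewrite upd_id.
  have := @prints_Loop D 8 (row_cmd k w Q) (row_cmd k w Q) s13
    (fun i => upd s13 14 (nseq (i * W) true)) _ isT (esym e).
  rewrite -[s13 8]/(s 8) s8 -/N -/s14 => /(_ _ _)/prints_iff; apply; last first.
    move=> i lt_i; rewrite if_same.
    have := @prints_row k w w_gt0 Q Q_ok (upd s13 14 (nseq (i * W) true)) N W h (i * W)
      s5 s6 s7 (upd_eq _ _ _).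
    by rewrite upd_upd addnC -mulSn; apply.
  move=> A; rewrite -exacts_exists.
  by split=> -[i lt_i cA]; exists i.
pose s15 := upd s14 15 (nseq (T * W) true).
have pr3 : prints D (csp_walk k w 9 15 (vertical Q) (vertical Q)) s14 s15
    (exacts k w N (fun c => exists2 i, i < T * W & shifted W i (vertical Q) c)).
  have := @prints_csp_walk k w w_gt0 9 15 _ _ s14 N W 0 isT isT isT Qv Qv s5 s6 (s_empty 15 isT).
  rewrite -[s14 9]/(s 9) s9 add0n -/s15; apply: prints_iff => A.
  rewrite -!exacts_exists; split=> -[i lt_i cA]; exists i => //; move: cA; by rewrite if_same.
pose s15' := upd s14 15 (nseq (T * W + h) true).
have skip I i s0 : I \notin [:: 0; 5; 6; 7] -> size (s0 5) = N -> size (s0 6) = W ->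
    size (s0 7) = h -> s0 I = nseq i true ->
    prints D (csp_walk k w 7 I [::] [::]) s0 (upd s0 I (nseq (i + h) true)) (fun _ => False).
  move=> I_ok e5 e6 e7 e; have := @prints_csp_walk k w w_gt0 7 I [::] [::] s0 N W i isT isT I_ok isT isT e5 e6 e.
  rewrite e7; apply: prints_iff => A; rewrite -exacts_exists.
  by split=> // -[j _ []] c []; rewrite if_same.
have pr4 := @skip 15 (T * W) s15 isT s5 s6 s7 (upd_eq _ _ _).
rewrite {2}/s15 upd_upd -/s15' in pr4.
have pr5 := @prints_csp_emit k w w_gt0 15 _ s15' N W (T * W + h) isT Qf s5 s6 (upd_eq _ _ _).
pose s16 := upd s15' 16 (nseq h true).
have pr6 : prints D (csp_walk k w 7 16 (blank_left Q) (blank_left Q)) s15' s16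
    (exacts k w N (fun c => exists2 i, i < h & shifted W i (blank_left Q) c)).
  have := @prints_csp_walk k w w_gt0 7 16 _ _ s15' N W 0 isT isT isT Ql Ql s5 s6 (s_empty 16 isT).
  rewrite -[s15' 7]/(s 7) s7 add0n -/s16; apply: prints_iff => A.
  rewrite -!exacts_exists; split=> -[i lt_i cA]; exists i => //; move: cA; by rewrite if_same.
pose s16' := upd s15' 16 (nseq (h + n) true).
have pr7 : prints D (csp_walk k w 2 16 (input_one Q) (input_zero Q)) s16 s16'
    (exacts k w N (fun c => exists2 j, j < n &
      shifted W (h + j) (if nth false x j then input_one Q else input_zero Q) c)).
  have := @prints_csp_walk k w w_gt0 2 16 _ _ s16 N W h isT isT isT Q1 Q0 s5 s6 (upd_eq _ _ _).
  by rewrite -[s16 2]/(s 2) s2 -/n {2}/s16 upd_upd.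
pose s16'' := upd s15' 16 (nseq (h + n + (B + T + 2)) true).
have pr8 : prints D (csp_walk k w 11 16 (input_blank Q) (input_blank Q)) s16' s16''
    (exacts k w N (fun c => exists2 j, j < B + T + 2 & shifted W (h + n + j) (input_blank Q) c)).
  have := @prints_csp_walk k w w_gt0 11 16 _ _ s16' N W (h + n) isT isT isT Qx Qx s5 s6 (upd_eq _ _ _).
  rewrite -[s16' 11]/(s 11) s11 {2}/s16' upd_upd; apply: prints_iff => A.
  rewrite -!exacts_exists; split=> -[i lt_i cA]; exists i => //; move: cA; by rewrite if_same.
pose s17 := upd s16'' 17 (nseq h true).
have pr9 := @skip 17 0 s16'' isT s5 s6 s7 (s_empty 17 isT).
rewrite add0n -/s17 in pr9.
pose s17' := upd s16'' 17 (nseq (h + B) true).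
have pr10 : prints D (csp_walk k w 10 17 (guess Q) (guess Q)) s17 s17'
    (exacts k w N (fun c => exists2 j, j < B & shifted W (h + j) (guess Q) c)).
  have := @prints_csp_walk k w w_gt0 10 17 _ _ s17 N W h isT isT isT Qg Qg s5 s6 (upd_eq _ _ _).
  rewrite -[s17 10]/(s 10) s10 {2}/s17 upd_upd; apply: prints_iff => A.
  rewrite -!exacts_exists; split=> -[i lt_i cA]; exists i => //; move: cA; by rewrite if_same.
pose s17'' := upd s16'' 17 (nseq (h + B + (n + T + 2)) true).
have pr11 : prints D (csp_walk k w 12 17 (guess_blank Q) (guess_blank Q)) s17' s17''
    (exacts k w N (fun c => exists2 j, j < n + T + 2 & shifted W (h + B + j) (guess_blank Q) c)).
  have := @prints_csp_walk k w w_gt0 12 17 _ _ s17' N W (h + B) isT isT isT Qy Qy s5 s6 (upd_eq _ _ _).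
  rewrite -[s17' 12]/(s 12) s12 {2}/s17' upd_upd; apply: prints_iff => A.
  rewrite -!exacts_exists; split=> -[i lt_i cA]; exists i => //; move: cA; by rewrite if_same.
have pr12 : prints D (csp_walk k w 20 18 (first_row Q) (first_row Q)) s17'' (upd s17'' 18 (nseq W true))
    (exacts k w N (fun c => exists2 j, j < W & shifted W j (first_row Q) c)).
  have := @prints_csp_walk k w w_gt0 20 18 _ _ s17'' N W 0 isT isT isT Qs Qs s5 s6 (s_empty 18 isT).
  rewrite -[s17'' 20]/(s 20) s20 add0n; apply: prints_iff => A.
  rewrite -!exacts_exists; split=> -[i lt_i cA]; exists i => //; move: cA; by rewrite if_same.
have pr13 := @prints_agents D [::] (upd s17'' 18 (nseq W true)) isT.
have := prints_Comp pr0 (prints_Comp pr1 (prints_Comp pr2 (prints_Comp pr3 (prints_Comp pr4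
  (prints_Comp pr5 (prints_Comp pr6 (prints_Comp pr7 (prints_Comp pr8 (prints_Comp pr9
  (prints_Comp pr10 (prints_Comp pr11 (prints_Comp pr12 pr13)))))))))))).
apply: prints_iff => A {pr0 pr1 pr2 pr3 pr4 pr5 pr6 pr7 pr8 pr9 pr10 pr11 pr12 pr13}.
split.
  case=> [->|[[i lt_i]|]]; first exact: Or41.
    case=> [->|->|->|[t lt_t ->]].
    - by apply: Or42; exists i, false.
    - by apply: Or42; exists i, true.
    - by apply: Or43; exists i; [|left].
    - by apply: Or43; exists i; [|right; exists t].
  case=> [[c cC ->]|[[c cC ->]|[[]|[[c cC ->]|[[c cC ->]|[[c cC ->]|[[c cC ->]|[[]|[[c cC ->]|
    [[c cC ->]|[[c cC ->]|//]]]]]]]]]]]; apply: Or44; exists c => //.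
  - by left.
  - by do 1!right; left.
  - by do 2!right; left.
  - by do 3!right; left.
  - by do 4!right; left.
  - by do 5!right; left.
  - by do 6!right; left.
  - by do 7!right; left.
  - by do 8!right.
case=> [->|[i [b [lt_i ->]]]|[i lt_i [->|[t lt_t ->]]]|[c cC ->]].
- by left.
- by right; left; exists i => //; case: b; [apply: Or42 | apply: Or41].
- by right; left; exists i => //; apply: Or43.
- by right; left; exists i => //; apply: Or44; exists t.
right; right; move: cC; rewrite /tableau_csp -/n -/h -/W.
move=> [cC|[cC|[cC|[cC|[cC|[cC|[cC|[cC|cC]]]]]]]].
- by left; exists c.
- by do 1!right; left; exists c.
- by do 3!right; left; exists c.
- by do 4!right; left; exists c.
- by do 5!right; left; exists c.
- by do 6!right; left; exists c.
- by do 8!right; left; exists c.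
- by do 9!right; left; exists c.
- by do 10!right; left; exists c.
Qed.

End Emission.

(** * Polynomial counters in unary and the bound on the number of cuts *)

Definition evaln (p : {poly nat}) (n : nat) : nat := horner p n.

Lemma hornerDn (p q : {poly nat}) n : evaln (p + q)%R n = evaln p n + evaln q n.
Proof. exact: hornerD. Qed.

Lemma hornerMn (p q : {poly nat}) n : evaln (p * q)%R n = evaln p n * evaln q n.
Proof. exact: hornerM. Qed.

Lemma hornerCn c n : evaln (c%:P)%R n = c.
Proof. exact: hornerC. Qed.

Lemma hornerXn n : evaln ('X)%R n = n.
Proof. exact: hornerX. Qed.

Lemma horner_expn (p : {poly nat}) d n : evaln (p ^+ d)%R n = evaln p n ^ d.
Proof.
elim: d => [|d IHd]; first by rewrite GRing.expr0; exact: (hornerCn 1 n).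
by rewrite GRing.exprS hornerMn IHd expnS.
Qed.

Definition hornern := (hornerDn, hornerMn, hornerCn, hornerXn, horner_expn).

Section Setup.
Variables (base d : nat).

Definition push_copies : cmd :=
  foldr (fun r c => Comp (Push r true) c) Skip (iota base d).

Lemma run_push_copies s r :
  run push_copies s r = if r \in iota base d then true :: s r else s r.
Proof.
rewrite /push_copies; elim: d base s => // e IHe b s.
rewrite /= IHe inE; case: eqP => [->|/eqP nrb] /=.
  by rewrite mem_iota ltnn /= upd_eq.
by rewrite upd_neq.
Qed.

Lemma run_Loop_copies q s r : q \notin iota base d ->
  run (Loop q push_copies push_copies) s r =
  if r \in iota base d then nseq (size (s q)) true ++ s r else s r.
Proof.
move=> _ /=; move: (s q) => v; elim: v s => [|b v IHv] s /=; first by rewrite if_same.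
rewrite if_same IHv run_push_copies; case: (r \in _) => //.
by elim: (size v) => //= m ->.
Qed.

(** Copying by pushes reverses a word. The input is therefore moved twice, and the digits of the
    number of cuts are reversed once before they are printed. *)
Lemma run_Loop_Push r q s : q != r ->
  run (Loop r (Push q true) (Push q false)) s = upd s q (rev (s r) ++ s q).
Proof.
move=> qr /=; move: (s r) => v; elim: v s => [|b v IHv] s /=; first by rewrite upd_id.
rewrite (_ : (if b then _ else _) = upd s q (b :: s q)); last by case: b.
by rewrite IHv upd_upd upd_eq rev_cons cat_rcons.
Qed.

Definition set_poly (rp : nat * {poly nat}) := repeat_poly rp.2 base (Push rp.1 true).

Lemma run_set_poly (rp : nat * {poly nat}) s n : rp.1 < base -> size rp.2 <= d ->
  (forall i, i < d -> size (s (base + i)) = n) ->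
  run (set_poly rp) s = upd s rp.1 (nseq (evaln rp.2 n) true ++ s rp.1).
Proof.
move=> lt_r le_d sn; rewrite /set_poly (@repeat_polyE _ _ _ n); last 2 first.
- by move=> q; rewrite inE => /eqP ->.
- by move=> i lt_i; apply/sn/(leq_trans lt_i).
rewrite -[horner_rec _ _]/(evaln rp.2 n); elim: (evaln rp.2 n) => [|m IHm] /=.
  by rewrite upd_id.
by rewrite IHm upd_upd upd_eq.
Qed.

Lemma run_set_polys (rps : seq (nat * {poly nat})) s n :
  all (fun rp : nat * {poly nat} => (rp.1 < base) && (size rp.2 <= d)) rps ->
  uniq [seq rp.1 | rp <- rps] -> (forall rp, rp \in rps -> s rp.1 = [::]) ->
  (forall i, i < d -> size (s (base + i)) = n) ->
  run (block [seq set_poly rp | rp <- rps]) s =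
  foldl (fun s rm => upd s rm.1 (nseq rm.2 true)) s
    [seq (rp.1, evaln rp.2 n) | rp : nat * {poly nat} <- rps].
Proof.
elim: rps s => //= rp rps IHrps s /andP[/andP[lt_r le_d] rps_ok] /andP[rp_rps rps_uniq] s0 sn.
rewrite (run_set_poly lt_r le_d sn) s0 ?mem_head// cats0 IHrps//.
  move=> rp' rp'_rps; rewrite upd_neq ?s0 ?inE ?rp'_rps ?orbT//.
  by apply: contraNneq rp_rps => <-; apply: map_f.
move=> i lt_i.
by rewrite upd_neq ?sn// gtn_eqF// (leq_trans lt_r)// leq_addr.
Qed.

Lemma within_set_poly (rp : nat * {poly nat}) : rp.1 < base -> size rp.2 <= d ->
  within (iota base d ++ iota 1 base.-1) (set_poly rp).
Proof.
move=> lt_r le_d; have base0 : 0 < base by apply: leq_ltn_trans lt_r.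
have := @within_repeat_poly (iota 1 base.-1) rp.2 base (Push rp.1 true).
rewrite within_Push; last by rewrite inE mem_iota; case: (rp.1) lt_r => //= m; lia.
have lt_base r : r \in iota 1 base.-1 -> r < base by rewrite mem_iota; lia.
move=> /(_ isT base0 lt_base)/within_sub; apply.
move=> q; rewrite !mem_cat !mem_iota => /orP[/andP[-> lt_q]|->]; last by rewrite orbT.
by rewrite (leq_trans lt_q) ?leq_add2l.
Qed.

End Setup.

Section Reduction.
Variables (pT pB : {poly nat}).

(** This leaves room for the input, the guessed word, the moves of the heads, and the symbol to the
    right of the head that is inspected at the end. *)
Definition half_poly : {poly nat} := ('X + pB + pT + 1%:P)%R.
Definition width_poly : {poly nat} := (half_poly + half_poly + 1%:P)%R.
Definition size_poly : {poly nat} := ((pT + 1%:P) * width_poly)%R.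

Definition dimensions : seq (nat * {poly nat}) :=
  [:: (5, size_poly); (6, width_poly); (7, half_poly); (8, (pT + 1%:P)%R);
      (9, (pT * width_poly)%R); (10, pB);
      (11, (pB + pT + 2%:P)%R); (12, ('X + pT + 2%:P)%R); (19, size_poly); (20, width_poly)].

(** The sum merely serves as a common bound on the numbers of coefficients. *)
Definition copies : nat := sumn [seq size rp.2 | rp : nat * {poly nat} <- dimensions].

(** The output is built from its end: the number of cuts, the end mark of the list of agents, then
    the agents printed by [c]. The digits of [N] come from [N] increments, and as the least
    significant digit comes first, one push turns them into those of [2N + 1]. *)
Definition main_cmd (c : cmd) : cmd :=
  block [:: Loop 1 (Push 2 true) (Push 2 false);
    Loop 1 (push_copies 30 copies) (push_copies 30 copies);
    block [seq set_poly 30 rp | rp <- dimensions];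
    Loop 5 (Incr 3) (Incr 3); Push 3 true;
    Loop 3 (Push 4 true) (Push 4 false);
    Push 0 false;
    Loop 4 (Comp (Push 0 true) (Push 0 true)) (Comp (Push 0 false) (Push 0 true));
    Push 0 false;
    c].

(** The input arrives in the output register, which must be emptied. This single use of [Clear]
    stays outside [main_cmd], so that [cost_bound] applies to the latter. *)
Definition reduction_cmd (c : cmd) : cmd :=
  Comp (Loop 0 (Push 1 true) (Push 1 false)) (Comp (Clear 0) (main_cmd c)).

Lemma dimensions_ok :
  all (fun rp : nat * {poly nat} => (rp.1 < 30) && (size rp.2 <= copies)) dimensions.
Proof.
apply/allP => rp rp_dim; apply/andP; split.
  by move: rp rp_dim; apply/allP.
rewrite /copies; elim: dimensions rp_dim => //= rp' rps IHrps.
rewrite inE => /predU1P[->|/IHrps le_rp]; first exact: leq_addr.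
exact: leq_trans le_rp (leq_addl _ _).
Qed.

Definition ones (m : nat) : word := nseq m true.

Definition tableau_regs (x : word) (N W h T1 TW B R0 R1 : nat) : nat -> word :=
  let s1 := upd (upd (fun r => if r \in iota 30 copies then ones (size x) else [::])
    1 (rev x)) 2 x in
  let s2 := upd (upd (upd (upd s1 5 (ones N)) 6 (ones W)) 7 (ones h)) 8 (ones T1) in
  let s3 := upd (upd (upd (upd s2 9 (ones TW)) 10 (ones B)) 11 (ones R0)) 12 (ones R1) in
  let s4 := upd (upd s3 19 (ones N)) 20 (ones W) in
  upd (upd s4 3 (bits N.*2.+1)) 4 (rev (bits N.*2.+1)).

Definition half_width (x : word) := size x + evaln pB (size x) + evaln pT (size x) + 1.
Definition width (x : word) := (half_width x + half_width x).+1.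
Definition cells (x : word) := (evaln pT (size x)).+1 * width x.

Definition main_regs (x : word) : nat -> word :=
  let n := size x in
  let T := evaln pT n in
  let B := evaln pB n in
  tableau_regs x (cells x) (width x) (half_width x) T.+1 (T * width x) B
    (B + T + 2) (n + T + 2).

Lemma run_set_up (x : word) c :
  run (reduction_cmd c) (init_regs x) =
  run c (upd (main_regs x) 0 (false :: enc_nat (cells x).*2.+1)).
Proof.
set n := size x; set T := evaln pT n; set h := half_width x; set N := cells x.
rewrite /reduction_cmd.
pose s1 := upd (fun _ => [::] : word) 1 (rev x).
have -> cs : run (Comp (Loop 0 (Push 1 true) (Push 1 false)) (Comp (Clear 0) cs))
    (init_regs x) = run cs s1.
  rewrite -[LHS]/(run cs (upd (run (Loop 0 (Push 1 true) (Push 1 false)) (init_regs x)) 0 [::])).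
  rewrite run_Loop_Push//; congr run; apply: funext => -[|[|r]] //=.
    by rewrite /s1 /upd /= cats0.
have blockE c0 cs s : run (block (c0 :: cs)) s = run (block cs) (run c0 s) by [].
rewrite /main_cmd blockE run_Loop_Push//.
have -> : upd s1 2 (rev (s1 1) ++ s1 2) = upd s1 2 x.
  by rewrite /s1 /upd /= revK cats0.
rewrite blockE.
have -> : run (Loop 1 (push_copies 30 copies) (push_copies 30 copies)) (upd s1 2 x) =
  upd (upd (fun r => if r \in iota 30 copies then ones n else [::]) 1 (rev x)) 2 x.
  apply: funext => r; rewrite run_Loop_copies; last by rewrite mem_iota.
  rewrite {1}/upd /s1 /upd /= size_rev -/n.
  case: (eqVneq r 2) => [->|r2]; first by rewrite mem_iota.
  case: (eqVneq r 1) => [->|r1]; first by rewrite mem_iota.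
  by case: ifP => // _; rewrite cats0.
set s3 := upd _ 2 x; rewrite blockE (@run_set_polys _ copies _ _ n); first last.
- move=> i lt_i; rewrite /s3 !upd_neq//.
  by rewrite mem_iota leq_addr ltn_add2l lt_i size_nseq.
- move=> rp rp_dim; have: (rp.1 < 30) && (rp.1 \notin [:: 1; 2]).
    by move: rp rp_dim; apply/allP.
  rewrite !inE negb_or => /and3P[lt_r r1 r2]; rewrite /s3 !upd_neq//.
  by rewrite mem_iota leqNgt lt_r.
- by [].
- exact: dimensions_ok.
have hE : evaln half_poly n = h by rewrite /half_poly !hornern.
have WE : evaln width_poly n = (h + h).+1.
  by rewrite /width_poly hornerDn hornerDn hE hornerCn addn1.
have NE : evaln size_poly n = N by rewrite /size_poly hornerMn WE hornerDn hornerCn addn1.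
have -> : [seq (rp.1, evaln rp.2 n) | rp : nat * {poly nat} <- dimensions] =
    [:: (5, N); (6, (h + h).+1); (7, h); (8, T.+1); (9, T * (h + h).+1); (10, evaln pB n);
        (11, evaln pB n + T + 2); (12, n + T + 2); (19, N); (20, (h + h).+1)].
  rewrite /=; congr [:: (_, _); (_, _); (_, _); (_, _); (_, _); (_, _); (_, _);
    (_, _); (_, _); (_, _)] => //.
  - by rewrite hornerDn hornerCn addn1.
  - by rewrite hornerMn WE.
  - by rewrite !hornerDn hornerCn.
  by rewrite !hornerDn hornerCn hornerXn.
rewrite [foldl _ _ _]/=.
set s4 := upd _ 20 _.
have N_gt0 : 0 < N by [].
have s43 : s4 3 = [::] by rewrite /s4 /s3 /upd /= mem_iota.
have s44 : s4 4 = [::] by rewrite /s4 /s3 /upd /= mem_iota.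
have s40 : s4 0 = [::] by rewrite /s4 /s3 /upd /= mem_iota.
have s45 : s4 5 = nseq N true by [].
have -> : main_regs x = upd (upd s4 3 (bits N.*2.+1)) 4 (rev (bits N.*2.+1)) by [].
clearbody s4; clear NE; move: N N_gt0 s45 => {}N N_gt0 s45.
rewrite blockE.
have -> : run (Loop 5 (Incr 3) (Incr 3)) s4 = upd s4 3 (bits N).
  have -> : bits N = iter (size (s4 5)) incw (s4 3).
    have -> : size (s4 5) = N by rewrite s45 size_nseq.
    by rewrite s43 -(prednK N_gt0) bits_iter.
  have incE v t : foldl (fun s (b : bool) => if b then run (Incr 3) s else run (Incr 3) s) t v =
      upd t 3 (iter (size v) incw (t 3)).
    elim: v t => [|b v IHv] t; first by rewrite /= upd_id.
    by rewrite [LHS]/= if_same IHv upd_upd upd_eq -iterSr.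
  by rewrite -incE.
rewrite blockE [run (Push 3 true) _]/= upd_upd upd_eq.
have -> : true :: bits N = bits N.*2.+1 by rewrite bits_doubleS.
rewrite blockE run_Loop_Push// upd_eq (@upd_neq _ s4 3 _ 4)// s44 cats0.
set s5 := upd _ 4 _.
have s50 : s5 0 = [::] by rewrite /s5 !upd_neq.
rewrite blockE [run (Push 0 false) _]/= s50 blockE.
have -> : run (Loop 4 (Comp (Push 0 true) (Push 0 true)) (Comp (Push 0 false) (Push 0 true)))
    (upd s5 0 [:: false]) = upd s5 0 (enc_nat N.*2.+1).
  rewrite /enc_nat /enc_seq.
  have loopE (v : word) t : foldl (fun s (b : bool) =>
      if b then run (Comp (Push 0 true) (Push 0 true)) s
      else run (Comp (Push 0 false) (Push 0 true)) s) t (rev v) =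
      upd t 0 (flatten [seq [:: true; b] | b <- v] ++ t 0).
    elim: v t => [|b v IHv] t; first by rewrite /= upd_id.
    rewrite rev_cons foldl_rcons IHv /=.
    by case: b; rewrite /= !upd_upd !upd_eq.
  by rewrite -[LHS]/(foldl _ _ (rev (bits N.*2.+1))) loopE upd_upd upd_eq.
rewrite blockE [run (Push 0 false) _]/= upd_upd upd_eq.
by rewrite /block /= .
Qed.

Lemma size_bits n : size (bits n) <= n.+1.
Proof.
rewrite size_mkseq ltnS; case: n => [|n]; first by [].
have /andP[le_n _] := trunc_log_bounds (isT : 1 < 2) (ltn0Sn n).
by apply: leq_trans le_n; apply/ltnW/ltn_expl.
Qed.

Lemma tableau_regsE x N W h T1 TW B R0 R1 :
  let s := tableau_regs x N W h T1 TW B R0 R1 in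
  [/\ s 2 = x, size (s 5) = N, size (s 6) = W, size (s 7) = h & size (s 8) = T1] /\
  [/\ size (s 9) = TW, size (s 10) = B, size (s 11) = R0 & size (s 12) = R1] /\
  [/\ size (s 19) = N, size (s 20) = W & forall r, 13 <= r <= 18 -> s r = [::]].
Proof.
rewrite /tableau_regs; split; first by split; rewrite /upd /= ?size_nseq.
split; first by split; rewrite /upd /= ?size_nseq.
split; try by rewrite /upd /= ?size_nseq.
move=> r r_bd; have r_neq q : (q < 13) || (18 < q) -> r != q.
  by move=> q_out; apply/eqP; lia.
rewrite !upd_neq ?r_neq// mem_iota; case: ifP => // /andP[le_r _]; lia.
Qed.

Lemma size_tableau_regs x N W h T1 TW B R0 R1 V r : r != 0 ->
  size x <= V -> N.*2.+2 <= V -> W <= V -> h <= V -> T1 <= V -> TW <= V -> B <= V ->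
  R0 <= V -> R1 <= V -> size (tableau_regs x N W h T1 TW B R0 R1 r) <= V.
Proof.
move=> r0 xV NV WV hV T1V TWV BV R0V R1V.
have bV := leq_trans (size_bits N.*2.+1) NV.
have NV' : N <= V by apply: leq_trans NV; rewrite -addnn; lia.
rewrite /tableau_regs /upd.
by repeat (case: ifP => _; first by rewrite ?size_rev ?size_nseq).
Qed.

Variables (k w : nat) (Q : csp_rules).
Hypotheses (w_gt0 : 0 < w) (Q_ok : rules_ok k Q).

Definition all_regs := iota 1 29 ++ iota 30 copies.

Lemma all_regs_lt (R : seq nat) : all (fun r => 0 < r < 30) R -> {subset R <= all_regs}.
Proof. by move=> /allP R30 q /R30; rewrite mem_cat !mem_iota => ->. Qed.

Lemma within_walk r I C1 C0 : r \notin [:: 0; 5; 6; I] -> I != 0 -> I < 30 -> r < 30 ->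
  csp_ok k C1 -> csp_ok k C0 -> within all_regs (csp_walk k w r I C1 C0).
Proof.
rewrite !inE !negb_or => /and4P[r0 r5 r6 rI] I0 I30 r30 ok1 ok0.
apply: (@within_sub (r :: [:: 5; 6; I])).
  by apply: all_regs_lt; rewrite /= !lt0n r0 r30 I0 I30.
apply: within_Loop => //; first by rewrite !inE !negb_or r5 r6.
  by apply: within_walk_step; [apply: csp_templates_ok | apply: regs_csp_templates].
by apply: within_walk_step; [apply: csp_templates_ok | apply: regs_csp_templates].
Qed.

Lemma within_csp_emit I C : I != 0 -> csp_ok k C -> within [:: 5; 6; I] (csp_emit k w I C).
Proof.
move=> I0 okC; apply: within_emit_agents; apply/allP => T TC.
have /allP -> // := csp_templates_ok w_gt0 I0 okC.
by have /allP -> := regs_csp_templates k w I C.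
Qed.

Lemma within_row : within [:: 5; 6; 7; 14] (row_cmd k w Q).
Proof.
have [[Qa Qb Qc _ _] _] := Q_ok.
have sub : {subset [:: 7; 5; 6; 14] <= [:: 5; 6; 7; 14]} by apply/allP.
have sub' : {subset [:: 5; 6; 14] <= [:: 5; 6; 7; 14]} by apply/allP.
have walk C : csp_ok k C -> within [:: 5; 6; 7; 14] (csp_walk k w 7 14 C C).
  move=> C_ok; apply: within_sub sub _; apply: within_Loop => //;
    by apply: within_walk_step; [apply: csp_templates_ok | apply: regs_csp_templates].
apply: within_Comp; first exact: walk.
apply: within_Comp; first by apply: within_sub sub' _; apply: within_csp_emit.
apply: within_Comp; first exact: walk.
by apply: within_Comp => //; apply: within_Push.
Qed.

Lemma within_emission : within all_regs (emission k w Q).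
Proof.
have [[Qa Qb Qc Qv Qf] [[Ql Q1 Q0 Qx] [Qg Qy Qs]]] := Q_ok.
apply: within_Comp.
  apply: within_emit_agent; first by rewrite /template_ok /= andbT addn_gt0 w_gt0 orbT.
  exact: all_regs_lt.
apply: within_Comp.
  apply: (@within_sub (19 :: [:: 5; 6; 13])); first exact: all_regs_lt.
  by apply: within_Loop => //;
    apply: within_walk_step; first [exact: cell_templates_ok | exact: regs_cell_templates].
apply: within_Comp.
  apply: (@within_sub (8 :: [:: 5; 6; 7; 14])); first exact: all_regs_lt.
  by apply: within_Loop => //; apply: within_row.
do 2![apply: within_Comp; first exact: within_walk].
apply: within_Comp.
  by apply: (@within_sub [:: 5; 6; 15]); [exact: all_regs_lt | exact: within_csp_emit].
by do 7![apply: within_Comp; first exact: within_walk].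
Qed.

Lemma within_main c : within all_regs c -> within all_regs (main_cmd c).
Proof.
move=> cR; have sub q (R : seq nat) e : all (fun r => 0 < r < 30) (q :: R) -> q \notin R ->
    all (within R) e -> size e = 2 -> within all_regs (Loop q (nth Skip e 0) (nth Skip e 1)).
  case: e => [|e1 [|e2 [|]]] //= qR qnR /and3P[e1R e2R _] _.
  apply: (@within_sub (q :: R)); first exact: all_regs_lt.
  by apply: within_Loop => //; case/andP: qR; rewrite lt0n => /andP[].
have copiesR : within (iota 30 copies) (push_copies 30 copies).
  have gen rs : {subset rs <= iota 30 copies} ->
      within (iota 30 copies) (foldr (fun r c => Comp (Push r true) c) Skip rs).
    elim: rs => //= r rs IHrs rsR.
    apply: within_Comp; first by apply: within_Push; rewrite inE rsR ?mem_head// orbT.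
    by apply: IHrs => q q_rs; rewrite rsR// inE q_rs orbT.
  exact: gen.
apply: within_Comp; first exact: (sub 1 [:: 2] [:: Push 2 true; Push 2 false]).
apply: within_Comp.
  apply: (@within_sub (1 :: iota 30 copies)).
    by move=> q; rewrite inE mem_cat => /predU1P[->|->]; rewrite ?mem_iota ?orbT.
  by apply: within_Loop; rewrite ?mem_iota.
apply: within_Comp.
  apply: within_block; rewrite all_map; apply/allP => rp rp_dim.
  have /allP/(_ _ rp_dim)/andP[lt_r le_d] := dimensions_ok.
  apply: within_sub (within_set_poly lt_r le_d) => q.
  by rewrite !mem_cat orbC.
apply: within_Comp; first exact: (sub 5 [:: 3] [:: Incr 3; Incr 3]).
apply: within_Comp; first exact: within_Push.
apply: within_Comp; first exact: (sub 3 [:: 4] [:: Push 4 true; Push 4 false]).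
apply: within_Comp; first exact: within_Push.
apply: within_Comp.
  exact: (sub 4 [::] [:: Comp (Push 0 true) (Push 0 true); Comp (Push 0 false) (Push 0 true)]).
apply: within_Comp; first exact: within_Push.
exact: within_Comp.
Qed.

End Reduction.

Section Reduction.
Variables (k w : nat) (Q : csp_rules) (pT pB : {poly nat}).
Hypotheses (w_gt0 : 0 < w) (Q_ok : rules_ok k Q).

Definition reduction : cmd := reduction_cmd pT pB (emission k w Q).

(** Apart from the output, a register ends with a word of length at most [N] or with the digits of
    [2N + 1], for which [2N + 2] is a crude bound. *)
Lemma prints_main (x : word) : let n := size x in
  exists s', [/\ prints (gadget_mass k w) (emission k w Q) (main_regs pT pB x) s'
    (gadget_agent k w (cells pT pB x)
      (tableau_csp Q (evaln pT n) (evaln pB n) x)) &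
    forall r, r != 0 -> size (s' r) <= (cells pT pB x).*2.+2].
Proof.
move=> n; set T := evaln pT n; set B := evaln pB n; set h := half_width pT pB x.
set W := width pT pB x; set N := cells pT pB x.
have [[e2 e5 e6 e7 e8] [[e9 e10 e11 e12] [e19 e20 s0]]] :=
  @tableau_regsE pT pB x N W h T.+1 (T * W) B (B + T + 2) (n + T + 2).
have pr := @prints_emission k w Q w_gt0 Q_ok (main_regs pT pB x) T B x
  e2 e5 e6 e7 e8 e9 e10 e11 e12 e19 e20 s0.
eexists; split; first exact: pr.
move=> r r0.
have hE : h = n + B + T + 1 by [].
have WE : W = (h + h).+1 by [].
have NE : N = W + T * W by [].
have le_TW : T <= T * W by rewrite WE mulnS leq_addr.
have main_le : size (main_regs pT pB x r) <= N.*2.+2.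
  by apply: size_tableau_regs => //; rewrite -?/n; lia.
rewrite /upd; do 6![case: ifP => _; first by rewrite size_nseq; lia].
exact: main_le.
Qed.

Theorem reduction_correct (x : word) : let n := size x in
  exists2 L : seq (seq (nat * nat)),
    forall A, A \in L <->
      gadget_agent k w (cells pT pB x) (tableau_csp Q (evaln pT n) (evaln pB n) x) A &
    run reduction (init_regs x) 0 =
      encode [seq slot_agent (gadget_mass k w) A | A <- L] (cells pT pB x).*2.+1.
Proof.
move=> n; have [s' [[L LP run_L] _]] := prints_main x; exists L => //.
rewrite /reduction run_set_up run_L upd_eq /encode /enc_seq /enc_agents -map_comp.
by rewrite -catA.
Qed.

Theorem reduction_polytime : polytime_function (fun x => run reduction (init_regs x) 0).
Proof.
have [|a1 [d1 cost1]] := @cost_bound (Loop 0 (Push 1 true) (Push 1 false)); first by [].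
have /and4P[main_wf main_cf _ main0] := within_main (@within_emission pT pB k w Q w_gt0 Q_ok).
have [a2 [d2 cost2]] := cost_bound main_cf.
(* The summands pay for the reversal of the input, where [V = n], for clearing the input register,
   and for [main_cmd], where [V = 2N + 2]. *)
pose p : {poly nat} := (a1%:P * ('X + (1%N)%:P) ^+ d1 + ((2%N)%:P * 'X + (1%N)%:P) +
  a2%:P * ((2%N)%:P * size_poly pT pB + (3%N)%:P) ^+ d2)%R.
have wfE c d : wf (Comp c d) = wf c && wf d by [].
have costE c d s : cost (Comp c d) s = cost c s + cost d (run c s) by [].
have runE c d s : run (Comp c d) s = run d (run c s) by [].
apply: (@run_polytime _ p) => [|x].
  by rewrite /reduction /reduction_cmd wfE wfE main_wf.
rewrite [in X in X <= _]/reduction /reduction_cmd costE costE.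
pose n := size x; rewrite -[X in _ <= X]/(evaln p n) /p !hornerDn.
rewrite hornerMn horner_expn hornerDn hornerXn !hornerCn.
rewrite !hornerMn hornerXn !hornerCn horner_expn hornerDn hornerMn !hornerCn.
have NE : evaln (size_poly pT pB) n = cells pT pB x.
  rewrite /cells /width /half_width /size_poly /width_poly /half_poly.
  by rewrite !hornern !addn1.
rewrite NE -addnA; apply: leq_add; last apply: leq_add.
- rewrite addn1; apply: cost1 => r; rewrite inE => /eqP->.
  by rewrite run_Loop_Push// upd_neq//; apply: leqnn.
- rewrite run_Loop_Push// [cost _ _]/= upd_neq// -[init_regs x 0]/x -/n; lia.
rewrite mul2n addn3; apply: cost2 => r r_main.
have [s' [[L LP run_L] le_s']] := prints_main x.
have r0 : r != 0 by apply: contraNneq main0 => <-.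
have := run_set_up pT pB x (emission k w Q).
rewrite /reduction_cmd runE runE => ->.
by rewrite run_L upd_neq// le_s'.
Qed.

End Reduction.

(** * Shares of the slots *)

Section Shares.
Variable R : realType.

Local Open Scope classical_set_scope.
Local Open Scope ring_scope.

Notation mu := (@lebesgue_measure R).

Definition point (e : nat) : R := 1 - 2 ^- e.

Definition slot_lo (j : nat) : R := point j.*2.+1.
Definition slot_hi (j : nat) : R := point j.*2.+2.

(** Slots are open on the left and closed on the right, as are the pieces on which [density] is
    constant. *)
Definition slot (j : nat) : set R := `]slot_lo j, slot_hi j]%classic.

Lemma fraction_dyadic e : fraction_val R (dyadic e) = point e.
Proof.
have e0 : (2 ^ e)%:R != 0 :> R by rewrite pnatr_eq0 expn_eq0.
rewrite /fraction_val /dyadic /= natrB ?expn_gt0// mulrBl divff// mul1r.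
by rewrite natrX.
Qed.

Lemma ltr_point e f : (point e < point f) = (e < f)%N.
Proof.
rewrite /point ltrD2l ltrN2 ltf_pV2 ?posrE ?exprn_gt0//.
by rewrite ltr_eXn2l// ltr1n.
Qed.

Lemma ler_point e f : (point e <= point f) = (e <= f)%N.
Proof. by rewrite leNgt ltr_point -leqNgt. Qed.

Lemma point0 : point 0 = 0.
Proof. by rewrite /point expr0 invr1 subrr. Qed.

Lemma point_lt1 e : point e < 1.
Proof. by rewrite /point gtrBl invr_gt0 exprn_gt0. Qed.

Lemma slot_lo_hi j : slot_lo j < slot_hi j.
Proof. by rewrite ltr_point. Qed.

Lemma slot_hi_lo i j : (i < j)%N -> slot_hi i < slot_lo j.
Proof. by move=> ij; rewrite ltr_point -!doubleS ltnS leq_double. Qed.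

Lemma slot_lo_gt0 j : 0 < slot_lo j.
Proof. by rewrite -point0 ltr_point. Qed.

Lemma slot_hi_lt1 j : slot_hi j < 1.
Proof. exact: point_lt1. Qed.

Lemma slot_size j : slot_hi j - slot_lo j = 2 ^- j.*2.+2.
Proof.
have half : 2 ^- j.*2.+1 = 2 ^- j.*2.+2 + 2 ^- j.*2.+2 :> R.
  have e0 : 2 ^+ j.*2.+1 != 0 :> R by rewrite expf_neq0 ?pnatr_eq0.
  by rewrite (exprS _ j.*2.+1); move: (2 ^+ j.*2.+1) e0 => e e0; field.
by rewrite /slot_hi /slot_lo /point half; ring.
Qed.

(* The slot [j] has length 2 ^ - (2j+2). *)
Definition share (S : set R) (j : nat) : R := fine (mu (S `&` slot j)) * 2 ^+ j.*2.+2.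

Lemma share_measure (S : set R) j : measurable S ->
  mu (S `&` slot j) = (share S j / 2 ^+ j.*2.+2)%:E.
Proof.
move=> mS; rewrite /share mulfK ?expf_neq0 ?pnatr_eq0// fineK//.
rewrite ge0_fin_numE//; apply: le_lt_trans (@le_measure _ _ _ mu _ (slot j) _ _ _) _.
- by rewrite inE; apply: measurableI => //; apply: measurable_itv.
- by rewrite inE; apply: measurable_itv.
- exact: subIsetr.
by rewrite [X in (X < _)%E](lebesgue_measure_itv `]slot_lo j, slot_hi j]) /=;
  case: ifP => // _; rewrite -EFinD ltry.
Qed.

Definition agent_ok (A : seq (nat * nat)) := sorted ltn [seq jm.1 | jm <- A].

Lemma density_slot_agent D A x : agent_ok A ->
  density (slot_agent D A) x =
  \sum_(jm <- A) (jm.2 * 2 ^ jm.1.*2.+2)%:R / D%:R * \1_(slot jm.1) x :> R.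
Proof.
elim: A => [_|[j m] A IHA A_ok].
  by rewrite /= big_nil; case: ifP => //; rewrite /fraction_val mul0r.
have notin (j' : nat) : x <= slot_lo j' -> \1_(slot j') x = 0 :> R.
  move=> le_x; rewrite indicE; case: (boolP (x \in _)) => //.
  by rewrite inE /slot /= in_itv /= ltNge le_x.
have later : forall j', j' \in [seq jm.1 | jm <- A] -> (j < j')%N.
  by move: A_ok; rewrite /agent_ok /= (path_sortedE ltn_trans) => /andP[/allP].
rewrite big_cons -[density _ _]/(if x <= fraction_val R (dyadic j.*2.+1)
  then fraction_val R (0, 1)%N else if x <= fraction_val R (dyadic j.*2.+2)
  then fraction_val R (m * 2 ^ j.*2.+2, D)%N else density (slot_agent D A) x).
rewrite !fraction_dyadic -/(slot_lo j) -/(slot_hi j).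
have sum0 : x <= slot_hi j ->
    \sum_(jm <- A) (jm.2 * 2 ^ jm.1.*2.+2)%:R / D%:R * \1_(slot jm.1) x = 0 :> R.
  move=> le_x; rewrite big_seq big1// => jm jmA; rewrite notin ?mulr0//.
  by apply/ltW/(le_lt_trans le_x)/slot_hi_lo/later/map_f.
case: leP => [le_lo|lt_lo].
  rewrite notin//= mulr0 add0r sum0 /fraction_val ?mul0r//.
  exact/(le_trans le_lo)/ltW/slot_lo_hi.
case: leP => [le_hi|lt_hi].
  have xj : slot j x by rewrite /slot /= in_itv /= lt_lo.
  by rewrite sum0// addr0 indicE mem_set// mulr1.
have xj : ~ slot j x by rewrite /slot /= in_itv /= lt_lo leNgt lt_hi.
rewrite indicE memNset// mulr0 add0r.
by apply: IHA; move: A_ok; rewrite /agent_ok /= => /path_sorted.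
Qed.

Lemma agent_measureE D A (S : set R) : (0 < D)%N -> agent_ok A -> measurable S ->
  agent_measure (slot_agent D A) S =
    ((\sum_(jm <- A) jm.2%:R * share S jm.1) / D%:R)%:E.
Proof.
move=> D_gt0 A_ok mS; rewrite /agent_measure.
have mSI : measurable (S `&` `[0, 1]) by apply: measurableI => //; apply: measurable_itv.
under eq_integral do rewrite density_slot_agent// -sumEFin.
rewrite ge0_integral_sum//; last first.
  move=> jm; apply/measurable_EFinP/measurable_funM => //.
  by apply: measurable_indic; apply: measurable_itv.
rewrite mulr_suml -sumEFin; apply: eq_bigr => -[j m] _ /=.
rewrite (@integralZl_indic _ _ _ mu _ _ (fun=> slot j))//; last 2 first.
  by rewrite ltNge divr_ge0.
  exact: measurable_itv.
rewrite integral_indic//; last exact: measurable_itv.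
have -> : slot j `&` (S `&` `[0, 1]) = S `&` slot j.
  rewrite setIA (setIC (slot j)) -setIA; congr (_ `&` _); apply/setIidPl => x.
  rewrite /slot /= !in_itv /= => /andP[lt_x le_x].
  by rewrite ltW ?(lt_trans (slot_lo_gt0 j))//= ltW// (le_lt_trans le_x) ?slot_hi_lt1.
rewrite [X in (_ * X)%E](share_measure j mS) -EFinM; congr (_%:E).
have e0 : 2 ^+ j.*2.+2 != 0 :> R by rewrite expf_neq0 ?pnatr_eq0.
by rewrite natrM natrX; field; rewrite e0 pnatr_eq0 -lt0n D_gt0.
Qed.

Lemma share_setT j : share setT j = 1.
Proof.
rewrite /share setTI /slot lebesgue_measure_itv /= lte_fin slot_lo_hi -EFinD /=.
by rewrite slot_size mulVf// expf_neq0 ?pnatr_eq0.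
Qed.

Lemma valid_slot_agent D A : (0 < D)%N -> agent_ok A ->
  sumn [seq jm.2 | jm <- A] = D -> valid_agent R (slot_agent D A).
Proof.
move=> D_gt0 A_ok sumA; split.
- rewrite /slot_agent all_cat /= andbT; elim: A {A_ok sumA} => //= jm A ->.
  by rewrite !expn_gt0 D_gt0.
- have gen x : (forall j, j \in [seq jm.1 | jm <- A] -> x < slot_lo j) -> x < 1 ->
    path <%R x [seq fraction_val R bv.1 | bv <- slot_agent D A].
    elim: A x A_ok {sumA} => [|[j m] A IHA] x A_ok lt_x x1.
      by rewrite /= /fraction_val divr1 x1.
    rewrite -[path _ _ _]/[&& x < fraction_val R (dyadic j.*2.+1),
      fraction_val R (dyadic j.*2.+1) < fraction_val R (dyadic j.*2.+2) &
      path <%R (fraction_val R (dyadic j.*2.+2))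
        [seq fraction_val R bv.1 | bv <- slot_agent D A]].
    rewrite !fraction_dyadic -/(slot_lo j) -/(slot_hi j) slot_lo_hi lt_x ?mem_head//=.
    apply: IHA; last exact: slot_hi_lt1.
      by move: A_ok; rewrite /agent_ok /= => /path_sorted.
    move=> j' j'A; apply: slot_hi_lo; move: A_ok.
    by rewrite /agent_ok /= (path_sortedE ltn_trans) => /andP[/allP/(_ _ j'A)].
  by apply: gen => // j _; apply: slot_lo_gt0.
- by rewrite /slot_agent map_cat last_cat /= /fraction_val divr1.
rewrite agent_measureE//; congr (_%:E).
under eq_bigr do rewrite share_setT mulr1.
have sumE : (\sum_(jm <- A) jm.2)%N = D by rewrite -sumA sumnE big_map.
rewrite -natr_sum sumE divff//.
by rewrite pnatr_eq0 -lt0n.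
Qed.

(** A cut at [a] itself is counted as passed: this is the label immediately to the right of [a]. *)
Definition label_at (t : seq R) (lab : seq bool) (a : R) : bool :=
  nth false lab (count (fun c => c <= a) t).

(** Consecutive closed subintervals share a cut point, but a point strictly between [a] and [b] is
    no cut and lies in just one of them. The left end [x0] varies for the induction on the cuts. *)
Lemma plus_partP x0 (t : seq R) lab a b y : path <%R x0 (rcons t 1) ->
  size lab = (size t).+1 ->
  x0 <= a -> a < y -> y < b -> b <= 1 -> (forall c, c \in t -> ~~ (a < c < b)) ->
  (exists2 i, nth false lab i &
     nth 0 (x0 :: rcons t 1) i <= y <= nth 0 (rcons t 1) i) <->
  label_at t lab a.
Proof.
rewrite /label_at => + + x0a ay yb b1.
have size_lab i : nth false lab i -> (i < size lab)%N.
  by case: ltnP => // le_i; rewrite nth_default.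
elim: t x0 lab x0a size_lab => [|c t IHt] x0 [//|l lab] x0a size_lab /=.
  move=> _ [lab0] _; rewrite (size0nil lab0).
  split=> [[[|i] /= lab_i //]|lab_0]; first by rewrite nth_nil in lab_i.
  by exists 0%N => //=; rewrite (le_trans x0a (ltW ay)) (le_trans (ltW yb)).
move=> /andP[x0c path_t] [lab_t] no_cut.
have no_cut' d : d \in t -> ~~ (a < d < b).
  by move=> dt; apply: no_cut; rewrite inE dt orbT.
have [c_le_a|a_lt_c] := leP c a.
  have := IHt c lab c_le_a _ path_t lab_t no_cut'; rewrite add1n /= => <-.
    split=> -[i lab_i y_i]; last by exists i.+1.
    case: i lab_i y_i => [|i] lab_i /= y_i; last by exists i.
    by move/andP: y_i => [_]; rewrite leNgt (le_lt_trans c_le_a ay).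
  by move=> i; apply: (size_lab i.+1).
have b_le_c : b <= c by move: (no_cut c (mem_head _ _)); rewrite a_lt_c /= -leNgt.
have gt_c d : d \in rcons t 1 -> c < d.
  by move: path_t; rewrite lt_path_sortedE => /andP[/allP all_gt _] /all_gt.
have count0 : count (fun d => d <= a) t = 0%N.
  apply/eqP; rewrite -leqn0 leqNgt -has_count; apply/hasPn => d dt.
  by rewrite -ltNge (lt_trans a_lt_c)// gt_c// mem_rcons inE dt orbT.
rewrite count0 /=; split=> [[[|i] lab_i]|lab0] //=; last first.
  by exists 0%N => //=; rewrite (le_trans x0a (ltW ay)) (le_trans (ltW yb)).
move=> /andP[]; rewrite leNgt (lt_le_trans yb)// (le_trans b_le_c)//.
case: i lab_i => [//|i] lab_i /=; apply/ltW/gt_c/mem_nth.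
by rewrite size_rcons -lab_t; apply/ltnW/(size_lab i.+2).
Qed.

Lemma measurable_plus_part (t : seq R) lab : measurable (plus_part t lab).
Proof. by apply: bigcup_measurable => i _; apply: measurable_itv. Qed.

(** Only the end point [b] can deviate from the label at [a], and it is a null set. *)
Lemma plus_part_measure (t : seq R) lab a b : cuts t -> size lab = (size t).+1 ->
  0 <= a -> a < b -> b <= 1 -> (forall c, c \in t -> ~~ (a < c < b)) ->
  mu (plus_part t lab `&` `]a, b]) = ((label_at t lab a)%:R * (b - a))%:E.
Proof.
move=> t_cuts lab_t a0 ab b1 no_cut.
have plusP y : a < y -> y < b -> plus_part t lab y <-> label_at t lab a.
  move=> ay yb; rewrite -(plus_partP t_cuts lab_t a0 ay yb b1 no_cut).
  by split=> -[i lab_i]; rewrite ?in_itv /= => y_i; exists i => //=; rewrite in_itv.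
have mI (i : interval R) : measurable [set` i] by apply: measurable_itv.
have mP := measurable_plus_part t lab.
have muoc : mu `]a, b] = (b - a)%:E.
  by rewrite [LHS](lebesgue_measure_itv `]a, b]) /= lte_fin ab EFinB.
case lab_a : (label_at t lab a); rewrite ?mul1r ?mul0r.
  apply/eqP; rewrite eq_le; apply/andP; split.
    by rewrite -muoc le_measure ?inE//; apply: measurableI.
  have <- : mu `]a, b[ = (b - a)%:E.
    by rewrite [LHS](lebesgue_measure_itv `]a, b[) /= lte_fin ab EFinB.
  rewrite le_measure ?inE//; first exact: measurableI.
  move=> y /=; rewrite in_itv /= => /andP[ay yb]; split; first by apply/plusP.
  by rewrite /= in_itv /= ay ltW.
apply/eqP; rewrite -measure_le0 -(lebesgue_measure_set1 b) le_measure ?inE//.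
  exact: measurableI.
move=> y [y_plus /=]; rewrite in_itv /= => /andP[ay].
rewrite le_eqVlt => /predU1P[//|yb].
by have := (plusP y ay yb).1 y_plus; rewrite lab_a.
Qed.

End Shares.

(** * Soundness of the gadget *)

Section Soundness.
Variable R : realType.

Local Open Scope ring_scope.

Definition weighted_sum (phi : nat -> R) (A : seq (nat * nat)) : R :=
  \sum_(jm <- A) jm.2%:R * phi jm.1.

Variables (k w N : nat).

Lemma weighted_sum_force phi n b : weighted_sum phi (force_agent k w N n b) =
  w%:R * phi (force_slot n b) + \sum_(t <- iota 0 k) phi (cell_slot k N n t b).
Proof.
rewrite /weighted_sum /force_agent big_cons big_map; congr (_ + _).
by apply: eq_bigr => t _; rewrite mul1r.
Qed.

(** If [L] has length [k], the agent has no piece on the minus slot, because only positive masses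
    are printed; the corresponding summand is then zero. *)
Lemma weighted_sum_exact phi L : (size L <= k)%N ->
  weighted_sum phi (exact_agent k w N L) =
  w%:R * phi plus_slot + (k - size L)%:R * phi (minus_slot N) +
  \sum_(l <- L) phi (cell_slot k N l.1.1 l.1.2 l.2).
Proof.
move=> le_k; rewrite /weighted_sum /exact_agent big_cons big_cat /= big_map addrA.
congr (_ + _ + _); last by apply: eq_bigr => l _; rewrite mul1r.
by case: eqP => [->|_]; rewrite ?big_nil ?subnn ?mul0r// big_cons big_nil addr0.
Qed.

Lemma boolr_int (b : bool) : b%:R \is a @Num.int R.
Proof. exact: rpred_nat. Qed.

Definition force_support n b := [seq jm.1 | jm <- force_agent k w N n b].

Lemma force_supportP n b j : j \in force_support n b <->
  j = force_slot n b \/ exists2 t, (t < k)%N & j = cell_slot k N n t b.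
Proof.
rewrite /force_support /= inE -map_comp; split.
  case/predU1P => [->|/mapP[t t_k ->]]; first by left.
  by right; exists t => //; move: t_k; rewrite mem_iota.
case=> [->|[t t_k ->]]; first by rewrite eqxx.
by apply/orP; right; apply/mapP; exists t; rewrite ?mem_iota.
Qed.

(** Here [phi], [L] and [K] stand for the shares of the slots, the labels at their left ends and the
    slots containing a cut; the labels of [plus_slot] and [minus_slot] are unknown. Non-integrality
    gives every cell a cut among its first slots, [one] makes it unique, and the linking agents
    transfer it to the second slot of the same pair. Hence all cells start with the label [b] of
    [minus_slot], and every agent becomes an equation in [b] and one non-integer [d]. *)
Lemma csp_of_shares (CS : seq (nat * nat) -> Prop) (phi : nat -> R) (L : nat -> bool)
    (K : pred nat) (C : R) :
  csp_wf k N CS -> C \isn't a Num.int ->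
  (forall j, ~~ K j -> phi j = (L j)%:R /\ L j.+1 = L j) ->
  (forall j, K j -> phi j \isn't a Num.int -> L j.+1 = ~~ L j) ->
  (forall n b j j', (n < N)%N -> j \in force_support n b -> j' \in force_support n b ->
     K j -> K j' -> j = j') ->
  (forall j, K j -> j = flip_slot N \/ exists n b, (n < N)%N /\ j \in force_support n b) ->
  (forall A, gadget_agent k w N CS A -> weighted_sum phi A = C) ->
  exists u, gadget_csp k N CS u.
Proof.
move=> CS_wf C_nint uncut cut one own agents.
have support_cell n t b : (t < k)%N -> cell_slot k N n t b \in force_support n b.
  by move=> t_k; apply/force_supportP; right; exists t.
have plus_uncut : ~~ K plus_slot.
  apply/negP => /own[|[n [b [_ /force_supportP[|[t _]]]]]];
    by rewrite /plus_slot /flip_slot /force_slot /cell_slot; lia.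
have minus_uncut : ~~ K (minus_slot N).
  apply/negP => /own[|[n [b [lt_n /force_supportP[|[t _]]]]]];
    by rewrite /minus_slot /flip_slot /force_slot /cell_slot; lia.
have [phiP _] := uncut _ plus_uncut; have [phiM LM] := uncut _ minus_uncut.
set b := L (minus_slot N) in phiM LM.
have uncut_int j : ~~ K j -> phi j \is a Num.int.
  by move=> /uncut[-> _]; apply: boolr_int.
have exactE Ls : (size Ls <= k)%N -> gadget_agent k w N CS (exact_agent k w N Ls) ->
    \sum_(l <- Ls) phi (cell_slot k N l.1.1 l.1.2 l.2) =
    C - w%:R * (L plus_slot)%:R - (k - size Ls)%:R * b%:R.
  move=> le_k /agents <-; rewrite weighted_sum_exact// phiP phiM.
  by ring.
have cellE n : (n < N)%N -> \sum_(t <- iota 0 k) phi (cell_slot k N n t false) =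
    C - w%:R * (L plus_slot)%:R.
  move=> lt_n; have := @exactE (cell_lits k n).
  rewrite size_map size_iota leqnn subnn mul0r subr0 big_map /= => ->//.
  by apply: Or43; exists n => //; left.
have linkE n t : (n < N)%N -> (t < k)%N ->
    \sum_(v <- iota 0 k) phi (cell_slot k N n v (v == t)) = C - w%:R * (L plus_slot)%:R.
  move=> lt_n lt_t; have := @exactE (link_lits k n t).
  rewrite size_map size_iota leqnn subnn mul0r subr0 big_map /= => ->//.
  by apply: Or43; exists n => //; right; exists t.
have C'_nint : C - w%:R * (L plus_slot)%:R \isn't a Num.int.
  rewrite rpredBr //; apply: rpredM; first exact: rpred_nat.
  exact: boolr_int.
have twin n t : (n < N)%N -> (t < k)%N ->
    phi (cell_slot k N n t true) = phi (cell_slot k N n t false).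
  move=> lt_n lt_t; have t_k : t \in iota 0 k by rewrite mem_iota.
  have := linkE n t lt_n lt_t; rewrite -(cellE n lt_n).
  rewrite !(bigD1_seq t) ?iota_uniq//= eqxx.
  rewrite [X in _ + X](eq_bigr (fun v => phi (cell_slot k N n v false))).
    by move/addIr.
  by move=> v /negbTE ->.
pose u n := find (fun t => K (cell_slot k N n t false)) (iota 0 k).
have has_u n : (n < N)%N -> has (fun t => K (cell_slot k N n t false)) (iota 0 k).
  move=> lt_n; apply: contraNT C'_nint => /hasPn no_cut.
  rewrite -(cellE n lt_n) big_seq; apply: rpred_sum => t t_k.
  exact/uncut_int/no_cut.
have u_lt n : (n < N)%N -> (u n < k)%N.
  by move=> /has_u; rewrite has_find size_iota.
have u_cut n : (n < N)%N -> K (cell_slot k N n (u n) false).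
  move=> lt_n; have := nth_find 0%N (has_u n lt_n); rewrite nth_iota ?u_lt//.
have only n t : (n < N)%N -> (t < k)%N -> t != u n -> ~~ K (cell_slot k N n t false).
  move=> lt_n lt_t; apply: contraNN => cut_t.
  have := one n false _ _ lt_n (support_cell n t _ lt_t) (support_cell n _ _ (u_lt n lt_n))
    cut_t (u_cut n lt_n).
  by rewrite /cell_slot; lia.
have u_nint n : (n < N)%N -> phi (cell_slot k N n (u n) false) \isn't a Num.int.
  move=> lt_n; apply: contraNN C'_nint => u_int.
  rewrite -(cellE n lt_n) big_seq; apply: rpred_sum => t; rewrite mem_iota => lt_t.
  by have [->|/only t_uncut] := eqVneq t (u n); [|apply/uncut_int/t_uncut].
have u_cut' n : (n < N)%N -> K (cell_slot k N n (u n) true).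
  by move=> lt_n; apply: contraNT (u_nint n lt_n) => /uncut_int; rewrite twin ?u_lt.
have only' n t : (n < N)%N -> (t < k)%N -> t != u n -> ~~ K (cell_slot k N n t true).
  move=> lt_n lt_t; apply: contraNN => cut_t.
  have := one n true _ _ lt_n (support_cell n t _ lt_t) (support_cell n _ _ (u_lt n lt_n))
    cut_t (u_cut' n lt_n).
  by rewrite /cell_slot; lia.
have slotS n t : cell_slot k N n t true = (cell_slot k N n t false).+1.
  by rewrite /cell_slot; lia.
have slotSS n t : cell_slot k N n t.+1 false = (cell_slot k N n t true).+1.
  by rewrite /cell_slot; lia.
have slot_next n : cell_slot k N n.+1 0 false = cell_slot k N n k false.
  by rewrite /cell_slot; lia.
have L_cell n t : (n < N)%N -> (t <= k)%N -> L (cell_slot k N n 0 false) = b ->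
    L (cell_slot k N n t false) = b.
  (* The two slots of the pair [u n] flip the label twice, and no other slot of the cell is cut. *)
  move=> lt_n + L0; elim: t => // t IHt lt_t.
  rewrite slotSS; have [tu|tu] := eqVneq t (u n).
    rewrite cut; last 2 first.
    - by rewrite tu u_cut'.
    - by rewrite tu twin ?u_lt// u_nint.
    rewrite slotS cut; last 2 first.
    - by rewrite tu u_cut.
    - by rewrite tu u_nint.
    by rewrite negbK IHt// ltnW.
  have [_ ->] := uncut _ (only' n t lt_n lt_t tu).
  rewrite slotS; have [_ ->] := uncut _ (only n t lt_n lt_t tu).
  by rewrite IHt// ltnW.
have L_base n : (n <= N)%N -> L (cell_slot k N n 0 false) = b.
  elim: n => [_|n IHn lt_n]; last by rewrite slot_next L_cell// IHn// ltnW.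
  by rewrite -LM /cell_slot /minus_slot; congr L; lia.
(* The share of the selected slot differs from that of the other slots of its cell by [d], which is
   nonzero because it is not an integer. *)
pose d := C - w%:R * (L plus_slot)%:R - k%:R * b%:R.
have d_nint : d \isn't a Num.int.
  by rewrite rpredBr //; apply: rpredM; [apply: rpred_nat | apply: boolr_int].
have phi_cell n t : (n < N)%N -> (t < k)%N ->
    phi (cell_slot k N n t false) = b%:R + (u n == t)%:R * d.
  move=> lt_n lt_t; have phi_other v : (v < k)%N -> v != u n ->
      phi (cell_slot k N n v false) = b%:R.
    by move=> lt_v vu; have [-> _] := uncut _ (only n v lt_n lt_v vu);
       rewrite L_cell ?L_base// ltnW.
  have [ut|ut] := eqVneq; last by rewrite mul0r addr0 phi_other// eq_sym.
  have := cellE n lt_n; have t_k : t \in iota 0 k by rewrite mem_iota.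
  rewrite (bigD1_seq t) ?iota_uniq//= big_seq_cond.
  rewrite (eq_bigr (fun=> b%:R)); last first.
    by move=> v /andP[]; rewrite mem_iota => lt_v vt; apply: phi_other; rewrite ?ut.
  rewrite -big_seq_cond /d.
  have kb : \sum_(v <- iota 0 k) b%:R = b%:R + \sum_(v <- iota 0 k | v != t) b%:R :> R.
    by rewrite (bigD1_seq t) ?iota_uniq.
  move: kb; rewrite [LHS]big_const_seq (_ : count _ _ = k); last first.
    by rewrite -[RHS](size_iota 0) -count_predT.
  rewrite iter_addr_0 => kb <-.
  rewrite mul1r mulr_natl kb; ring.
exists u; split=> // c cC; have [le_c lt_c _] := CS_wf c cC.
have := @exactE (first_lits c).
rewrite size_map big_map /= => /(_ le_c) exact_c.
have {}exact_c := exact_c (Or44 _ _ _ (ex_intro2 _ _ c cC erefl)).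
move: exact_c; rewrite big_seq (eq_bigr (fun l => b%:R + (u l.1 == l.2)%:R * d)); last first.
  by move=> l lc; have /allP/(_ l lc)/andP[] := lt_c; apply: phi_cell.
have sum_b : \sum_(l <- c) b%:R = (size c)%:R * b%:R :> R.
  by rewrite big_const_seq -count_predT iter_addr_0 mulr_natl.
have sum_u : \sum_(l <- c) (u l.1 == l.2)%:R = (count (fun l => u l.1 == l.2) c)%:R :> R.
  by rewrite -natr_sum -sumn_count sumnE big_map.
rewrite -big_seq big_split /= -mulr_suml sum_b sum_u natrB// => exact_c.
(* The padding on [minus_slot] raises the number of terms [b] to [k], whatever the length of [c], so
   that [b] cancels. *)
set q := count _ c in exact_c *; have : (q%:R - 1) * d = 0.
  rewrite mulrBl mul1r; apply/eqP; rewrite subr_eq0; apply/eqP.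
  by rewrite {2}/d; move: exact_c; lra.
move/eqP; rewrite mulf_eq0 => /orP[|/eqP d0]; last by rewrite d0 rpred0 in d_nint.
by rewrite subr_eq0 (eqr_nat R q 1) => /eqP.
Qed.

End Soundness.

(** * Exact solutions *)

Lemma cell_slot_inj k N n n' t t' b b' : t < k -> t' < k ->
  cell_slot k N n t b = cell_slot k N n' t' b' -> [/\ n = n', t = t' & b = b'].
Proof.
rewrite /cell_slot => lt_t lt_t' e.
have [eb ek] : b = b' /\ n * k + t = n' * k + t'.
  by case: b e; case: b'; split=> //; lia.
have k_gt0 : 0 < k by apply: leq_trans lt_t.
have := congr1 (divn^~ k) ek; have := congr1 (modn^~ k) ek.
by rewrite !modnMDl !divnMDl// !divn_small// !modn_small// !addn0.
Qed.

Section Solutions.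
Variable R : realType.

Local Open Scope ring_scope.

Notation mu := (@lebesgue_measure R).
Notation slot_lo := (@slot_lo R).
Notation slot_hi := (@slot_hi R).
Notation in_slot c j := (slot_lo j < c < slot_hi j).

Lemma in_slot_inj (c : R) i j : in_slot c i -> in_slot c j -> i = j.
Proof.
move=> /andP[ic ci] /andP[jc cj]; case: (ltngtP i j) => // /(slot_hi_lo R).
  by rewrite ltNge ltW// (lt_trans jc).
by rewrite ltNge ltW// (lt_trans ic).
Qed.

Section Labelling.
Variables (t : seq R) (lab : seq bool).
Hypotheses (t_cuts : cuts t) (size_lab : size lab = (size t).+1).

Let phi := share (plus_part t lab).
Let L j := label_at t lab (slot_lo j).

Lemma label_at_eq (a b : R) : a <= b -> (forall c, c \in t -> ~~ (a < c <= b)) ->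
  label_at t lab a = label_at t lab b.
Proof.
move=> ab no_cut; rewrite /label_at; congr (nth _ _ _); apply: eq_in_count => c ct.
apply/idP/idP => [/le_trans|cb]; first exact.
by move: (no_cut c ct); rewrite cb andbT -leNgt.
Qed.

Lemma share_uncut j : (forall c, c \in t -> ~~ in_slot c j) -> phi j = (L j)%:R.
Proof.
move=> no_cut; rewrite /phi /share plus_part_measure ?slot_lo_hi//.
- by rewrite /= slot_size mulfVK// expf_neq0 ?pnatr_eq0.
- exact/ltW/slot_lo_gt0.
exact/ltW/slot_hi_lt1.
Qed.

Lemma share_cut j c : c \in t -> in_slot c j ->
  (forall c', c' \in t -> in_slot c' j -> c' = c) ->
  phi j = ((L j)%:R * (c - slot_lo j) + (label_at t lab c)%:R * (slot_hi j - c)) *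
          2 ^+ j.*2.+2.
Proof.
move=> ct /andP[lo_c c_hi] c_only; rewrite /phi /share; congr (_ * _).
have -> : slot j = (`]slot_lo j, c] `|` `]c, slot_hi j])%classic.
  by rewrite -itv_bndbnd_setU// bnd_simp ltW.
have m1 : mu (plus_part t lab `&` `]slot_lo j, c]%classic) =
    ((L j)%:R * (c - slot_lo j))%:E.
  apply: plus_part_measure => //; first exact/ltW/slot_lo_gt0.
    exact/ltW/(lt_trans c_hi)/slot_hi_lt1.
  move=> c' c't; apply/negP => /andP[lo_c' c'c].
  by move: (c'c); rewrite (c_only c') ?ltxx// lo_c' (lt_trans c'c).
have m2 : mu (plus_part t lab `&` `]c, slot_hi j]%classic) =
    ((label_at t lab c)%:R * (slot_hi j - c))%:E.
  apply: plus_part_measure => //; first exact/ltW/(lt_trans (slot_lo_gt0 R j)).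
    exact/ltW/slot_hi_lt1.
  move=> c' c't; apply/negP => /andP[cc' c'hi].
  by move: (cc'); rewrite (c_only c') ?ltxx// (lt_trans lo_c).
rewrite setIUr measureU; last 3 first.
- by apply: measurableI; [apply: measurable_plus_part | apply: measurable_itv].
- by apply: measurableI; [apply: measurable_plus_part | apply: measurable_itv].
- apply/seteqP; split=> // y [[_ /=]]; rewrite in_itv /= => /andP[_ yc] [_ /=].
  by rewrite in_itv /= ltNge yc.
by rewrite [X in (X + _)%E]m1 [X in (_ + X)%E]m2.
Qed.

Hypothesis cuts_in_slots : forall c, c \in t -> exists j, in_slot c j.

Lemma label_next j : L j.+1 = label_at t lab (slot_hi j).
Proof.
apply/esym/label_at_eq => [|c ct]; first exact/ltW/slot_hi_lo.
apply/negP => /andP[hi_c c_lo]; have [i /andP[i_c c_i]] := cuts_in_slots ct.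
have [le_ij|lt_ji] := leqP i j.
  have: slot_hi i <= slot_hi j by rewrite ler_point !ltnS leq_double.
  by rewrite leNgt (lt_trans hi_c).
have: slot_lo j.+1 <= slot_lo i by rewrite ler_point ltnS leq_double.
by rewrite leNgt (lt_le_trans i_c).
Qed.

Lemma label_uncut j : (forall c, c \in t -> ~~ in_slot c j) -> L j.+1 = L j.
Proof.
move=> no_cut; rewrite label_next; apply/esym/label_at_eq; first exact/ltW/slot_lo_hi.
(* A cut at the end point of a slot would have to be interior to some slot, which is impossible. *)
move=> c ct; apply/negP => /andP[lo_c]; rewrite le_eqVlt => /orP[/eqP c_hi|c_hi].
  have [i /andP[i_c c_i]] := cuts_in_slots ct; move: i_c c_i; rewrite c_hi.
  by rewrite !ltr_point; clear; lia.
by move: (no_cut c ct); rewrite lo_c c_hi.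
Qed.

Lemma label_cut j c : c \in t -> in_slot c j ->
  (forall c', c' \in t -> in_slot c' j -> c' = c) -> L j.+1 = label_at t lab c.
Proof.
move=> ct /andP[lo_c c_hi] c_only; rewrite label_next; apply/esym/label_at_eq => [|d dt].
  exact: ltW.
apply/negP => /andP[cd]; rewrite le_eqVlt => /orP[/eqP d_hi|d_hi].
  have [i /andP[i_c c_i]] := cuts_in_slots dt; move: i_c c_i; rewrite d_hi.
  by rewrite !ltr_point; clear; lia.
by move: (cd); rewrite (c_only d) ?ltxx// d_hi (lt_trans lo_c).
Qed.

End Labelling.

Variables (k w N : nat) (alpha beta : R) (CS : seq (nat * nat) -> Prop).
Hypotheses (CS_wf : csp_wf k N CS) (w_gt0 : (0 < w)%N).
Hypotheses (alpha01 : 0 < alpha < 1) (beta01 : 0 < beta < 1).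
Hypothesis alpha_mass : alpha * (gadget_mass k w)%:R = w%:R + beta.

Lemma lt01_not_int (x : R) : 0 < x < 1 -> x \isn't a Num.int.
Proof.
move=> x01; apply/negP => /intrP[m xm]; move: x01; rewrite xm.
by rewrite ltr0z ltrz1; lia.
Qed.

Lemma not_int_mass : w%:R + beta \isn't a Num.int.
Proof. by rewrite rpredDl ?lt01_not_int// rpred_nat. Qed.

Lemma force_supports_disjoint n n' b b' j : (n < N)%N -> (n' < N)%N ->
  j \in force_support k w N n b -> j \in force_support k w N n' b' -> n = n' /\ b = b'.
Proof.
move=> lt_n lt_n' /force_supportP[->|[t lt_t ->]] /force_supportP[|[t' lt_t']];
  rewrite /force_slot /cell_slot.
- by case: b; case: b'; split=> //; lia.
- by case: b; case: b'; lia.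
- by case: b; case: b'; lia.
by move=> e; have [-> _ ->] := cell_slot_inj lt_t lt_t' e.
Qed.

Lemma flip_not_force n b : (n < N)%N -> flip_slot N \notin force_support k w N n b.
Proof.
move=> lt_n; apply/negP => /force_supportP[|[t _]];
  by rewrite /flip_slot /force_slot /cell_slot; case: b; lia.
Qed.

(** Each forcing or flip agent has a cut in its support, as otherwise its positive part would have
    integral mass. The supports are disjoint and as numerous as the permitted cuts, so counting
    leaves exactly one cut in each of them and none elsewhere. *)
Lemma solution_csp (t : seq R) (lab : seq bool) :
  cuts t -> size lab = (size t).+1 -> (size t <= N.*2.+1)%N ->
  (forall A, gadget_agent k w N CS A ->
     weighted_sum (share (plus_part t lab)) A = w%:R + beta) ->
  exists u, gadget_csp k N CS u.
Proof.
move=> t_cuts size_lab le_t agents.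
pose phi := share (plus_part t lab).
pose L j := label_at t lab (slot_lo j).
pose F := option ('I_N * bool).
pose supp (f : F) := if f is Some nb then force_support k w N nb.1 nb.2
                     else [:: flip_slot N].
have suppI f g j : j \in supp f -> j \in supp g -> f = g.
  case: f g => [[n b]|] [[n' b']|] //=.
  - move=> jf jg; have [nn bb] := force_supports_disjoint (ltn_ord n) (ltn_ord n') jf jg.
    by congr (Some (_, _)) => //; apply: val_inj.
  - move=> jf; rewrite inE => /eqP ej.
    by have := flip_not_force b (ltn_ord n); rewrite -ej jf.
  - rewrite inE => /eqP ej jg.
    by have := flip_not_force b' (ltn_ord n'); rewrite -ej jg.
have cut_or_int j : (exists2 c, c \in t & in_slot c j) \/ phi j \is a Num.int.
  have [/hasP[c ct c_j]|/hasPn no_cut] := boolP (has (fun c => in_slot c j) t).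
    by left; exists c.
  by right; rewrite /phi share_uncut// boolr_int.
have hit f : exists2 c, c \in t & exists2 j, j \in supp f & in_slot c j.
  suff /hasP[j jf] : has (fun j => has (fun c => in_slot c j) t) (supp f).
    by case/hasP=> c ct c_j; exists c => //; exists j.
  apply: contraT => /hasPn no_cut.
  have f_int j : j \in supp f -> phi j \is a Num.int.
    move=> jf; have [[c ct c_j]|//] := cut_or_int j.
    by have /hasPn/(_ c ct) := no_cut j jf; rewrite c_j.
  case: f f_int {no_cut} => [[n b]|] f_int /=.
    have := agents (force_agent k w N n b) (Or42 _ _ _ (ex_intro _ _ (ex_intro _ _ (conj _ erefl)))).
    rewrite weighted_sum_force => /(_ (ltn_ord n)) e.
    have: w%:R + beta \is a @Num.int R.
      rewrite -e; apply: rpredD.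
        by apply: rpredM; [apply: rpred_nat | apply: f_int; rewrite mem_head].
      rewrite big_seq; apply: rpred_sum => v; rewrite mem_iota => lt_v.
      by apply: f_int; apply/force_supportP; right; exists v.
    by rewrite (negbTE not_int_mass).
  (* For the flip agent a missing cut would make [alpha] itself an integer. *)
  have := agents _ (Or41 _ _ _ erefl); rewrite /weighted_sum /flip_agent big_seq1 /= => e.
  have: alpha \is a Num.int; last by rewrite (negbTE (lt01_not_int alpha01)).
  have D_neq0 : (gadget_mass k w)%:R != 0 :> R.
    by rewrite pnatr_eq0 -lt0n addn_gt0 w_gt0 orbT.
  suff -> : alpha = phi (flip_slot N) by apply: f_int; rewrite mem_head.
  by apply: (mulIf D_neq0); rewrite alpha_mass -e mulrC.
have hit_i f : exists i : 'I_(size t), has (fun j => in_slot (nth 0 t i) j) (supp f).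
  have [c ct [j jf c_j]] := hit f; have lt_i : (index c t < size t)%N by rewrite index_mem.
  by exists (Ordinal lt_i); apply/hasP; exists j => //=; rewrite nth_index.
pose g f := xchoose (hit_i f).
have gP f : exists2 j, j \in supp f & in_slot (nth 0 t (g f)) j.
  by have /hasP := xchooseP (hit_i f).
have g_inj : injective g.
  move=> f f' ff'; have [j jf c_j] := gP f; have [j' jf' c_j'] := gP f'.
  by rewrite -ff' in c_j'; apply: suppI jf _; rewrite (in_slot_inj c_j c_j').
(* The supports are indexed by [2N + 1] elements, with [None] for the flip agent, and there are at
   most that many cuts; hence the injection is onto. *)
have [|g' _ gK] := inj_card_bij g_inj.
  by rewrite card_ord card_option card_prod card_ord card_bool muln2.
have owner c : c \in t -> exists2 f, c = nth 0 t (g f) &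
    exists2 j, j \in supp f & in_slot c j.
  move=> ct; have lt_i : (index c t < size t)%N by rewrite index_mem.
  have e : c = nth 0 t (g (g' (Ordinal lt_i))) by rewrite gK /= nth_index.
  by exists (g' (Ordinal lt_i)) => //; have := gP (g' (Ordinal lt_i)); rewrite -e.
have in_slots c : c \in t -> exists j, in_slot c j.
  by case/owner=> f _ [j _ c_j]; exists j.
have one f j j' c c' : j \in supp f -> j' \in supp f -> c \in t -> c' \in t ->
    in_slot c j -> in_slot c' j' -> c = c'.
  move=> jf jf' /owner[f1 -> [i if1 c_i]] /owner[f2 -> [i' if2 c_i']] c_j c_j'.
  rewrite (in_slot_inj c_i c_j) in if1; rewrite (in_slot_inj c_i' c_j') in if2.
  by rewrite (suppI _ _ _ if1 jf) (suppI _ _ _ if2 jf').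
pose K j := has (fun c => in_slot c j) t.
have no_cut j : ~~ K j -> forall c, c \in t -> ~~ in_slot c j.
  by move=> /hasPn no_c c /no_c.
apply: (@csp_of_shares R k w N CS phi L K (w%:R + beta)) => //.
- exact: not_int_mass.
- move=> j /no_cut no_c; split; first exact: share_uncut.
  exact: label_uncut.
- move=> j /hasP[c ct c_j] phi_nint.
  have [f _ [i if1 c_i]] := owner c ct; have ij := in_slot_inj c_i c_j.
  rewrite ij in if1.
  have c_only c' : c' \in t -> in_slot c' j -> c' = c.
    by move=> c't c'_j; apply: (one f j j).
  have := share_cut t_cuts size_lab ct c_j c_only.
  rewrite -/phi -/(L j) /L (label_cut lab in_slots ct c_j c_only) => phiE.
  (* With the same label on both sides of its only cut, the slot would have share 0 or 1. *)
  apply: contraNeq phi_nint => LL.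
  have {}LL : label_at t lab c = label_at t lab (slot_lo j).
    by move: LL; case: (label_at t lab c); case: (label_at _ _ _).
  rewrite phiE LL -mulrDr (_ : c - _ + _ = slot_hi j - slot_lo j); last by ring.
  by rewrite slot_size mulfVK ?boolr_int// expf_neq0 ?pnatr_eq0.
- move=> n b j j' lt_n jf jf' /hasP[c ct c_j] /hasP[c' c't c'_j'].
  have cc' := one (Some (Ordinal lt_n, b)) j j' c c' jf jf' ct c't c_j c'_j'.
  by rewrite -cc' in c'_j'; apply: in_slot_inj c_j c'_j'.
- move=> j /hasP[c ct c_j]; have [f _ [i if1 c_i]] := owner c ct.
  rewrite (in_slot_inj c_i c_j) in if1.
  case: f if1 => [[n b]|] /=; last by rewrite inE => /eqP; left.
  by move=> jf; right; exists n, b.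
Qed.

End Solutions.

(** * From an assignment to an exact solution *)

Section Construction.
Variable R : realType.

Local Open Scope ring_scope.

Notation slot_lo := (@slot_lo R).
Notation slot_hi := (@slot_hi R).
Notation in_slot c j := (slot_lo j < c < slot_hi j).

Variables (k w N : nat) (alpha beta : R) (CS : seq (nat * nat) -> Prop).
Hypothesis CS_wf : csp_wf k N CS.
Hypotheses (alpha01 : 0 < alpha < 1) (beta01 : 0 < beta < 1).
Hypothesis alpha_mass : alpha * (gadget_mass k w)%:R = w%:R + beta.

Section Cuts.
Variable u : nat -> nat.
Hypothesis u_csp : gadget_csp k N CS u.

Let cs n t b := cell_slot k N n t b.

Definition cut_slots : seq nat :=
  flip_slot N :: flatten [seq [:: cs n (u n) false; cs n (u n) true] | n <- iota 0 N].

(** The label passes from + to - in the flip slot, which leaves the fraction [alpha] on +. First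
    slots of pairs have odd numbers and pass from - to +, second slots from + to -; the fractions
    [1 - beta] and [beta] therefore give both of them the share [beta]. *)
Definition cut_pos (j : nat) : R :=
  slot_lo j + (if j == flip_slot N then alpha else if odd j then 1 - beta else beta) *
              (slot_hi j - slot_lo j).

Definition csp_cuts : seq R := [seq cut_pos j | j <- cut_slots].

Definition csp_labels : seq bool := mkseq (fun i => ~~ odd i) N.*2.+2.

Lemma u_lt n : (n < N)%N -> (u n < k)%N.
Proof. by case: u_csp => u_k _ /u_k. Qed.

Lemma in_slot_cut_pos j : in_slot (cut_pos j) j.
Proof.
rewrite /cut_pos; set th := (if _ then alpha else _).
have /andP[th0 th1] : 0 < th < 1.
  rewrite /th; case: ifP => // _; case: ifP => // _.
  by case/andP: beta01 => *; apply/andP; split; lra.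
have len := slot_lo_hi R j.
rewrite ltrDl mulr_gt0 ?subr_gt0//= -ltrBrDl gtr_pMl ?subr_gt0//.
Qed.

Lemma cut_pos_homo : {homo cut_pos : i j / (i < j)%N >-> i < j}.
Proof.
move=> i j ij; have /andP[_ ci] := in_slot_cut_pos i; have /andP[cj _] := in_slot_cut_pos j.
exact: lt_trans ci (lt_trans (slot_hi_lo R ij) cj).
Qed.

Lemma cut_pos_le i j : (cut_pos i <= slot_lo j) = (i < j)%N.
Proof.
have /andP[ic ci] := in_slot_cut_pos i; case: ltnP => [ij|ji].
  exact/ltW/(lt_trans ci)/slot_hi_lo.
apply/negbTE; rewrite -ltNge; apply: le_lt_trans ic.
by rewrite ler_point ltnS leq_double.
Qed.

(** The path starts one slot before cell [m], so that the first slot of that cell may be cut too. *)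
Lemma cells_sorted m n : (forall i, (i < m + n)%N -> (u i < k)%N) ->
  path ltn (cs m 0 false).-1
    (flatten [seq [:: cs i (u i) false; cs i (u i) true] | i <- iota m n]).
Proof.
elim: n m => //= n IHn m u_k; have u_m : (u m < k)%N by apply: u_k; lia.
apply/and3P; split; rewrite /cs /cell_slot; try by lia.
have := IHn m.+1; set l := flatten _ => path_l; have : path ltn (cs m.+1 0 false).-1 l.
  by apply: path_l => i lt_i; apply: u_k; lia.
by case: l {path_l} => //= a l /andP[lt_a ->]; rewrite andbT; move: lt_a;
  rewrite /cs /cell_slot; nia.
Qed.

Lemma cut_slots_sorted : sorted ltn cut_slots.
Proof.
rewrite /cut_slots /=; have := @cells_sorted 0 N u_lt.
case: flatten => //= a l /andP[lt_a ->]; rewrite andbT; move: lt_a.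
by rewrite /cs /cell_slot /flip_slot; lia.
Qed.

Lemma size_cut_slots : size cut_slots = N.*2.+1.
Proof.
rewrite /cut_slots /=; congr _.+1; rewrite -[in RHS](size_iota 0 N).
by elim: (iota 0 N) => //= n s ->.
Qed.

Lemma cuts_csp_cuts : cuts csp_cuts.
Proof.
have gt0 j : 0 < cut_pos j.
  by have /andP[+ _] := in_slot_cut_pos j; apply: lt_trans; apply: slot_lo_gt0.
have lt1 j : cut_pos j < 1.
  by have /andP[_ /lt_trans] := in_slot_cut_pos j; apply; apply: slot_hi_lt1.
rewrite /cuts rcons_path; apply/andP; split.
  rewrite lt_path_sortedE; apply/andP; split; first by rewrite all_map; apply/allP => j _ /=.
  by apply: (homo_sorted (e := ltn)); [exact: cut_pos_homo | exact: cut_slots_sorted].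
by rewrite /csp_cuts /cut_slots /= (last_map cut_pos).
Qed.

Lemma mem_cell_cut n t b : (n < N)%N -> (t < k)%N -> (cs n t b \in cut_slots) = (t == u n).
Proof.
move=> lt_n lt_t; rewrite /cut_slots inE [_ == flip_slot N](_ : _ = false); last first.
  by apply/eqP; rewrite /cs /cell_slot /flip_slot; lia.
apply/flattenP/eqP => [[s /mapP[m]]|->].
  rewrite mem_iota => lt_m ->; rewrite !inE => e.
  have [b' {}e] : exists b', cs n t b = cs m (u m) b'.
    by case/orP: e => /eqP->; [exists false | exists true].
  by have [-> -> _] := cell_slot_inj lt_t (u_lt lt_m) e.
exists [:: cs n (u n) false; cs n (u n) true].
  by apply/mapP; exists n; rewrite ?mem_iota.
by case: b; rewrite !inE eqxx ?orbT.
Qed.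

Lemma not_cut_slot j : (j <= minus_slot N)%N -> j != flip_slot N -> j \notin cut_slots.
Proof.
move=> le_j /negbTE jf; rewrite /cut_slots inE jf /=; apply/flattenP => -[s /mapP[m _ ->]].
by rewrite !inE /cs /cell_slot; move: le_j; rewrite /minus_slot; lia.
Qed.

Let L j := label_at csp_cuts csp_labels (slot_lo j).

Let phi := share (plus_part csp_cuts csp_labels).

(** The labels alternate, starting with +, so a label is the parity of the number of cuts to its
    left. *)
Lemma label_count j : L j = ~~ odd (count (fun i => (i < j)%N) cut_slots).
Proof.
rewrite /L /label_at /csp_cuts count_map.
rewrite (eq_count (a2 := fun i => (i < j)%N)); last by move=> i /=; rewrite cut_pos_le.
by rewrite nth_mkseq// ltnS -size_cut_slots count_size.
Qed.

Lemma label_succ j : L j.+1 = (j \in cut_slots) (+) L j.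
Proof.
rewrite !label_count; have uniq_cuts := sorted_uniq ltn_trans ltnn cut_slots_sorted.
have -> : count (fun i => (i < j.+1)%N) cut_slots =
          ((j \in cut_slots) + count (fun i => (i < j)%N) cut_slots)%N.
  rewrite -(count_uniq_mem j uniq_cuts) -count_predUI.
  rewrite (@eq_count _ (predI _ _) pred0) ?count_pred0 ?addn0; last first.
    by move=> i /=; case: eqP => //= ->; rewrite ltnn.
  by apply: eq_count => i /=; rewrite ltnS leq_eqVlt.
by rewrite oddD oddb; case: (j \in _); case: (odd _).
Qed.

Lemma share_not_cut j : j \notin cut_slots -> phi j = (L j)%:R.
Proof.
move=> j_cut; apply: share_uncut => [||c /mapP[i i_cut ->]].
- exact: cuts_csp_cuts.
- by rewrite size_mkseq size_map size_cut_slots.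
apply: contraNN j_cut => /(in_slot_inj (in_slot_cut_pos i)).
by move=> <-.
Qed.

Lemma share_at_cut j : j \in cut_slots ->
  phi j = let th := if j == flip_slot N then alpha else if odd j then 1 - beta else beta in
          if L j then th else 1 - th.
Proof.
move=> j_cut; have c_in : cut_pos j \in csp_cuts by apply: map_f.
have c_only c : c \in csp_cuts -> in_slot c j -> c = cut_pos j.
  by move=> /mapP[i _ ->] /(in_slot_inj (in_slot_cut_pos i)) ->.
have in_slots c : c \in csp_cuts -> exists i, in_slot c i.
  by move=> /mapP[i _ ->]; exists i; apply: in_slot_cut_pos.
have size_lab : size csp_labels = (size csp_cuts).+1.
  by rewrite size_mkseq size_map size_cut_slots.
rewrite /phi (share_cut cuts_csp_cuts size_lab c_in (in_slot_cut_pos j) c_only).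
rewrite -(label_cut _ in_slots c_in (in_slot_cut_pos j) c_only) -/(L j) -/(L j.+1).
rewrite label_succ j_cut /cut_pos; set th := (if _ then alpha else _).
have e0 : 2 ^+ j.*2.+2 != 0 :> R by rewrite expf_neq0 ?pnatr_eq0.
have -> : slot_hi j = slot_lo j + 2 ^- j.*2.+2 by rewrite -slot_size; ring.
by case: (L j) => /=; move: (2 ^+ _) e0 => e e0; field.
Qed.

Lemma label_left j : (j <= flip_slot N)%N -> L j = true.
Proof.
elim: j => [_|j IHj lt_j]; last first.
  rewrite label_succ IHj ?(ltnW lt_j)// (negbTE (not_cut_slot _ _)) ?ltn_eqF//.
  by move: lt_j; rewrite /flip_slot /minus_slot; lia.
rewrite label_count (eq_count (a2 := pred0)) ?count_pred0//.
Qed.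

Lemma label_cell n t : (n < N)%N -> (t <= k)%N -> L (cs n t false) = false.
Proof.
have csS m v : cs m v true = (cs m v false).+1 by rewrite /cs /cell_slot; lia.
have csSS m v : cs m v.+1 false = (cs m v true).+1 by rewrite /cs /cell_slot; lia.
have walk m v : (m < N)%N -> (v <= k)%N -> L (cs m 0 false) = false -> L (cs m v false) = false.
  move=> lt_m + L0; elim: v => // v IHv lt_v.
  rewrite csSS label_succ csS label_succ -csS !mem_cell_cut// IHv 1?ltnW//.
  by case: (v == u m).
move=> lt_n le_t; apply: (walk) => //; elim: n lt_n => [_|n IHn lt_n].
  have -> : cs 0 0 false = (minus_slot N).+1 by rewrite /cs /cell_slot /minus_slot; lia.
  have -> : minus_slot N = (flip_slot N).+1 by rewrite /minus_slot /flip_slot; lia.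
  rewrite 2!label_succ label_left// mem_head (negbTE (not_cut_slot _ _))//.
    by rewrite /flip_slot /minus_slot; lia.
  by rewrite gtn_eqF.
have -> : cs n.+1 0 false = cs n k false by rewrite /cs /cell_slot; lia.
by apply: walk; rewrite ?(ltnW lt_n)// IHn// ltnW.
Qed.

Lemma share_cell n t b : (n < N)%N -> (t < k)%N -> phi (cs n t b) = (u n == t)%:R * beta.
Proof.
move=> lt_n lt_t; have csS : cs n t true = (cs n t false).+1 by rewrite /cs /cell_slot; lia.
have flipF : (cs n t b == flip_slot N) = false.
  by apply/eqP; rewrite /cs /cell_slot /flip_slot; lia.
have odd_cs : odd (cs n t b) = ~~ b.
  by rewrite /cs /cell_slot !oddD !odd_double /= oddb; case: (b).
have LE : L (cs n t b) = b && (t == u n).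
  case: b {flipF odd_cs}; last by rewrite (label_cell lt_n (ltnW lt_t)).
  by rewrite csS label_succ (label_cell lt_n (ltnW lt_t)) mem_cell_cut// addbF.
have [ut|ut] := eqVneq (u n) t; last first.
  rewrite mul0r share_not_cut ?mem_cell_cut// 1?eq_sym//.
  by rewrite LE eq_sym (negbTE ut) andbF.
rewrite mul1r share_at_cut ?mem_cell_cut ?ut// flipF odd_cs LE ut eqxx andbT /=.
by case: (b) => //=; ring.
Qed.

(** A slot to the left of the flip slot contributes its whole mass and the minus slot nothing, so
    every other agent receives [w] plus [beta] for each selected pair in its list, and there is
    exactly one such pair. *)
Lemma csp_solution A : gadget_agent k w N CS A -> weighted_sum phi A = w%:R + beta.
Proof.
have phi_plus : phi plus_slot = 1.
  by rewrite share_not_cut ?label_left// not_cut_slot// /plus_slot /flip_slot addn1.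
have phi_force n b : (n < N)%N -> phi (force_slot n b) = 1.
  move=> lt_n; have lt_flip : (force_slot n b < flip_slot N)%N.
    by rewrite /force_slot /flip_slot; case: b; lia.
  rewrite share_not_cut ?label_left// 1?ltnW// not_cut_slot ?ltn_eqF//.
  by move: lt_flip; rewrite /flip_slot /minus_slot; lia.
have phi_flip : phi (flip_slot N) = alpha.
  by rewrite share_at_cut ?mem_head// eqxx label_left.
have phi_minus : phi (minus_slot N) = 0.
  have minusE : minus_slot N = (flip_slot N).+1 by rewrite /minus_slot /flip_slot; lia.
  rewrite share_not_cut; first by rewrite minusE label_succ mem_head label_left.
  by rewrite not_cut_slot// minusE gtn_eqF.
have sum_count (T : eqType) (P : pred T) s : \sum_(x <- s) (P x)%:R = (count P s)%:R :> R.
  by rewrite -natr_sum -sumn_count sumnE big_map.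
have exactE Ls : (size Ls <= k)%N -> all (fun l => (l.1.1 < N)%N && (l.1.2 < k)%N) Ls ->
    count (fun l => u l.1.1 == l.1.2) Ls = 1%N ->
    weighted_sum phi (exact_agent k w N Ls) = w%:R + beta.
  move=> le_k /allP lt_Ls cnt1; rewrite weighted_sum_exact// phi_plus phi_minus mulr1 mulr0 addr0.
  congr (_ + _); rewrite big_seq (eq_bigr (fun l => (u l.1.1 == l.1.2)%:R * beta)); last first.
    by move=> l /lt_Ls/andP[lt_n lt_t]; apply: share_cell.
  by rewrite -big_seq -mulr_suml sum_count cnt1 mul1r.
have count_u n : (n < N)%N -> count (fun t => u n == t) (iota 0 k) = 1%N.
  move=> lt_n; rewrite (eq_count (a2 := pred1 (u n))); last by move=> t; rewrite /= eq_sym.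
  by rewrite count_uniq_mem ?iota_uniq// mem_iota u_lt.
have agent_lits n f : (n < N)%N ->
    weighted_sum phi (exact_agent k w N [seq (n, t, f t) | t <- iota 0 k]) = w%:R + beta.
  move=> lt_n; apply: exactE; first by rewrite size_map size_iota.
    by rewrite all_map; apply/allP => t; rewrite mem_iota /= lt_n.
  by rewrite count_map -(count_u n).
case=> [->|[n [b [lt_n ->]]]|[n lt_n [->|[t lt_t ->]]]|[c cC ->]].
- by rewrite /weighted_sum big_seq1 /= phi_flip mulrC alpha_mass.
- rewrite weighted_sum_force phi_force// mulr1; congr (_ + _).
  rewrite big_seq (eq_bigr (fun t => (u n == t)%:R * beta)); last first.
    by move=> t; rewrite mem_iota => lt_t; apply: share_cell.
  by rewrite -big_seq -mulr_suml sum_count count_u// mul1r.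
- exact: agent_lits.
- exact: agent_lits.
have [le_c lt_c _] := CS_wf cC; have [_ /(_ c cC) cnt] := u_csp.
by apply: exactE; rewrite ?size_map ?all_map ?count_map.
Qed.

End Cuts.
End Construction.

(** * Gadget instances as members of the language *)

Section GadgetLanguage.
Variables (k w N : nat) (CS : seq (nat * nat) -> Prop).
Hypotheses (CS_wf : csp_wf k N CS) (w_gt0 : 0 < w).

Lemma exact_agent_ok Ls : size Ls <= k ->
  sorted ltn [seq cell_slot k N l.1.1 l.1.2 l.2 | l <- Ls] ->
  agent_ok (exact_agent k w N Ls) /\
  sumn [seq jm.2 | jm <- exact_agent k w N Ls] = gadget_mass k w.
Proof.
move=> le_k sorted_Ls; rewrite /exact_agent /agent_ok /gadget_mass.
rewrite !map_cons !map_cat -!map_comp.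
have -> : [seq (snd \o (fun l => (cell_slot k N l.1.1 l.1.2 l.2, 1))) l | l <- Ls] =
    nseq (size Ls) 1 by elim: Ls {le_k sorted_Ls} => //= l Ls ->.
set slots := [seq (fst \o _) l | l <- Ls].
have path_slots : path ltn (minus_slot N) slots.
  move: sorted_Ls; rewrite -[[seq _ | l <- Ls]]/slots.
  case def_s: slots => [//|j s] /= ->; rewrite andbT.
  have /mapP[l _ ->] : j \in slots by rewrite def_s mem_head.
  by rewrite /= /cell_slot /minus_slot; lia.
have path_slots0 : path ltn plus_slot slots.
  case: slots path_slots => //= j s /andP[lt_j ->]; rewrite andbT.
  by apply: leq_trans lt_j; rewrite /plus_slot /minus_slot; lia.
case: eqP => [size_Ls|_] /=; rewrite ?sumn_nseq.
  by split=> //; rewrite size_Ls; lia.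
split; last by lia.
by rewrite path_slots /plus_slot /minus_slot; lia.
Qed.

Lemma gadget_agent_ok A : gadget_agent k w N CS A ->
  agent_ok A /\ sumn [seq jm.2 | jm <- A] = gadget_mass k w.
Proof.
have iota_ok n (f : nat -> bool) :
  sorted ltn [seq cell_slot k N l.1.1 l.1.2 l.2 | l <- [seq (n, t, f t) | t <- iota 0 k]].
  rewrite -map_comp; apply: (homo_sorted (e := ltn)); last exact: iota_ltn_sorted.
  by move=> t t' /= lt_t; rewrite /cell_slot; case: (f t); case: (f t'); lia.
case=> [->|[n [b [lt_n ->]]]|[n lt_n [->|[t lt_t ->]]]|[c cC ->]].
- by split=> //=; rewrite addn0.
- rewrite /force_agent /agent_ok /= -!map_comp; split; last first.
    have -> : [seq (snd \o (fun t => (cell_slot k N n t b, 1))) t | t <- iota 0 k] = nseq k 1.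
      by rewrite -[in RHS](size_iota 0 k); elim: (iota 0 k) => //= t s ->.
    by rewrite sumn_nseq /gadget_mass; lia.
  have := iota_ok n (fun=> b); rewrite -map_comp; set slots := map _ _.
  have ge_slots j : j \in slots -> force_slot n b < j.
    by move=> /mapP[t _ ->] /=; rewrite /force_slot /cell_slot; case: (b); lia.
  case: slots ge_slots => //= j s ge_slots ->; rewrite andbT.
  by apply: ge_slots; rewrite mem_head.
- apply: exact_agent_ok; first by rewrite size_map size_iota.
  exact: (iota_ok n (fun=> false)).
- apply: exact_agent_ok; first by rewrite size_map size_iota.
  exact: (iota_ok n (fun v => v == t)).
have [le_c _ c_sorted] := CS_wf cC; apply: exact_agent_ok; first by rewrite size_map.
rewrite -map_comp (eq_map (g := (fun m => N.*2 + 3 + m.*2 + 0) \o (fun l => l.1 * k + l.2)))//.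
rewrite map_comp; apply: (homo_sorted (e := ltn)) c_sorted.
by move=> x y /=; lia.
Qed.

Theorem gadget_ICD (R : realType) (alpha beta : R) (L : seq (seq (nat * nat))) :
  (0 < alpha < 1)%R -> (0 < beta < 1)%R ->
  (alpha * (gadget_mass k w)%:R = w%:R + beta)%R ->
  (forall A, A \in L <-> gadget_agent k w N CS A) ->
  ICD alpha (encode [seq slot_agent (gadget_mass k w) A | A <- L] N.*2.+1) <->
  exists u, gadget_csp k N CS u.
Proof.
move=> alpha01 beta01 alpha_mass LP.
have D_gt0 : 0 < gadget_mass k w by rewrite addn_gt0 w_gt0 orbT.
have D_neq0 : ((gadget_mass k w)%:R != 0 :> R)%R by rewrite pnatr_eq0 -lt0n.
have measureE A t lab : A \in L ->
    agent_measure (slot_agent (gadget_mass k w) A) (plus_part t lab) = alpha%:E <->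
    (weighted_sum (share (plus_part t lab)) A = w%:R + beta)%R.
  move=> /LP/gadget_agent_ok[A_ok _].
  rewrite agent_measureE//; last exact: measurable_plus_part.
  rewrite -alpha_mass; rewrite /weighted_sum; split=> [[<-]|->]; first by rewrite divfK.
  by rewrite mulfK.
split=> [[I [c [/encode_inj[<- <-] _ [t [lab [le_t [t_cuts size_lab sol]]]]]]]|[u u_csp]].
  apply: (solution_csp CS_wf w_gt0 alpha01 beta01 alpha_mass t_cuts size_lab le_t).
  move=> A /LP AL; apply/measureE => //.
  by apply: sol; apply: map_f.
exists [seq slot_agent (gadget_mass k w) A | A <- L], N.*2.+1; split=> //.
  move=> _ /mapP[A AL ->]; have /LP/gadget_agent_ok[A_ok sumA] := AL.
  exact: valid_slot_agent.
exists (csp_cuts k N alpha beta u), (csp_labels N).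
split; first by rewrite size_map size_cut_slots.
split; first exact: (cuts_csp_cuts alpha01 beta01 u_csp).
  by rewrite size_mkseq size_map size_cut_slots.
move=> _ /mapP[A AL ->]; apply/measureE => //.
by apply: (csp_solution CS_wf alpha01 beta01 alpha_mass u_csp); apply/LP.
Qed.

End GadgetLanguage.

(** * Computation tableaux *)

Definition not_bit A (s : option (bool + A)) : bool :=
  if s is Some (inl _) then false else true.

Section Tableau.
Variable M : TM.

Notation sym := (option (bool + tm_aux M)).
Notation vec := {ffun 'I_(tm_tapes M).+1 -> sym}.

(* State, scanned symbols, then for the left neighbour, the cell itself and the
   right neighbour the symbols once the head has written, then the symbols
   before writing.  Columns are relative to the heads, so that a move of a head
   shifts its tape. *)
Definition cell : finType := (tm_state M * vec * vec * vec * vec * vec)%type.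

Definition cell_state (u : cell) := u.1.1.1.1.1.
Definition cell_scan (u : cell) := u.1.1.1.1.2.
Definition cell_left (u : cell) := u.1.1.1.2.
Definition cell_mid (u : cell) := u.1.1.2.
Definition cell_right (u : cell) := u.1.2.
Definition cell_sym (u : cell) := u.2.

(** A halted configuration repeats itself by rewriting the scanned symbols in place, so a tableau of
    fixed height also represents shorter runs. *)
Definition act_of (q : tm_state M) (a : vec) :
    tm_state M * {ffun 'I_(tm_tapes M).+1 -> sym * move} :=
  if tm_halt q then (q, [ffun i => (a i, MoveN)]) else tm_trans q a.

Definition next_cell (u : cell) : tm_state M * vec :=
  let qa := act_of (cell_state u) (cell_scan u) in
  (qa.1, [ffun i => match (qa.2 i).2 with
                    | MoveL => cell_left u i
                    | MoveN => cell_mid u i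
                    | MoveR => cell_right u i
                    end]).

Definition written (u : cell) : vec :=
  [ffun i => ((act_of (cell_state u) (cell_scan u)).2 i).1].

(** The windows of two neighbours overlap in two columns. Comparing [to_right] with [to_left] of the
    next cell identifies these and also spreads the state and the scanned symbols along the row. *)
Definition to_right (u : cell) := (cell_state u, cell_scan u, cell_mid u, cell_right u).
Definition to_left (u : cell) := (cell_state u, cell_scan u, cell_left u, cell_mid u).
Definition current (u : cell) := (cell_state u, cell_sym u).

Definition plain_cell (u : cell) : bool := cell_mid u == cell_sym u.
Definition head_cell (u : cell) : bool :=
  (cell_scan u == cell_sym u) && (cell_mid u == written u).

Definition bit_or_blank (s : sym) : bool := if s is Some (inr _) then false else true.

Definition accept_cell (u : cell) : bool :=
  [&& tm_halt (cell_state u), cell_scan u ord0 == Some (inl true) &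
      not_bit (cell_right u ord0)].
Definition blank_cell (u : cell) : bool := [forall i, cell_sym u i == None].
Definition input_cell (s : sym) (u : cell) : bool := cell_sym u ord0 == s.
(** A blank forces a blank to its right, so the guessed symbols form a word of length at most [B]
    followed by blanks. Quantifying over [i] also covers a machine with a single tape, which does
    not see its second argument. *)
Definition guess_cell (u : cell) : bool :=
  [forall i : 'I_(tm_tapes M).+1, (i == 1 :> nat) ==>
     bit_or_blank (cell_sym u i) && ((cell_sym u i == None) ==> (cell_right u i == None))].
Definition guess_blank_cell (u : cell) : bool :=
  [forall i : 'I_(tm_tapes M).+1, (i == 1 :> nat) ==> (cell_sym u i == None)].
Definition start_cell (u : cell) : bool :=
  (cell_state u == tm_start M) &&
  [forall i : 'I_(tm_tapes M).+1, (1 < i) ==> (cell_sym u i == None)].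

Section Grid.
Variables (T B : nat) (x : word).
Let n := size x.
Let h := n + B + T + 1.
Let W := (h + h).+1.

Definition grid_rows (v : nat -> nat -> cell) : Prop :=
  [/\ forall i j, i <= T -> j < W -> j != h -> plain_cell (v i j),
      forall i, i <= T -> head_cell (v i h),
      forall i j, i <= T -> j.+1 < W -> to_right (v i j) = to_left (v i j.+1),
      forall i j, i < T -> j < W -> next_cell (v i j) = current (v i.+1 j) &
      accept_cell (v T h)].

Definition grid_start (v : nat -> nat -> cell) : Prop :=
  [/\ forall j, j < W -> start_cell (v 0 j) & forall j, j < h -> blank_cell (v 0 j)] /\
  [/\ forall j, j < n -> input_cell (Some (inl (nth false x j))) (v 0 (h + j)),
      forall j, j < B + T + 2 -> input_cell None (v 0 (h + n + j)),
      forall j, j < B -> guess_cell (v 0 (h + j)) &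
      forall j, j < n + T + 2 -> guess_blank_cell (v 0 (h + B + j))].

(* The content of a tape at position [p], when the head is at [h + 1]. *)
Definition tape_at (t : tape M) (p : nat) : sym :=
  if h < p then nth None t.2 (p - h.+1) else nth None t.1 (h - p).

Definition write_at (t : tape M) (s : sym) (p : nat) : sym :=
  if p == h.+1 then s else tape_at t p.

(** Column [j] is read at position [j + 1], so that column 0 still has a left neighbour and the
    predecessor of a position is never truncated. *)
Lemma tape_at_move t am p : 0 < p ->
  tape_at (write_move t am) p =
  write_at t am.1 (match am.2 with MoveL => p.-1 | MoveN => p | MoveR => p.+1 end).
Proof.
case: t am => [l r] [s mv] p_gt0; rewrite /write_at /tape_at /write_move /=.
case: mv => /=.
- rewrite nth_behead; case: (ltngtP h p) => [lt_hp|lt_ph|eq_hp].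
  + have [e|ne] := eqVneq p h.+1; first by rewrite e subnn /= ltn_eqF// ltnn subnn nth0.
    have -> : p - h.+1 = (p - h.+2).+1 by lia.
    have [e'|ne'] := eqVneq p.-1 h.+1; first by have -> : p - h.+2 = 0 by lia.
    have -> : h < p.-1 by lia.
    have -> : p - h.+2 = (p.-1 - h.+2).+1 by lia.
    by rewrite /= nth_behead; congr (nth _ _ _); lia.
  + have -> : p.-1 == h.+1 = false by apply/eqP; lia.
    have -> : h < p.-1 = false by lia.
    by congr (nth _ _ _); lia.
  have -> : p.-1 == h.+1 = false by apply/eqP; lia.
  have -> : h < p.-1 = false by lia.
  by congr (nth _ _ _); lia.
- have [->|ne] := eqVneq p h.+1; first by rewrite ltnSn subnn.
  case: ltnP => // lt_hp; have -> : p - h.+1 = (p - h.+2).+1 by lia.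
  by rewrite /= nth_behead.
have [e|ne] := eqVneq p.+1 h.+1.
  by have [->] := e; rewrite ltnn subnn.
case: (ltnP h p) => lt_hp.
  by rewrite nth_behead ltnW//; congr (nth _ _ _); lia.
have -> : h < p.+1 = false by lia.
by have -> : h - p = (h - p.+1).+1 by lia.
Qed.

Definition scan (c : config M) : vec := [ffun i => scanned (c.2 i)].

Lemma scanE c i : scan c i = tape_at (c.2 i) h.+1.
Proof. by rewrite ffunE /scanned /tape_at ltnSn subnn nth0. Qed.

Lemma tm_step_state c : (tm_step c).1 = (act_of c.1 (scan c)).1.
Proof. by rewrite /tm_step /act_of; case: ifP. Qed.

Lemma tm_step_tape c i p : 0 < p ->
  tape_at ((tm_step c).2 i) p =
  write_at (c.2 i) ((act_of c.1 (scan c)).2 i).1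
    (match ((act_of c.1 (scan c)).2 i).2 with
     | MoveL => p.-1 | MoveN => p | MoveR => p.+1 end).
Proof.
move=> p_gt0; rewrite /tm_step /act_of; case: ifP => _ /=; last first.
  by rewrite ffunE tape_at_move.
by rewrite ffunE /= /write_at; case: eqP => // ->; rewrite scanE.
Qed.

Definition config_cell (c : config M) (j : nat) : cell :=
  let w p := [ffun i => write_at (c.2 i) ((act_of c.1 (scan c)).2 i).1 p] in
  (c.1, scan c, w j, w j.+1, w j.+2, [ffun i => tape_at (c.2 i) j.+1]).

Definition run_config (y : word) (i : nat) : config M :=
  iter i (@tm_step M) (tm_init M [:: x; y]).

Definition accepting (c : config M) : Prop :=
  tm_halt c.1 /\ leading_bits (c.2 ord0).2 = [:: true].

Lemma leading_bits_true (A : Type) (s : seq (option (bool + A))) :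
  leading_bits s = [:: true] <->
  nth None s 0 = Some (inl true) /\ not_bit (nth None s 1).
Proof.
case: s => [|[[b|a]|] s] /=; try by split=> // -[].
by case: s => [|[[b'|a']|] s] /=; split=> [|[]] // [->].
Qed.

Lemma tape_at_init y i j : j <= h + h ->
  tape_at ((tm_init M [:: x; y]).2 i) j.+1 =
  if h <= j then nth None [seq Some (inl b) | b <- nth [::] [:: x; y] i] (j - h) else None.
Proof.
move=> le_j; rewrite ffunE /tape_at ltnS subSS; case: ifP => // _.
by rewrite nth_nil.
Qed.

Lemma grid_of_run y : size y <= B -> accepting (run_config y T) ->
  exists2 v, grid_rows v & grid_start v.
Proof.
move=> le_y [acc_halt acc_out]; exists (fun i => config_cell (run_config y i)).
  split.
  - move=> i j _ _ jh; apply/eqP/ffunP => a; rewrite !ffunE /write_at.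
    by rewrite eqSS (negbTE jh).
  - move=> i _; apply/andP; split; apply/eqP/ffunP => a.
      by rewrite [LHS]scanE ffunE.
    by rewrite !ffunE /write_at eqxx.
  - by [].
  - move=> i j _ _; rewrite /current /next_cell /run_config iterS -/(run_config y i).
    congr pair; first by rewrite /cell_state /= tm_step_state.
    apply/ffunP => a; rewrite !ffunE tm_step_tape//=.
    rewrite /cell_state /cell_scan /=.
    by case: ((act_of (run_config y i).1 (scan (run_config y i))).2 a).2.
  - move/leading_bits_true: acc_out => [out0 out1].
    apply/and3P; split=> //=; first by rewrite scanE /tape_at ltnSn subnn out0.
    rewrite /cell_right /= ffunE /write_at gtn_eqF// /tape_at leqnSn.
    by rewrite subSnn.
have symE j a : j <= h + h -> cell_sym (config_cell (run_config y 0) j) a =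
    if h <= j then nth None [seq Some (inl b) | b <- nth [::] [:: x; y] a] (j - h) else None.
  by move=> le_j; rewrite /cell_sym /= ffunE tape_at_init.
split; split.
- move=> j lt_j; apply/andP; split=> //; apply/forallP => a; apply/implyP => a1.
  rewrite symE//; case: ifP => // _.
  by case: (nat_of_ord a) a1 => [|[|b]] //= _; rewrite !nth_nil.
- by move=> j lt_j; apply/forallP => a; rewrite symE ?(leqNgt h) ?lt_j// ltnW// ltn_addr.
- move=> j lt_j; apply/eqP; rewrite symE; last by rewrite /h; lia.
  by rewrite leq_addr addKn (nth_map false).
- move=> j lt_j; apply/eqP; rewrite symE; last by rewrite /h; lia.
  rewrite -addnA leq_addr addKn nth_default// size_map /= -/n; lia.
- move=> j lt_j; apply/forallP => a; apply/implyP => /eqP a1.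
  have symR : cell_right (config_cell (run_config y 0) (h + j)) a =
      cell_sym (config_cell (run_config y 0) (h + j).+1) a.
    rewrite /cell_right /cell_sym /= !ffunE /write_at ifN//.
    by apply/eqP; lia.
  rewrite symR !symE; try by rewrite /h; lia.
  rewrite leq_addr leqW ?leq_addr// subSn ?leq_addr// addKn a1 /=.
  have [lt_jy|le_yj] := ltnP j (size y); first by rewrite (nth_map false).
  by rewrite !nth_default ?size_map// leqW.
move=> j lt_j; apply/forallP => a; apply/implyP => /eqP a1; apply/eqP.
rewrite symE; last by rewrite /h; lia.
rewrite -addnA leq_addr addKn a1 nth_default// size_map /=.
by rewrite (leq_trans le_y)// leq_addr.
Qed.

Lemma word_of_guess (Y : nat -> sym) b m : b <= m ->
  (forall i, i < b -> bit_or_blank (Y i) && ((Y i == None) ==> (Y i.+1 == None))) ->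
  (forall i, b <= i < m -> Y i = None) ->
  exists2 y : word, size y <= b &
    forall i, i < m -> Y i = nth None [seq Some (inl c) | c <- y] i.
Proof.
elim: b Y m => [|b IHb] Y m le_bm Yb Ym.
  by exists [::] => // i lt_i; rewrite nth_nil Ym.
have /andP[] := Yb 0 isT; case Y0: (Y 0) => [[c|//]|] _ Y1; last first.
  have Y_None i : i <= b -> Y i = None.
    elim: i => // i IHi lt_i; have /andP[_] := Yb i (ltnW lt_i).
    by rewrite IHi ?eqxx ?(ltnW lt_i)//= => /eqP.
  exists [::] => // i lt_i; rewrite nth_nil.
  by have [/Y_None|lt_b] := leqP i b; [|apply: Ym; rewrite lt_b].
case: m le_bm Ym => // m le_bm Ym.
have [y le_y Yy] : exists2 y : word, size y <= b &
    forall i, i < m -> Y i.+1 = nth None [seq Some (inl c) | c <- y] i.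
  apply: IHb => // i; last by move=> /andP[le_i lt_i]; apply: Ym; rewrite ltnS le_i.
  by move=> lt_i; apply: (Yb i.+1).
by exists (c :: y) => // -[|i] //; apply: Yy.
Qed.

Section FromGrid.
Variables (v : nat -> nat -> cell).
Hypotheses (v_rows : grid_rows v) (v_start : grid_start v).

Lemma guess_of_grid : exists2 y : word, size y <= B &
  forall j a, j <= h + h -> cell_sym (v 0 j) a = tape_at ((tm_init M [:: x; y]).2 a) j.+1.
Proof.
have [plain _ hor _ _] := v_rows.
have [[v_first v_blank] [v_in v_in' v_guess v_guess']] := v_start.
have hE : h = n + B + T + 1 by [].
have [y le_y yP] : exists2 y : word, size y <= B &
    forall (a : 'I_(tm_tapes M).+1) i, a = 1 :> nat -> i <= h ->
      cell_sym (v 0 (h + i)) a = nth None [seq Some (inl c) | c <- y] i.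
  have [lt_K|le_K] := ltnP 1 (tm_tapes M).+1; last first.
    by exists [::] => // a i a1; have := ltn_ord a; rewrite a1 ltnNge le_K.
  have [|i lt_i|i /andP[le_i lt_i]|y le_y yP] :=
    @word_of_guess (fun i => cell_sym (v 0 (h + i)) (Ordinal lt_K)) B h.+1.
  - by rewrite hE; lia.
  - have /forallP/(_ (Ordinal lt_K))/= /andP[-> /=] := v_guess i lt_i.
    have := hor 0 (h + i) (leq0n _) _; rewrite -addnS.
    have -> : (h + i.+1 < W) by rewrite /W; lia.
    move=> /(_ isT); rewrite /to_right /to_left => -[_ _ _ ->].
    have /eqP -> // : plain_cell (v 0 (h + i.+1)).
    by apply: plain => //; [rewrite /W; lia | apply/eqP; lia].
  - apply/eqP; have := v_guess' (i - B); have -> : h + B + (i - B) = h + i by lia.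
    have -> : i - B < n + T + 2 by lia.
    by move=> /(_ isT)/forallP/(_ (Ordinal lt_K)).
  exists y => // a i a1 le_i; rewrite -yP//; congr (cell_sym _ _).
  exact: val_inj.
exists y => // j a le_j; rewrite tape_at_init//.
have [le_hj|lt_jh] := leqP h j; last by have /forallP/(_ a)/eqP := v_blank j lt_jh.
have [a0|a0] := eqVneq (nat_of_ord a) 0.
  have -> : a = ord0 by apply: val_inj.
  rewrite /=; have [lt_n|le_n] := ltnP (j - h) n.
    have /eqP := v_in (j - h) lt_n; rewrite subnKC// => ->.
    by rewrite (nth_map false).
  have := v_in' (j - h - n); have -> : h + n + (j - h - n) = j by lia.
  have -> : j - h - n < B + T + 2 by lia.
  by move=> /(_ isT)/eqP ->; rewrite nth_default// size_map.
have [a1|a1] := eqVneq (nat_of_ord a) 1.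
  by rewrite -[in LHS](subnKC le_hj) yP ?a1//; lia.
have a_gt1 : 1 < a by move: a0 a1; case: (nat_of_ord a) => [|[]].
have lt_jW : j < W by rewrite ltnS.
have /andP[_ /forallP/(_ a)/implyP/(_ a_gt1)/eqP ->] := v_first j lt_jW.
by case: (nat_of_ord a) a_gt1 => [|[|b]] //= _; rewrite !nth_nil.
Qed.

(** Nothing constrains the left neighbour of the first column or the right neighbour of the last
    one, and this error spreads by at most one column per step. Row [i] therefore agrees with the
    run only in the columns from [i] to [2h - i], which contain the head column and its right
    neighbour up to row [T]. *)
Lemma run_of_grid : exists2 y : word, size y <= B & accepting (run_config y T).
Proof.
have [plain hd hor ver acc] := v_rows; have [y le_y init_y] := guess_of_grid.
exists y => //.
have hE : h = n + B + T + 1 by [].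
have WE : W = (h + h).+1 by [].
have row i j : i <= T -> j < W ->
    cell_state (v i j) = cell_state (v i h) /\ cell_scan (v i j) = cell_scan (v i h).
  move=> le_i lt_j; have row0 j' : j' < W ->
      cell_state (v i j') = cell_state (v i 0) /\ cell_scan (v i j') = cell_scan (v i 0).
    elim: j' => // j' IHj lt_j'; have := hor i j' le_i lt_j'.
    by rewrite /to_right /to_left => -[<- <- _ _]; apply/IHj/ltnW.
  by have [-> ->] := row0 j lt_j; have [|-> ->] := row0 h; rewrite // WE ltnS leq_addr.
pose c i := run_config y i.
have scanP i : i <= T -> (forall a, cell_sym (v i h) a = tape_at ((c i).2 a) h.+1) ->
    cell_scan (v i h) = scan (c i).
  move=> le_i symE; have /andP[/eqP -> _] := hd i le_i.
  by apply/ffunP => a; rewrite symE scanE.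
have cone i : i <= T -> cell_state (v i h) = (c i).1 /\
    forall j a, i <= j -> i + j <= h + h -> cell_sym (v i j) a = tape_at ((c i).2 a) j.+1.
  elim: i => [|i IHi] lt_i.
    split; last by move=> j a _ le_j; apply: init_y.
    have [[v_first _] _] := v_start.
    have /andP[/eqP -> //] : start_cell (v 0 h) by apply: v_first; rewrite WE ltnS leq_addr.
  have [stateE symE] := IHi (ltnW lt_i).
  have scan_i : cell_scan (v i h) = scan (c i).
    by apply: scanP => [|a]; [exact: ltnW | apply: symE; lia].
  have act_i j : j < W -> act_of (cell_state (v i j)) (cell_scan (v i j)) =
      act_of (c i).1 (scan (c i)).
    by move=> lt_j; have [-> ->] := row i j (ltnW lt_i) lt_j; rewrite stateE scan_i.
  have lt_hW : h < W by rewrite WE ltnS leq_addr.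
  have midE j a : i <= j -> i + j <= h + h ->
      cell_mid (v i j) a = write_at ((c i).2 a) ((act_of (c i).1 (scan (c i))).2 a).1 j.+1.
    move=> le_ij le_j; rewrite /write_at eqSS; have [->|jh] := eqVneq j h.
      have /andP[_ /eqP ->] := hd i (ltnW lt_i).
      by rewrite ffunE act_i.
    have /eqP -> : plain_cell (v i j) by apply: plain => //; [exact: ltnW | lia].
    exact: symE.
  split.
    have := ver i h lt_i lt_hW; rewrite /next_cell /current => -[<- _].
    by rewrite act_i// /c /run_config iterS tm_step_state.
  move=> j a le_j le_jh; have lt_j : j < W by lia.
  have := ver i j lt_i lt_j; rewrite /next_cell /current => -[_ <-].
  rewrite ffunE act_i// /c /run_config iterS -/(run_config y i) tm_step_tape// -/(c i).
  case: j le_j le_jh lt_j => // j le_j le_jh lt_j.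
  case: ((act_of _ _).2 a).2 => /=.
  - have := hor i j (ltnW lt_i) lt_j; rewrite /to_right /to_left => -[_ _ <- _].
    by apply: midE; lia.
  - by apply: midE; lia.
  have lt_jW : j.+2 < W by lia.
  have := hor i j.+1 (ltnW lt_i) lt_jW; rewrite /to_right /to_left => -[_ _ _ ->].
  by apply: midE; lia.
have [stateT symT] := cone T (leqnn T).
have scanT : cell_scan (v T h) = scan (c T).
  by apply: scanP => // a; apply: symT; lia.
have /and3P[haltT outT nextT] := acc.
split; first by rewrite -stateT.
apply/leading_bits_true; split.
  by move: outT; rewrite scanT ffunE /scanned -nth0 => /eqP.
have lt_hW : h.+1 < W by lia.
have := hor T h (leqnn T) lt_hW; rewrite /to_right /to_left => -[_ _ _ rightE].
move: nextT; rewrite rightE.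
have /eqP -> : plain_cell (v T h.+1) by apply: plain => //; apply/eqP; lia.
rewrite symT; [|lia|lia].
by rewrite /tape_at leqnSn subSnn.
Qed.

End FromGrid.
End Grid.
End Tableau.

(** * The tableau as a constraint system *)

Section Encoding.
Variable M : TM.

Notation cell := (cell M).

Definition default_cell : cell :=
  let a := [ffun => None] in (tm_start M, a, a, a, a, a).

Definition cell_of (t : nat) : cell := nth default_cell (enum cell) t.
Definition cell_code (u : cell) : nat := index u (enum cell).

Lemma cell_codeK u : cell_of (cell_code u) = u.
Proof. by rewrite /cell_of nth_index// mem_enum. Qed.

Lemma cell_code_lt u : cell_code u < #|cell|.
Proof. by rewrite cardE index_mem mem_enum. Qed.

Definition lits (n : nat) (P : pred cell) : seq (nat * nat) :=
  [seq (n, t) | t <- iota 0 #|cell| & P (cell_of t)].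

Definition must (P : pred cell) := [:: lits 0 P].

(* [f] of a cell equals [g] of another one when, for every value [c], exactly
   one of [f = c] and [g <> c] holds. *)
Definition agree (C : finType) (f g : cell -> C) (b : nat) :=
  [seq lits 0 (fun u => f u == c) ++ lits b (fun u => g u != c) | c <- enum C].

Definition tm_rules : csp_rules := {|
  row_left := must (@plain_cell M) ++ agree (@to_right M) (@to_left M) 1;
  row_head := must (@head_cell M);
  (* This walk starts in the head column, which need not be plain: the condition concerns the next
     cell. *)
  row_right := lits 1 (@plain_cell M) :: agree (@to_right M) (@to_left M) 1;
  vertical := agree (@next_cell M) (@current M) 2;
  accept := must (@accept_cell M);
  blank_left := must (@blank_cell M);
  input_one := must (@input_cell M (Some (inl true)));
  input_zero := must (@input_cell M (Some (inl false)));
  input_blank := must (@input_cell M None);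
  guess := must (@guess_cell M);
  guess_blank := must (@guess_blank_cell M);
  first_row := must (@start_cell M) |}.

Lemma size_lits n P : size (lits n P) <= #|cell|.
Proof. by rewrite size_map size_filter -[X in _ <= X](size_iota 0) count_size. Qed.

Variable k : nat.
(** The constraints of [agree] contain literals of two cells. *)
Hypothesis k_large : #|cell|.*2 <= k.

Lemma csp_ok_must P : csp_ok k (must P).
Proof. by rewrite /csp_ok /= andbT; apply: leq_trans (size_lits _ _) _; lia. Qed.

Lemma csp_ok_agree (C : finType) (f g : cell -> C) b : csp_ok k (agree f g b).
Proof.
rewrite /csp_ok all_map; apply/allP => c _ /=; rewrite size_cat.
by apply: leq_trans (leq_add (size_lits _ _) (size_lits _ _)) _; rewrite addnn.
Qed.

Lemma csp_okU Cs Cs' : csp_ok k Cs -> csp_ok k Cs' -> csp_ok k (Cs ++ Cs').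
Proof. by rewrite /csp_ok all_cat => -> ->. Qed.

Lemma tm_rules_ok : rules_ok k tm_rules.
Proof.
split; [split|split; split]; rewrite ?csp_ok_must ?csp_ok_agree//.
  exact: csp_okU (csp_ok_must _) (csp_ok_agree _ _ _).
rewrite -[row_right _]/([:: lits 1 (@plain_cell M)] ++ agree (@to_right M) (@to_left M) 1).
apply: csp_okU (csp_ok_agree _ _ _).
by rewrite /csp_ok /= andbT; apply: leq_trans (size_lits _ _) _; lia.
Qed.

Lemma shift_lits W i n P : shift_csp W i (lits n P) = lits (i + offset W n) P.
Proof. by rewrite /shift_csp /lits -map_comp. Qed.

(** The values from [#|cell|] up to [k] code no cell and satisfy no literal. Each cell of the
    tableau is subject to a constraint on that cell alone, which excludes these values before
    [agree] is interpreted. *)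
Lemma count_lits (u : nat -> nat) n P :
  count (fun l => u l.1 == l.2) (lits n P) = (u n < #|cell|) && P (cell_of (u n)).
Proof.
rewrite count_map (eq_count (a2 := pred1 (u n))); last by move=> t; rewrite /= eq_sym.
by rewrite count_uniq_mem ?filter_uniq ?iota_uniq// mem_filter mem_iota andbC.
Qed.

Section Satisfaction.
Variables (W : nat) (u : nat -> nat).

Definition sat (i : nat) (Cs : seq (seq (nat * nat))) : Prop :=
  forall c, shifted W i Cs c -> count (fun l => u l.1 == l.2) c = 1.

Lemma sat_cat i Cs Cs' : sat i (Cs ++ Cs') <-> sat i Cs /\ sat i Cs'.
Proof.
split=> [sat_i|[s1 s2] c [C]].
  by split=> c [C CC ->]; apply: sat_i; exists C => //; rewrite mem_cat CC ?orbT.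
by rewrite mem_cat => /orP[] CC ->; [apply: s1 | apply: s2]; exists C.
Qed.

Lemma sat_lits i n P : sat i [:: lits n P] <->
  u (i + offset W n) < #|cell| /\ P (cell_of (u (i + offset W n))).
Proof.
split=> [sat_i|[lt_u Pu] c [_ /[!inE]/eqP-> ->]].
  have := sat_i (lits (i + offset W n) P).
  rewrite count_lits => /(_ _)/eqP; rewrite eqb1 => uP.
  by apply/andP/uP; exists (lits n P); rewrite ?mem_head ?shift_lits.
by rewrite shift_lits count_lits lt_u Pu.
Qed.

Lemma sat_agree (C : finType) (f g : cell -> C) b i :
  u i < #|cell| -> u (i + offset W b) < #|cell| ->
  sat i (agree f g b) <-> f (cell_of (u i)) = g (cell_of (u (i + offset W b))).
Proof.
move=> lt_u lt_u'; have countE c :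
    count (fun l => u l.1 == l.2)
      (shift_csp W i (lits 0 (fun u => f u == c) ++ lits b (fun u => g u != c))) =
    (f (cell_of (u i)) == c) + (g (cell_of (u (i + offset W b))) != c).
  rewrite /shift_csp map_cat -!/(shift_csp _ _ _) count_cat !shift_lits !count_lits.
  by rewrite /offset /= addn0 lt_u lt_u'.
split=> [sat_i|fg c [_ /mapP[d _ ->] ->]]; last by rewrite countE fg; case: eqP.
set d := f (cell_of (u i)).
have mem_d : lits 0 (fun u => f u == d) ++ lits b (fun u => g u != d) \in agree f g b.
  by apply/mapP; exists d; rewrite ?mem_enum.
have := sat_i _
  (ex_intro2 (fun C => C \in agree f g b) (fun C => _ = shift_csp W i C) _ mem_d erefl).
by rewrite countE eqxx; case: eqP.
Qed.

End Satisfaction.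

Section Instance.
Variables (T B : nat) (x : word).

Let n := size x.
Let h := n + B + T + 1.
Let W := (h + h).+1.
Let N := T.+1 * W.

(** Every constraint lists values of one cell, or of two cells with the earlier one first, whence
    the order of the slots. *)
Lemma csp_wf_tableau : csp_wf k N (tableau_csp tm_rules T B x).
Proof.
have m_k : #|cell| <= k by apply: leq_trans k_large; rewrite -addnn leq_addr.
have lits_lt c0 P l : c0 < N -> l \in lits c0 P -> (l.1 < N) && (l.2 < k).
  move=> lt_c /mapP[t]; rewrite mem_filter mem_iota => /and3P[_ _ lt_t] -> /=.
  by rewrite lt_c (leq_trans lt_t).
have lits_sorted c0 P : sorted ltn [seq l.1 * k + l.2 | l <- lits c0 P].
  rewrite /lits -map_comp; apply: (homo_sorted (e := ltn)).
    by move=> s t /=; rewrite ltn_add2l.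
  exact/sorted_filter/iota_ltn_sorted/ltn_trans.
suff forms c : tableau_csp tm_rules T B x c ->
    (exists c0 P, c0 < N /\ c = lits c0 P) \/
    (exists c0 c1 P P', [/\ c0 < c1, c1 < N & c = lits c0 P ++ lits c1 P']).
  move=> c /forms[[c0 [P [lt_c ->]]]|[c0 [c1 [P [P' [lt01 lt_c ->]]]]]].
    split; [exact: leq_trans (size_lits _ _) m_k | by apply/allP => l; apply: lits_lt |].
    exact: lits_sorted.
  split.
  - rewrite size_cat; apply: leq_trans k_large; rewrite -addnn.
    exact: leq_add (size_lits _ _) (size_lits _ _).
  - apply/allP => l; rewrite mem_cat => /orP[]; apply: lits_lt => //.
    exact: ltn_trans lt01 lt_c.
  rewrite map_cat (sorted_pairwise ltn_trans) pairwise_cat.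
  rewrite -!(sorted_pairwise ltn_trans) !lits_sorted !andbT.
  apply/allrelP => _ _ /mapP[l lP ->] /mapP[l' lP' ->].
  have /andP[_ lt_k] := lits_lt _ _ _ (ltn_trans lt01 lt_c) lP.
  have [{1}-> ->] : l.1 = c0 /\ l'.1 = c1 by case/mapP: lP lP' => ? _ -> /mapP[? _ ->].
  rewrite /= -ltnS -addnS; apply: leq_trans (leq_add (leqnn _) lt_k) _.
  by rewrite -mulSnr (leq_trans _ (leq_addr _ _))// leq_mul2r lt01 orbT.
have ofs b : b != 0 -> b <= 2 -> 0 < offset W b by case: b => [|[|[|]]].
have one i n0 P : i + offset W n0 < N -> shifted W i [:: lits n0 P] c ->
    (exists c0 P, c0 < N /\ c = lits c0 P).
  move=> lt_i [_ /[!inE]/eqP-> ->]; exists (i + offset W n0), P.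
  by rewrite shift_lits.
have two i b (C : finType) (f g : cell -> C) : b != 0 -> b <= 2 -> i + offset W b < N ->
    shifted W i (agree f g b) c ->
    (exists c0 c1 P P', [/\ c0 < c1, c1 < N & c = lits c0 P ++ lits c1 P']).
  move=> b0 b2 lt_i [_ /mapP[d _ ->] ->]; rewrite /shift_csp map_cat -!/(shift_csp _ _ _).
  rewrite !shift_lits; do 4 eexists; split; [|exact: lt_i|reflexivity].
  by rewrite ltn_add2l ofs.
have row i j : i <= T -> j < W -> i * W + j < N.
  by move=> le_i lt_j; rewrite /N; nia.
have row0 j : j < W -> j < N by move=> lt_j; have := row 0 j isT lt_j.

have hW : h < W by rewrite /W ltnS leq_addr.
have lt_nBT : n + B + T < h by rewrite /h addn1.
have cat i Cs Cs' : shifted W i (Cs ++ Cs') c -> shifted W i Cs c \/ shifted W i Cs' c.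
  by case=> C; rewrite mem_cat => /orP[] CC ->; [left | right]; exists C.
have one0 j P : j < W -> shifted W j (must P) c ->
    exists c0 P, c0 < N /\ c = lits c0 P.
  by move=> lt_j; apply: one; rewrite /offset /= addn0 row0.
case=> [[i le_i [[j lt_j]|sh|[j lt_j]]]|].
- have lt_j1 : i * W + j + 1 < N by rewrite -addnA row// addn1 /W; lia.
  case/cat=> sh; [left | right].
    by apply: one sh; rewrite /offset /= addn0; apply: leq_ltn_trans lt_j1; lia.
  exact: two sh.
- by left; apply: one sh; rewrite /offset /= addn0 row.
- have lt_j1 : i * W + h + j + 1 < N by rewrite -!addnA row// /W; lia.
  case/(cat _ [:: _])=> sh; [left | right]; first exact: one sh.
  exact: two sh.
case=> [[i lt_i sh]|]; first by right; apply: two sh => //; rewrite /offset /= /N; lia.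
move=> sh; left; move: sh.
case=> [|[[j lt_j]|[[j lt_j]|[[j lt_j]|[[j lt_j]|[[j lt_j]|[j lt_j]]]]]]].
- by apply: one; rewrite /offset /= addn0 row.
- by apply: one0; lia.
- by case: ifP => _; apply: one0; lia.
- by apply: one0; lia.
- by apply: one0; lia.
- by apply: one0; lia.
exact: one0.
Qed.



(** The variables number the cells row by row, so horizontal neighbours are at distance 1 and
    vertical ones at distance [W]. *)
Lemma tableau_grid :
  (exists u, gadget_csp k N (tableau_csp tm_rules T B x) u) <->
  (exists v, @grid_rows M T B x v /\ @grid_start M T B x v).
Proof.
have hW : h < W by rewrite /W ltnS leq_addr.
have lt_nBT : n + B + T < h by rewrite /h addn1.
split=> [[u [_ cs]]|[v [[vP vH vR vV vA] [[vS vL] [vI vIB vG vGB]]]]].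
  have sL i j : i <= T -> j < h -> sat W u (i * W + j) (row_left tm_rules).
    by move=> le_i lt_j c sh; apply: cs; left; exists i => //; apply: Or31; exists j.
  have sH i : i <= T -> sat W u (i * W + h) (row_head tm_rules).
    by move=> le_i c sh; apply: cs; left; exists i => //; apply: Or32.
  have sR i j : i <= T -> j < h -> sat W u (i * W + h + j) (row_right tm_rules).
    by move=> le_i lt_j c sh; apply: cs; left; exists i => //; apply: Or33; exists j.
  have sV i : i < T * W -> sat W u i (vertical tm_rules).
    by move=> lt_i c sh; apply: cs; right; left; exists i.
  have sA : sat W u (T * W + h) (accept tm_rules).
    by move=> c sh; apply: cs; do 2 right; left.
  have sB j : j < h -> sat W u j (blank_left tm_rules).
    by move=> lt_j c sh; apply: cs; do 3 right; left; exists j.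
  have sI j : j < n -> sat W u (h + j)
      (if nth false x j then input_one tm_rules else input_zero tm_rules).
    by move=> lt_j c sh; apply: cs; do 4 right; left; exists j.
  have sIB j : j < B + T + 2 -> sat W u (h + n + j) (input_blank tm_rules).
    by move=> lt_j c sh; apply: cs; do 5 right; left; exists j.
  have sG j : j < B -> sat W u (h + j) (guess tm_rules).
    by move=> lt_j c sh; apply: cs; do 6 right; left; exists j.
  have sGB j : j < n + T + 2 -> sat W u (h + B + j) (guess_blank tm_rules).
    by move=> lt_j c sh; apply: cs; do 7 right; left; exists j.
  have sS j : j < W -> sat W u j (first_row tm_rules).
    by move=> lt_j c sh; apply: cs; do 8 right; exists j.
  have plain i j : i <= T -> j < W -> j != h ->
      u (i * W + j) < #|cell| /\ plain_cell (cell_of (u (i * W + j))).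
    move=> le_i lt_j; rewrite neq_ltn => /orP[lt_jh|lt_hj].
      by have /sat_cat[/sat_lits] := sL _ _ le_i lt_jh; rewrite /offset /= addn0.
    have lt_jh : j - h.+1 < h by move: lt_j; rewrite /W; lia.
    have /(sat_cat _ _ _ [:: _])[/sat_lits] := sR _ _ le_i lt_jh.
    have -> // : i * W + h + (j - h.+1) + offset W 1 = i * W + j.
    by rewrite -2!(addnA (i * W)) -(addnA h) addn1 subnSK// subnKC// ltnW.
  have head i : i <= T -> u (i * W + h) < #|cell| /\ head_cell (cell_of (u (i * W + h))).
    by move=> /sH/sat_lits; rewrite /offset /= addn0.
  have small i j : i <= T -> j < W -> u (i * W + j) < #|cell|.
    move=> le_i lt_j; have [->|/(plain _ _ le_i lt_j)[]//] := eqVneq j h; exact: (head i le_i).1.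
  exists (fun i j => cell_of (u (i * W + j))); split; first split.
  - by move=> i j le_i lt_j /(plain _ _ le_i lt_j)[].
  - by move=> i /head[].
  - move=> i j le_i lt_j; rewrite addnS -(addn1 (i * W + j)).
    have lt_u := small _ _ le_i (ltnW lt_j); have := small _ _ le_i lt_j.
    rewrite addnS -(addn1 (i * W + j)) => lt_u'; apply/(@sat_agree W u _ _ _ 1 _ lt_u lt_u').
    have [lt_jh|le_hj] := ltnP j h; first by have /sat_cat[] := sL _ _ le_i lt_jh.
    have lt_jh : j - h < h by move: lt_j; rewrite /W; lia.
    have /(sat_cat _ _ _ [:: _])[_] := sR _ _ le_i lt_jh.
    by rewrite -addnA subnKC.
  - move=> i j lt_i lt_j; rewrite mulSnr addnAC.
    have lt_u := small _ _ (ltnW lt_i) lt_j; have := small _ _ lt_i lt_j.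
    rewrite mulSnr addnAC => lt_u'; apply/(@sat_agree W u _ _ _ 2 _ lt_u lt_u')/sV.
    by apply: (@leq_trans (i.+1 * W)); rewrite ?leq_mul2r ?lt_i ?orbT// mulSnr ltn_add2l.
  - by have /sat_lits[_] := sA; rewrite /offset /= addn0.
  split; split=> j lt_j; rewrite mul0n add0n.
  - by have /sat_lits[_] := sS j lt_j; rewrite /offset /= addn0.
  - by have /sat_lits[_] := sB j lt_j; rewrite /offset /= addn0.
  - by have := sI j lt_j; case: ifP => _ /sat_lits[_]; rewrite /offset /= addn0.
  - by have /sat_lits[_] := sIB j lt_j; rewrite /offset /= addn0.
  - by have /sat_lits[_] := sG j lt_j; rewrite /offset /= addn0.
  by have /sat_lits[_] := sGB j lt_j; rewrite /offset /= addn0.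
pose u m := cell_code (v (m %/ W) (m %% W)).
have uE i j : j < W -> cell_of (u (i * W + j)) = v i j.
  move=> lt_j; rewrite /u cell_codeK divnMDl// modnMDl.
  by rewrite divn_small// modn_small// addn0.
have u0E j : j < W -> cell_of (u j) = v 0 j by move=> lt_j; rewrite -(uE 0 j lt_j).
have lt_u m : u m < #|cell| by apply: cell_code_lt.
have must0 i (P : pred cell) : P (cell_of (u i)) -> sat W u i (must P).
  by move=> Pu; apply/sat_lits; rewrite /offset /= addn0.
exists u; split=> [m _|c].
  by apply: leq_trans (lt_u m) _; apply: leq_trans k_large; rewrite -addnn leq_addr.
suff sats : [/\ forall i j, i <= T -> j < h -> sat W u (i * W + j) (row_left tm_rules),
    forall i j, i <= T -> j < h -> sat W u (i * W + h + j) (row_right tm_rules) &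
    forall i, i < T * W -> sat W u i (vertical tm_rules)].
  have [sL sR sV] := sats.
  case=> [[i le_i [[j lt_j]|sh|[j lt_j]]]|].
  - exact: sL.
  - by apply: (must0 _ (@head_cell M)) sh; rewrite uE// vH.
  - exact: sR.
  case=> [[i lt_i]|]; first exact: sV.
  case=> [|[[j lt_j]|[[j lt_j]|[[j lt_j]|[[j lt_j]|[[j lt_j]|[j lt_j]]]]]]].
  - by apply: must0; rewrite uE.
  - by apply: must0; rewrite u0E ?vL//; lia.
  - have := vI j lt_j; rewrite -u0E; last lia.
    by case: ifP => _ vIj; apply: must0.
  - by apply: must0; rewrite u0E ?vIB//; lia.
  - by apply: must0; rewrite u0E ?vG//; lia.
  - by apply: must0; rewrite u0E ?vGB//; lia.
  by apply: must0; rewrite u0E ?vS.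
have right i j : i <= T -> j.+1 < W ->
    to_right (cell_of (u (i * W + j))) = to_left (cell_of (u (i * W + j.+1))).
  move=> le_i lt_j; have e := congr1 (@to_right M) (uE i j (ltnW lt_j)).
  have e' := congr1 (@to_left M) (uE i j.+1 lt_j).
  exact: etrans e (etrans (vR i j le_i lt_j) (esym e')).
split.
- move=> i j le_i lt_j; have lt_jW := ltn_trans lt_j hW.
  apply/sat_cat; split; first by apply: must0; rewrite uE ?vP// (ltn_eqF lt_j).
  apply/(@sat_agree W u _ _ _ 1 _ (lt_u _) (lt_u _)).
  rewrite -(addnA (i * W)) addn1; apply: right => //.
  by rewrite /W ltnS (leq_trans lt_j)// leq_addr.
- move=> i j le_i lt_j; have lt_jW : (h + j).+1 < W by rewrite ltnS ltn_add2l.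
  apply/(sat_cat _ _ _ [:: _]); rewrite -(addnA (i * W)); split.
    apply/sat_lits; split=> //; rewrite -(addnA (i * W)) addn1 uE// vP//.
    by rewrite gtn_eqF// ltnS leq_addr.
  apply/(@sat_agree W u _ _ _ 1 _ (lt_u _) (lt_u _)).
  by rewrite -(addnA (i * W)) addn1; apply: right.
move=> i lt_i; apply/(@sat_agree W u _ _ _ 2 _ (lt_u _) (lt_u _)).
have e : cell_of (u (i + W)) = v (i %/ W).+1 (i %% W).
  by rewrite cell_codeK modnDr divnDr ?dvdnn// divnn addn1.
have e0 : cell_of (u i) = v (i %/ W) (i %% W) by apply: cell_codeK.
have lt_q : i %/ W < T by rewrite ltn_divLR.
have lt_r : i %% W < W by apply: ltn_pmod.
rewrite (congr1 (@next_cell M) e0) (vV _ _ lt_q lt_r).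
exact: esym (congr1 (@current M) e).
Qed.

End Instance.
End Encoding.

(** * The reduction *)

Lemma leq_evaln p m n : m <= n -> evaln p m <= evaln p n.
Proof.
move=> le_mn; elim/poly_ind: p => [|p c IHp]; first by rewrite /evaln !horner0.
by rewrite !hornerDn !hornerMn !hornerXn !hornerCn leq_add2r leq_mul.
Qed.

Lemma hornern_comp (p q : {poly nat}) n : evaln (p \Po q)%R n = evaln p (evaln q n).
Proof. exact: horner_comp. Qed.

Lemma iter_halted (M : TM) (c : config M) t : tm_halt c.1 -> iter t (@tm_step M) c = c.
Proof. by move=> c_halt; elim: t => //= t ->; rewrite /tm_step c_halt. Qed.

Lemma accepting_outputs (M : TM) x y t T b :
  tm_outputs M [:: x; y] t [:: b] -> t <= T -> accepting (run_config M x y T) <-> b.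
Proof.
move=> [halted out] le_tT; rewrite /run_config -(subnK le_tT) iterD iter_halted//.
by rewrite /accepting out; split=> [[_ []]|-> //].
Qed.

(** The equation says [beta = alpha k - w (1 - alpha)]. Taking [k] at least the inverse of [alpha]
    makes [alpha k - 1] nonnegative; then [w] is the positive integer for which [w (1 - alpha)]
    exceeds [alpha k - 1] by at most [1 - alpha], which puts [beta] between [alpha] and 1, with 1
    excluded. *)
Lemma gadget_mass_split (R : realType) (alpha : R) m : (0 < alpha < 1)%R ->
  exists k w (beta : R), [/\ m <= k, 0 < w, (0 < beta < 1)%R &
    (alpha * (gadget_mass k w)%:R = w%:R + beta)%R].
Proof.
move=> /andP[alpha_gt0 alpha_lt1].
pose k := maxn m (Num.truncn alpha^-1).+1; pose g : R := (alpha * k%:R - 1)%R.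
pose w := (Num.truncn (g / (1 - alpha))).+1; pose beta : R := (alpha * k%:R - w%:R * (1 - alpha))%R.
have g_ge0 : (0 <= g)%R.
  rewrite /g subr_ge0 -ler_pdivrMl// mulr1.
  have /andP[_ /ltW le_a] : ((Num.truncn alpha^-1)%:R <= alpha^-1 < (Num.truncn alpha^-1).+1%:R)%R.
    by apply: truncn_itv; rewrite invr_ge0 ltW.
  by apply: le_trans le_a _; rewrite ler_nat leq_maxr.
have d_gt0 : (0 < 1 - alpha)%R by rewrite subr_gt0.
have := truncn_itv (divr_ge0 g_ge0 (ltW d_gt0)).
rewrite ler_pdivlMr// ltr_pdivrMr// => /andP[a b].
exists k, w, beta; split=> //; first exact: leq_maxl.
  rewrite /beta /w -natr1; move: a b; rewrite -natr1 /g; lra.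
by rewrite /beta /gadget_mass natrD; lra.
Qed.

Local Open Scope ring_scope.

Theorem theorem5p1 (R : realType) (alpha : R) (halpha : 0 < alpha < 1) :
  NP_hard (ICD alpha).
Proof.
move=> L' [V [[M [pM VM]] [p L'V]]].
have [k [w [beta [k_large w_gt0 beta01 massE]]]] := gadget_mass_split #|cell M|.*2%N halpha.
(* The height of the tableau may depend only on the length of the input: by monotonicity, the time
   for the longest admissible certificate suffices for all of them. *)
pose pT : {poly nat} := pM \Po ('X + p).
exists (fun x => run (reduction k w (tm_rules M) pT p) (init_regs x) 0); split.
  exact: reduction_polytime w_gt0 (tm_rules_ok k_large).
move=> x; have [L LP ->] := reduction_correct pT p w_gt0 (tm_rules_ok k_large) x.
set n := size x in LP *; set T := evaln pT n in LP *; set B := evaln p n in LP *.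
have accept_V y : (size y <= B)%N -> accepting (run_config M x y T) <-> V x y.
  move=> le_y; apply: accepting_outputs (VM x y) _.
  by rewrite /T hornern_comp hornerDn hornerXn; apply: leq_evaln; rewrite leq_add2l.
have wf : csp_wf k (cells pT p x) _ := @csp_wf_tableau M k k_large T B x.
rewrite L'V (gadget_ICD wf w_gt0 halpha beta01 massE LP).
rewrite -[X in gadget_csp _ X]/(T.+1 * (n + B + T + 1 + (n + B + T + 1)).+1)%N.
rewrite tableau_grid//; split=> [[y [le_y Vxy]]|[v [v_rows v_start]]].
  have [v] := grid_of_run le_y ((accept_V y le_y).2 Vxy); by exists v.
have [y le_y /(accept_V y le_y)] := run_of_grid v_rows v_start; by exists y.
Qed.
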